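(* Let $(A,\mathfrak m,k)$ be a non-regular Gorenstein local ring of dimension $d\ge 1$ and let $I$ be an $\mathfrak m$-primary ideal. Let $E$ be a maximal Cohen-Macaulay $A$-module such that $r_\infty^{I,A}(E)\le d-q$ for some integer $q\ge 1$. Then there exists an integer $\eta$, depending only on $I$ and $A$, such that for every maximal Cohen-Macaulay $A$-module $M\in\operatorname{thick}(E)$, $$\max\{a_d(G_I(M)),\ldots,a_{d-q+1}(G_I(M))\}\le\eta.$$
   Context: All rings are commutative Noetherian and all modules are finitely generated. $\lambda(-)$ denotes length. $\underline{\operatorname{CM}}(A)$ is the stable category of maximal Cohen-Macaulay (MCM) $A$-modules (objects: MCM $A$-modules; morphisms: $A$-linear maps modulo those factoring through a finitely generated free module), a triangulated category with translation functor $\Omega^{-1}$. For $E\in\underline{\operatorname{CM}}(A)$, $\operatorname{thick}(E)$ is the intersection of all thick subcategories of $\underline{\operatorname{CM}}(A)$ containing $E$. For $i\ge0$, $\Omega^i$ is the $i$-th (minimal) syzygy; for an MCM module $X$, with $X^*=\operatorname{Hom}_A(X,A)$, the cosyzygy is $\Omega^{-1}X=(\Omega(X^* ))^*$, and $\Omega^{-i}X=\Omega^{-1}(\Omega^{-(i-1)}X)$. For an MCM $A$-module $M$, the function $n\mapsto\lambda(\operatorname{Tor}_1^A(M,A/I^n))$ is known to agree with a polynomial for $n\gg0$, whose degree is denoted $r_1^{I,A}(M)$ (the zero polynomial has degree $-1$), and $r_\infty^{I,A}(M)=\sup\{r_1^{I,A}(\Omega^sM): s\in\mathbb Z\}$.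 $G_I(A)=\bigoplus_{n\ge0}I^n/I^{n+1}$ is the associated graded ring, $G_I(A)_+=\bigoplus_{n\ge1}I^n/I^{n+1}$, and $G_I(M)=\bigoplus_{n\ge0}I^nM/I^{n+1}M$ is the associated graded module, a graded $G_I(A)$-module. $a_i(G_I(M))=\max\{n : H^i_{G_I(A)_+}(G_I(M))_n\ne0\}$ (equal to $-\infty$ if this local cohomology module is zero). *)

(* Defs.v *)
From HB Require Import structures.
From mathcomp Require Import all_boot all_order all_algebra.
From mathcomp Require Import generic_quotient ring_quotient.
From mathcomp Require Import mathcomp_extra boolp classical_sets functions.
From mathcomp Require Import constructive_ereal.

Set Implicit Arguments.
Unset Strict Implicit.
Unset Printing Implicit Defensive.

Import Order.TTheory GRing.Theory Num.Theory.
Local Open Scope classical_set_scope.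
Local Open Scope ring_scope.
Local Open Scope quotient_scope.
#[local] Obligation Tactic := idtac.

(* Supremum of a set of integers in Z u {-oo, +oo}; it is the maximum when S
   is nonempty and bounded above.  The default value of xget is never used. *)
Definition int_sup (S : set int) : \bar int :=
  xget +oo%E [set u : \bar int |
    (forall n, S n -> (n%:E <= u)%E) /\
    (forall v : \bar int, (forall n, S n -> (n%:E <= v)%E) -> (u <= v)%E)].

Definition is_max (P : nat -> Prop) (n : nat) : Prop :=
  P n /\ forall k, P k -> (k <= n)%N.

Record submodule (A : comNzRingType) (V : lmodType A) := Submodule {
  smod_pred :> V -> Prop;
  smod0 : smod_pred 0;
  smodP : forall a x y, smod_pred x -> smod_pred y -> smod_pred (a *: x + y) }.

Section Submodule.
Variables (A : comNzRingType) (V : lmodType A) (N : submodule V).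

Lemma smodZ a x : N x -> N (a *: x).
Proof. by move=> Nx; rewrite -[_ *: _]addr0; apply: smodP Nx (smod0 N). Qed.

Lemma smodD x y : N x -> N y -> N (x + y).
Proof. by move=> Nx Ny; rewrite -[x]scale1r; apply: smodP. Qed.

Lemma smodB x y : N x -> N y -> N (x - y).
Proof. by move=> Nx Ny; rewrite addrC -scaleN1r; apply: smodP. Qed.

Definition smem : {pred V} := fun x => `[< N x >].

Lemma smemP x : reflect (N x) (x \in smem).
Proof. exact: asboolP. Qed.

Lemma smem_closed : submod_closed smem.
Proof.
split=> [|a x y /smemP xN /smemP yN]; apply/smemP; first exact: smod0.
exact: smodP.
Qed.
HB.instance Definition _ := GRing.isSubmodClosed.Build A V smem smem_closed.

Record smod_type := SmodType { smod_val : V; _ : smod_val \in smem }.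
HB.instance Definition _ := [isSub for smod_val].
HB.instance Definition _ := [Choice of smod_type by <:].
HB.instance Definition _ := [SubChoice_isSubLmodule of smod_type by <:].

Definition quot_mod := Quotient.quot smem.
HB.instance Definition _ := GRing.Zmodule.on quot_mod.
HB.instance Definition _ := EqQuotient.on quot_mod.

Definition quot_scale (a : A) (x : quot_mod) : quot_mod :=
  \pi_quot_mod (a *: repr x).

Lemma quot_eqP x y : reflect (N (x - y)) (x == y %[mod quot_mod]).
Proof. by rewrite -Quotient.idealrBE; apply: smemP. Qed.

Lemma quot_scale_pi a x : quot_scale a (\pi_quot_mod x) = \pi_quot_mod (a *: x).
Proof.
apply/eqP/quot_eqP; rewrite -scalerBr; apply: smodZ; apply/quot_eqP.
by rewrite reprK.
Qed.

Lemma quot_piD x y : \pi_quot_mod (x + y) = \pi_quot_mod x + \pi_quot_mod y.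
Proof. exact: raddfD. Qed.

Fact quot_scaleA a b x : quot_scale a (quot_scale b x) = quot_scale (a * b) x.
Proof.
by rewrite -[x]reprK (quot_scale_pi b) (quot_scale_pi a) (quot_scale_pi (a * b)) scalerA.
Qed.
Fact quot_scale1 : left_id 1 quot_scale.
Proof. by move=> x; rewrite -[x]reprK quot_scale_pi scale1r. Qed.
Fact quot_scaleDr : right_distributive quot_scale +%R.
Proof.
move=> a x y; rewrite -[x]reprK -[y]reprK -quot_piD.
by rewrite !(quot_scale_pi, quot_piD) scalerDr quot_piD.
Qed.
Fact quot_scaleDl x : {morph quot_scale^~ x : a b / a + b}.
Proof.
by move=> a b; rewrite -[x]reprK !quot_scale_pi scalerDl quot_piD.
Qed.
HB.instance Definition _ := GRing.Zmodule_isLmodule.Build A quot_mod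
  quot_scaleA quot_scale1 quot_scaleDr quot_scaleDl.
End Submodule.

Section SubmoduleOps.
Variable A : comNzRingType.
Implicit Types V W : lmodType A.

Definition full_smod V : submodule V :=
  @Submodule A V (fun=> True) I (fun _ _ _ _ _ => I).

Program Definition span V (S : set V) : submodule V :=
  @Submodule A V (fun x => forall N : submodule V, (forall s, S s -> N s) -> N x) _ _.
Next Obligation. by move=> V S N _; exact: smod0. Qed.
Next Obligation.
by move=> V S a x y Sx Sy N SN; apply: smodP; [exact: Sx|exact: Sy].
Qed.

Program Definition preim_smod V W (f : {linear V -> W}) (N : submodule W) :
  submodule V := @Submodule A V (fun x => N (f x)) _ _.
Next Obligation. by move=> V W f N /=; rewrite linear0; exact: smod0. Qed.
Next Obligation. by move=> V W f N a x y Nx Ny /=; rewrite linearP; exact: smodP. Qed.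

Program Definition ker_smod V W (f : {linear V -> W}) : submodule V :=
  @Submodule A V (fun x => f x = 0) _ _.
Next Obligation. by move=> V W f /=; rewrite linear0. Qed.
Next Obligation.
by move=> V W f a x y fx fy /=; rewrite linearP fx fy scaler0 addr0.
Qed.

Program Definition im_smod V W (f : {linear V -> W}) : submodule W :=
  @Submodule A W (fun y => exists x, f x = y) _ _.
Next Obligation. by move=> V W f /=; exists 0; rewrite linear0. Qed.
Next Obligation.
by move=> V W f a _ _ [x <-] [y <-] /=; exists (a *: x + y); rewrite linearP.
Qed.

(* Z / (Z :&: B), which is Z / B when B is contained in Z. *)
Definition subquot V (Z B : submodule V) : lmodType A :=
  quot_mod (preim_smod (\val : smod_type Z -> V) B).

Definition smod_le V (N N' : submodule V) := forall x, N x -> N' x.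
Definition smod_lt V (N N' : submodule V) := smod_le N N' /\ ~ smod_le N' N.
Definition smod_eq V (N N' : submodule V) := forall x, N x <-> N' x.

Definition has_chain V (P : submodule V -> Prop) (n : nat) : Prop :=
  exists2 N : nat -> submodule V, (forall i, (i <= n)%N -> P (N i))
    & (forall i, (i < n)%N -> smod_lt (N i) (N i.+1)).

Definition has_length V (l : nat) : Prop :=
  is_max (has_chain (fun _ : submodule V => True)) l.

Definition fin_gen V (N : submodule V) : Prop :=
  exists n (x : 'I_n -> V), smod_eq N (span (range x)).

Definition is_zero V : Prop := forall x : V, x = 0.

Definition mod_iso V W : Prop := exists f : {linear V -> W}, bijective f.

Definition ideal := submodule A^o.

Definition mul_smod V (J : ideal) (N : submodule V) : submodule V :=
  span [set z | exists a x, [/\ J a, N x & z = (a : A) *: x]].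

Definition ideal_pow (J : ideal) (n : nat) : ideal :=
  iter n (mul_smod J) (full_smod A^o).
End SubmoduleOps.
Arguments full_smod {A} V.
Arguments is_zero {A} V.
Arguments has_length {A} V l.

Section CommutativeAlgebra.
Variable A : comNzRingType.
Implicit Types J P m : ideal A.

Definition noetherian : Prop := forall J, fin_gen J.

Definition proper_smod J : Prop := ~ J 1.

Definition maximal_ideal J : Prop :=
  proper_smod J /\ forall K : ideal A, smod_le J K -> proper_smod K -> smod_le K J.

Definition prime_ideal J : Prop :=
  proper_smod J /\ forall a b : A, J (a * b) -> J a \/ J b.

Definition radical J (a : A) : Prop := exists n, J (a ^+ n).

Definition primary_ideal J : Prop :=
  proper_smod J /\ forall a b : A, J (a * b) -> J a \/ radical J b.

Definition local_ring m : Prop :=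
  maximal_ideal m /\ forall P, maximal_ideal P -> smod_eq P m.

Definition primary_to m J : Prop :=
  primary_ideal J /\ forall a, radical J a <-> m a.

Definition krull_dim (d : nat) : Prop := is_max (has_chain prime_ideal) d.

Definition regular_local m : Prop :=
  exists2 d, krull_dim d & exists x : 'I_d -> A^o, smod_eq m (span (range x)).

Definition regular_seq m (M : lmodType A) (n : nat) (x : nat -> A) : Prop :=
  let xM i := mul_smod (span [set a : A^o | exists2 j, (j < i)%N & a = x j])
                (full_smod M) in
  [/\ forall i, (i < n)%N -> m (x i),
      forall i, (i < n)%N -> forall y : M, xM i (x i *: y) -> xM i y
    & exists y : M, ~ xM n y].

Definition depth m (M : lmodType A) (n : nat) : Prop :=
  is_max (fun k => exists x, regular_seq m M k x) n.

(* The zero module is maximal Cohen-Macaulay (depth 0 = +oo). *)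
Definition MCM m (M : lmodType A) : Prop :=
  fin_gen (full_smod M) /\
  (is_zero M \/ exists2 d, krull_dim d & depth m M d).

Definition injective_module (J : lmodType A) : Prop :=
  forall (X Y : lmodType A) (u : {linear X -> Y}) (f : {linear X -> J}),
    injective u -> exists g : {linear Y -> J}, forall x, g (u x) = f x.

Definition finite_injective_dim (M : lmodType A) : Prop :=
  exists n (J : nat -> lmodType A) (e : {linear M -> J 0})
    (d : forall i, {linear J i -> J i.+1}),
  [/\ forall i, injective_module (J i),
      forall i, (n < i)%N -> is_zero (J i),
      injective e,
      smod_eq (ker_smod (d 0)) (im_smod e)
    & forall i, smod_eq (ker_smod (d i.+1)) (im_smod (d i))].

Definition gorenstein : Prop := finite_injective_dim A^o.
End CommutativeAlgebra.
Arguments noetherian A : clear implicits.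
Arguments krull_dim A d : clear implicits.
Arguments gorenstein A : clear implicits.

Section Syzygies.
Variables (A : comNzRingType) (m : ideal A).
Implicit Types X Y Z K : lmodType A.

Record min_cover X := MinCover {
  cover_rank : nat;
  cover_map :> {linear 'rV[A]_cover_rank -> X};
  cover_surj : forall x, exists v, cover_map v = x;
  cover_min : forall v, cover_map v = 0 -> forall i, m (v 0 i) }.

Definition syz X (c : min_cover X) : lmodType A := smod_type (ker_smod c).

Program Definition linear_smod X : submodule (X -> A^o) :=
  @Submodule A (X -> A^o) (fun f => forall a x y, f (a *: x + y) = a *: f x + f y) _ _.
Next Obligation.
move=> X a x y; change ((0 : A^o) = a *: (0 : A^o) + 0).
by rewrite scaler0 addr0.
Qed.
Next Obligation.
move=> X a f g flin glin b x y; change (a *: f (b *: x + y) + g (b *: x + y) =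
  b *: (a *: f x + g x) + (a *: f y + g y)).
rewrite flin glin.
by rewrite !scalerDr !scalerA [b * a]mulrC addrACA.
Qed.

Definition dual X : lmodType A := smod_type (linear_smod X).

Section Cosyzygy.
Variables (X : lmodType A) (c : min_cover (dual X)).

(* Dualizing 0 -> K -> F -> X^* -> 0, where F = A^n -> X^* is the cover c,
   gives 0 -> X -> F^* -> K^* -> 0 with F^* = A^n (via dual bases) and X
   identified with X^**. *)
Definition cosyz : lmodType A := dual (syz c).

Definition cosyz_in (x : X) : 'rV[A]_(cover_rank c) :=
  \row_i smod_val (c (delta_mx 0 i)) x.

Fact cosyz_out_proof (v : 'rV[A]_(cover_rank c)) :
  (fun k : syz c => \sum_i v 0 i * smod_val k 0 i) \in smem (linear_smod (syz c)).
Proof.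
apply/smemP => a x y; rewrite scaler_sumr -big_split; apply: eq_bigr => i _ /=.
by rewrite !mxE mulrDr mulrCA.
Qed.
Definition cosyz_out v : cosyz := SmodType (cosyz_out_proof v).
End Cosyzygy.
Arguments cosyz_in {X} c x.
Arguments cosyz_out {X} c v.

Definition is_syz X Y : Prop := exists c : min_cover X, mod_iso Y (syz c).

Definition is_cosyz X Y : Prop :=
  exists c : min_cover (dual X), mod_iso Y (cosyz c).

(* Y is isomorphic to Omega^s X. *)
Definition is_Omega (s : int) X Y : Prop :=
  match s with
  | Posz n => iter n (fun R Z => exists2 K, R K & is_syz K Z) (mod_iso X) Y
  | Negz n => iter n.+1 (fun R Z => exists2 K, R K & is_cosyz K Z) (mod_iso X) Y
  end.

(* Two maps are identified when their difference factors through A^n. *)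
Definition stable_eq X Y (f g : X -> Y) : Prop :=
  exists n (h : {linear X -> 'rV[A]_n}) (k : {linear 'rV[A]_n -> Y}),
    forall x, f x - g x = k (h x).

Definition stable_inv X Y (f : X -> Y) (g : Y -> X) : Prop :=
  stable_eq (g \o f) idfun /\ stable_eq (f \o g) idfun.

Definition stable_iso X Y (f : {linear X -> Y}) : Prop :=
  exists g : {linear Y -> X}, stable_inv f g.

(* b represents the image of (the stable class of) a under Omega^{-1}. *)
Definition is_shift X Y (cX : min_cover (dual X)) (cY : min_cover (dual Y))
    (a : {linear X -> Y}) (b : {linear cosyz cX -> cosyz cY}) : Prop :=
  exists q : {linear 'rV[A]_(cover_rank cX) -> 'rV[A]_(cover_rank cY)},
    (forall x, q (cosyz_in cX x) = cosyz_in cY (a x)) /\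
    (forall v, b (cosyz_out cX v) = cosyz_out cY (q v)).

(* X -f-> Y -g-> Z -h-> Omega^{-1} X where Z is the pushout of f and of the
   embedding of X in the free module F^*. *)
Definition standard_triangle X Y Z (c : min_cover (dual X))
    (f : {linear X -> Y}) (g : {linear Y -> Z}) (h : {linear Z -> cosyz c}) : Prop :=
  exists j : {linear 'rV[A]_(cover_rank c) -> Z},
  [/\ forall z, exists y v, z = g y + j v,
      forall y v, g y + j v = 0 <-> exists x, y = f x /\ v = - cosyz_in c x,
      forall y, h (g y) = 0
    & forall v, h (j v) = cosyz_out c v].

Definition distinguished X Y Z (c : min_cover (dual X))
    (u : {linear X -> Y}) (v : {linear Y -> Z}) (w : {linear Z -> cosyz c}) : Prop :=
  exists (X' Y' Z' : lmodType A) (c' : min_cover (dual X'))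
    (f : {linear X' -> Y'}) (g : {linear Y' -> Z'}) (h : {linear Z' -> cosyz c'})
    (a : {linear X -> X'}) (b : {linear Y -> Y'}) (e : {linear Z -> Z'})
    (sa : {linear cosyz c -> cosyz c'}),
  [/\ [/\ MCM m X', MCM m Y' & MCM m Z'],
      standard_triangle f g h /\ is_shift a sa,
      [/\ stable_iso a, stable_iso b & stable_iso e]
    & [/\ stable_eq (b \o u) (f \o a), stable_eq (e \o v) (g \o b)
        & stable_eq (sa \o w) (h \o e)]].

(* A full triangulated subcategory, closed under isomorphism and under direct
   summands, given by its objects; X * Y is the direct sum. *)
Record thick_subcat (P : lmodType A -> Prop) : Prop := {
  thick_MCM : forall X, P X -> MCM m X;
  thick0 : P 'rV[A]_0;
  thick_iso : forall X Y (f : {linear X -> Y}),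
    MCM m Y -> stable_iso f -> P X -> P Y;
  thick_syz : forall X Y, is_syz X Y -> P X -> P Y;
  thick_cosyz : forall X Y, is_cosyz X Y -> P X -> P Y;
  thick_triangle : forall X Y Z (c : min_cover (dual X))
      (u : {linear X -> Y}) (v : {linear Y -> Z}) (w : {linear Z -> cosyz c}),
    MCM m X -> MCM m Y -> MCM m Z -> distinguished u v w ->
    [/\ P X -> P Y -> P Z, P Y -> P Z -> P X & P X -> P Z -> P Y];
  thick_summand : forall X Y, MCM m X -> MCM m Y -> P (X * Y)%type -> P X }.

Definition thick (E M : lmodType A) : Prop :=
  forall P, thick_subcat P -> P E -> P M.
End Syzygies.

Section Tor.
Variable A : comNzRingType.
Implicit Types M N : lmodType A.

Record free_res M := FreeRes {
  res_rank : nat -> nat;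
  res_d : forall i, 'M[A]_(res_rank i.+1, res_rank i);
  res_aug : {linear 'rV[A]_(res_rank 0) -> M};
  _ : forall x, exists v, res_aug v = x;
  _ : forall v, res_aug v = 0 <-> exists w, w *m res_d 0 = v;
  _ : forall i (v : 'rV[A]_(res_rank i.+1)),
    v *m res_d i = 0 <-> exists w, w *m res_d i.+1 = v }.

(* Resolutions consist of free modules A^p of row vectors, with matrices acting
   on the right, and A^p (x) N is identified with N^p; this is the map induced by D. *)
Definition mx_tensor N p q (D : 'M[A]_(p, q)) (v : 'I_p -> N) : 'I_q -> N :=
  fun j => \sum_i D i j *: v i.

Fact mx_tensor_is_linear N p q (D : 'M[A]_(p, q)) : linear (@mx_tensor N p q D).
Proof.
move=> a u v; apply/funext => j.
change (\sum_i D i j *: (a *: u i + v i) =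
  a *: (\sum_i D i j *: u i) + \sum_i D i j *: v i).
rewrite scaler_sumr -big_split; apply: eq_bigr => i _ /=.
by rewrite scalerDr !scalerA mulrC.
Qed.
HB.instance Definition _ N p q (D : 'M[A]_(p, q)) :=
  GRing.isLinear.Build A ('I_p -> N) ('I_q -> N) _ (@mx_tensor N p q D)
    (mx_tensor_is_linear D).

(* H_1 (F (x) N). *)
Definition Tor1 M (F : free_res M) N : lmodType A :=
  subquot (ker_smod (mx_tensor (N := N) (res_d F 0)))
          (im_smod (mx_tensor (N := N) (res_d F 1))).

Definition Tor1_length M N (l : nat) : Prop :=
  exists F : free_res M, has_length (Tor1 F N) l.

(* size p - 1 is the degree of p, and -1 when p = 0. *)
Definition is_r1 (I : ideal A) M (r : int) : Prop :=
  exists (p : {poly rat}) (n0 : nat),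
    (forall n, (n0 <= n)%N -> exists2 l : nat,
       Tor1_length M (quot_mod (ideal_pow I n)) l & p.[n%:R] = l%:R) /\
    r = (size p)%:Z - 1.

Definition r_infty (m I : ideal A) M : \bar int :=
  int_sup [set r | exists s N, is_Omega m s M N /\ is_r1 I N r].
End Tor.

(* N-graded commutative rings and Z-graded modules, given by their homogeneous
   components.  The index equations i + j = k make associativity
   expressible without casts. *)
Record grRing := GrRing {
  gr_ob :> nat -> zmodType;
  gr_one : gr_ob 0;
  gr_mul : forall i j k, (i + j = k)%N -> gr_ob i -> gr_ob j -> gr_ob k;
  gr_mulDr : forall i j k (e : (i + j = k)%N) a,
    {morph gr_mul e a : b c / b + c};
  gr_mulC : forall i j k (e : (i + j = k)%N) (e' : (j + i = k)%N) a b,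
    gr_mul e a b = gr_mul e' b a;
  gr_mulA : forall i j l ij jl k (e1 : (i + j = ij)%N) (e2 : (ij + l = k)%N)
      (e3 : (j + l = jl)%N) (e4 : (i + jl = k)%N) a b c,
    gr_mul e2 (gr_mul e1 a b) c = gr_mul e4 a (gr_mul e3 b c);
  gr_mul1 : forall i (e : (0 + i = i)%N) a, gr_mul e gr_one a = a }.

Record grMod (G : grRing) := GrMod {
  gm_ob :> int -> zmodType;
  gm_act : forall (i : nat) (j k : int), i%:Z + j = k -> G i -> gm_ob j -> gm_ob k;
  gm_actDr : forall i j k (e : i%:Z + j = k) a,
    {morph gm_act e a : x y / x + y};
  gm_actDl : forall i j k (e : i%:Z + j = k) x,
    {morph (fun a => gm_act e a x) : a b / a + b};
  gm_actA : forall (i j ij : nat) (l jl k : int) (e1 : (i + j = ij)%N)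
      (e2 : ij%:Z + l = k) (e3 : j%:Z + l = jl) (e4 : i%:Z + jl = k) a b x,
    gm_act e2 (gr_mul e1 a b) x = gm_act e4 a (gm_act e3 b x);
  gm_act1 : forall j (e : 0%:Z + j = j) x, gm_act e (gr_one G) x = x }.

Section GradedModules.
Variable G : grRing.
Implicit Types X Y J : grMod G.

Record grHom X Y := GrHom {
  gh_fun :> forall n, X n -> Y n;
  gh_add : forall n, {morph @gh_fun n : x y / x + y};
  gh_act : forall i j k (e : i%:Z + j = k) a x,
    gh_fun (gm_act e a x) = gm_act e a (gh_fun x) }.
Arguments gh_fun {X Y} g n x : rename.

Definition gr_mono X Y (u : grHom X Y) : Prop := forall n, injective (u n).

Definition gr_injective J : Prop :=
  forall X Y (u : grHom X Y) (f : grHom X J), gr_mono u ->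
    exists g : grHom Y J, forall n x, g n (u n x) = f n x.

Record gr_inj_res X := GrInjRes {
  gir_ob : nat -> grMod G;
  gir_aug : grHom X (gir_ob 0);
  gir_d : forall i, grHom (gir_ob i) (gir_ob i.+1);
  gir_inj : forall i, gr_injective (gir_ob i);
  gir_mono : gr_mono gir_aug;
  gir_exact0 : forall n (y : gir_ob 0 n),
    gir_d 0 n y = 0 <-> exists x, gir_aug n x = y;
  gir_exact : forall i n (y : gir_ob i.+1 n),
    gir_d i.+1 n y = 0 <-> exists x, gir_d i n x = y }.

(* (G_+)^t x = 0. *)
Fixpoint killed X (t : nat) : forall n, X n -> Prop :=
  match t with
  | 0%N => fun n x => x = 0
  | t'.+1 => fun n x => forall (i : nat) k (e : i%:Z + n = k) (a : G i),
      (0 < i)%N -> killed t' (gm_act e a x)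
  end.

(* The degree n part of Gamma_{G_+}(X). *)
Definition Gamma_plus X n (x : X n) : Prop := exists t, killed t x.

(* For x in Gamma_{G_+}: x is a coboundary of the complex Gamma_{G_+}(R). *)
Definition is_coboundary X (R : gr_inj_res X) (i : nat) n :
    gir_ob R i n -> Prop :=
  match i with
  | 0%N => fun x => x = 0
  | i'.+1 => fun x => exists2 y, Gamma_plus y & gir_d R i' n y = x
  end.

(* H^i_{G_+}(X)_n <> 0, where H^i_{G_+} is the i-th right derived functor of
   Gamma_{G_+} on graded modules. *)
Definition loc_coh_neq0 X (i : nat) (n : int) : Prop :=
  exists (R : gr_inj_res X) (x : gir_ob R i n),
    [/\ Gamma_plus x, gir_d R i n x = 0 & ~ is_coboundary x].

Definition a_inv X (i : nat) : \bar int := int_sup [set n | loc_coh_neq0 X i n].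
End GradedModules.

Section SubquotTheory.
Variables (A : comNzRingType) (V : lmodType A) (Z B : submodule V).

Local Notation Q := (quot_mod (preim_smod (\val : smod_type Z -> V) B)).

(* The class of v in Z / (Z :&: B) when v is in Z. *)
Definition cls (v : V) : subquot Z B := \pi_Q (insubd 0 v).

Definition rep (q : subquot Z B) : V := \val (repr (q : Q)).

Lemma rep_in q : Z (rep q).
Proof. by apply/smemP; exact: (valP (repr (q : Q))). Qed.

Lemma val_insubd0 v : Z v -> \val (insubd (0 : smod_type Z) v) = v.
Proof. by move=> /smemP Zv; rewrite val_insubd Zv. Qed.

Lemma cls_eq v w : Z v -> Z w -> B (v - w) -> cls v = cls w.
Proof.
move=> Zv Zw Bvw; apply/eqP/quot_eqP.
change (B (\val (insubd (0 : smod_type Z) v - insubd 0 w))).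
by rewrite raddfB /= !val_insubd0.
Qed.

Lemma repK q : cls (rep q) = q.
Proof.
rewrite /cls /rep valKd; exact: (reprK (q : Q)).
Qed.

Lemma rep_cls v : Z v -> B (rep (cls v) - v).
Proof.
move=> Zv; have /eqP/quot_eqP := reprK (cls v : Q).
change (B (\val (repr (cls v : Q) - insubd (0 : smod_type Z) v)) -> B (rep (cls v) - v)).
by rewrite raddfB /= val_insubd0.
Qed.

Lemma clsP q : exists2 v, Z v & q = cls v.
Proof. by exists (rep q); [exact: rep_in | rewrite repK]. Qed.

Lemma clsD v w : Z v -> Z w -> cls (v + w) = cls v + cls w.
Proof.
move=> Zv Zw; rewrite /cls.
have -> : insubd (0 : smod_type Z) (v + w) = insubd 0 v + insubd 0 w.
  by apply: val_inj; rewrite raddfD /= !val_insubd0 //; exact: smodD.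
exact: quot_piD.
Qed.
End SubquotTheory.

Section SubquotScale.
Variables (A : comNzRingType) (M : lmodType A).
Variables (Z1 B1 : ideal A) (Z2 B2 Z3 B3 : submodule M).

(* Multiplication Z1/B1 x Z2/B2 -> Z3/B3 induced by scaling. *)
Definition subquot_scale (q : subquot Z1 B1) (x : subquot Z2 B2) : subquot Z3 B3 :=
  cls Z3 B3 ((rep q : A) *: rep x).

Hypothesis ZZ : forall (a : A) x, Z1 a -> Z2 x -> Z3 (a *: x).
Hypothesis BZ : forall (a : A) x, B1 a -> Z2 x -> B3 (a *: x).
Hypothesis ZB : forall (a : A) x, Z1 a -> B2 x -> B3 (a *: x).

Lemma subquot_scaleE (a : A) x : Z1 a -> Z2 x ->
  subquot_scale (cls Z1 B1 a) (cls Z2 B2 x) = cls Z3 B3 (a *: x).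
Proof.
move=> Za Zx; apply: cls_eq; [by apply: ZZ; exact: rep_in | exact: ZZ |].
set a' := rep _; set x' := rep _.
have -> : (a' : A) *: x' - a *: x = (a' - a : A) *: x' + a *: (x' - x).
  by rewrite scalerBl scalerBr addrA subrK.
by apply: smodD; [apply: BZ; [exact: rep_cls|exact: rep_in] | apply: ZB => //; exact: rep_cls].
Qed.

Lemma subquot_scaleDr q : {morph subquot_scale q : x y / x + y}.
Proof.
move=> x y; have [a Za ->] := clsP q.
have [v Zv ->] := clsP x; have [w Zw ->] := clsP y.
rewrite -clsD // !subquot_scaleE //; last exact: smodD.
by rewrite scalerDr clsD //; exact: ZZ.
Qed.

Lemma subquot_scaleDl x : {morph subquot_scale^~ x : p q / p + q}.
Proof.
move=> p q; have [v Zv ->] := clsP x.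
have [a Za ->] := clsP p; have [b Zb ->] := clsP q.
rewrite -clsD // !subquot_scaleE //; last exact: smodD.
by rewrite scalerDl clsD //; exact: ZZ.
Qed.
End SubquotScale.

Section AssociatedGraded.
Variables (A : comNzRingType) (J : ideal A).
Implicit Types M : lmodType A.

Lemma span_mem M (S : set M) x : S x -> span S x.
Proof. by move=> Sx N; apply. Qed.

Lemma mul_smodP M (K : ideal A) (N : submodule M) (a : A) x :
  K a -> N x -> mul_smod K N (a *: x).
Proof. by move=> Ka Nx; apply: span_mem; exists a, x. Qed.

Lemma mul_smod_ind M (K : ideal A) (N L : submodule M) :
  (forall (a : A) x, K a -> N x -> L (a *: x)) -> smod_le (mul_smod K N) L.
Proof. by move=> KNL x; apply => _ [a [y [Ka Ny ->]]]; exact: KNL. Qed.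

Program Definition colon_ideal M (N L : submodule M) : ideal A :=
  @Submodule A A^o (fun a => forall x, N x -> L ((a : A) *: x)) _ _.
Next Obligation. by move=> M N L x _; rewrite scale0r; exact: smod0. Qed.
Next Obligation.
move=> M N L a b c bN cN x Nx.
rewrite scalerDl -[a *: b]/(a * b) -scalerA.
by apply: smodP; [exact: bN | exact: cN].
Qed.

Program Definition colon_smod M (a : A) (L : submodule M) : submodule M :=
  @Submodule A M (fun x => L (a *: x)) _ _.
Next Obligation. by move=> M a L /=; rewrite scaler0; exact: smod0. Qed.
Next Obligation.
move=> M a L b x y Lx Ly /=; rewrite scalerDr scalerA mulrC -scalerA.
exact: smodP.
Qed.

Lemma ideal_powM i j (a b : A) :
  ideal_pow J i a -> ideal_pow J j b -> ideal_pow J (i + j) (a * b).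
Proof.
move=> Ja Jb.
suff H : smod_le (ideal_pow J i) (colon_ideal (ideal_pow J j) (ideal_pow J (i + j))).
  exact: H Ja _ Jb.
elim: i {a Ja} => [|i IH]; first by move=> a _ x Jx; apply: smodZ.
apply: mul_smod_ind => a x Ja Jx y Jy; rewrite -scalerA.
by apply: mul_smodP => //; exact: IH.
Qed.

Lemma ideal_powS i : smod_le (ideal_pow J i.+1) (ideal_pow J i).
Proof. by apply: mul_smod_ind => a x _; exact: smodZ. Qed.

Lemma ideal_pow_le i j : (i <= j)%N -> smod_le (ideal_pow J j) (ideal_pow J i).
Proof.
move=> /subnK <-; elim: (j - i)%N => [|k IH] x //.
by move=> /ideal_powS; exact: IH.
Qed.

(* I^n M, with the convention I^n = A for n < 0; then I^n M / I^(n+1) M = 0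
   for n < 0. *)
Definition powmod M (n : int) : submodule M :=
  match n with
  | Posz k => mul_smod (ideal_pow J k) (full_smod M)
  | Negz _ => full_smod M
  end.

Lemma powmodM M (i : nat) (j k : int) (a : A) (x : M) :
  i%:Z + j = k -> ideal_pow J i a -> powmod M j x -> powmod M k (a *: x).
Proof.
move=> <- Ja; case: j => [j|j] /=.
  suff H : smod_le (mul_smod (ideal_pow J j) (full_smod M))
      (colon_smod a (mul_smod (ideal_pow J (i + j)) (full_smod M))) by exact: H.
  apply: mul_smod_ind => b y Jb _.
  change (mul_smod (ideal_pow J (i + j)) (full_smod M) (a *: (b *: y))).
  by rewrite scalerA; apply: mul_smodP => //; exact: ideal_powM.
move=> _; case E: (i%:Z + Negz j) => [l|l] //.
change (mul_smod (ideal_pow J l) (full_smod M) (a *: x)).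
apply: mul_smodP => //; apply: ideal_pow_le Ja.
by rewrite -lez_nat -E NegzE lerBlDr lerDl.
Qed.

Definition assoc_gr_ob (i : nat) : lmodType A :=
  subquot (ideal_pow J i) (ideal_pow J i.+1).

Definition assoc_gm_ob M (n : int) : lmodType A :=
  subquot (powmod M n) (powmod M (n + 1)).

Definition assoc_gr_mul i j k (e : (i + j = k)%N)
    (a : assoc_gr_ob i) (b : assoc_gr_ob j) : assoc_gr_ob k :=
  subquot_scale (M := A^o) (ideal_pow J k) (ideal_pow J k.+1) a b.

Definition assoc_gm_act M i j k (e : i%:Z + j = k)
    (a : assoc_gr_ob i) (x : assoc_gm_ob M j) : assoc_gm_ob M k :=
  subquot_scale (powmod M k) (powmod M (k + 1)) a x.

Lemma assoc_gr_mulE i j k (e : (i + j = k)%N) (a b : A) :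
  ideal_pow J i a -> ideal_pow J j b ->
  assoc_gr_mul e (cls _ _ (a : A^o)) (cls _ _ (b : A^o)) = cls _ _ (a * b : A^o).
Proof.
move=> Ja Jb; apply: subquot_scaleE Ja Jb; subst k => c d Jc Jd.
- exact: ideal_powM.
- by rewrite -addSn; exact: ideal_powM.
- by rewrite -addnS; exact: ideal_powM.
Qed.

Lemma assoc_gm_actE M i j k (e : i%:Z + j = k) (a : A) (x : M) :
  ideal_pow J i a -> powmod M j x ->
  assoc_gm_act e (cls _ _ (a : A^o)) (cls _ _ x) = cls _ _ (a *: x).
Proof.
move=> Ja Jx; apply: subquot_scaleE Ja Jx => c d Jc Jd.
- exact: powmodM e _ _.
- by apply: powmodM Jc Jd; rewrite -e -addn1 PoszD addrAC.
- by apply: powmodM Jc Jd; rewrite -e addrA.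
Qed.

Program Definition assoc_gr : grRing :=
  @GrRing assoc_gr_ob (cls _ _ (1 : A^o)) assoc_gr_mul _ _ _ _.
Next Obligation.
move=> i j k e a; subst k; apply: subquot_scaleDr => c d Jc Jd.
- exact: ideal_powM.
- by rewrite -addSn; exact: ideal_powM.
- by rewrite -addnS; exact: ideal_powM.
Qed.
Next Obligation.
move=> i j k e e' a b; have [c Jc ->] := clsP a; have [d Jd ->] := clsP b.
by rewrite !assoc_gr_mulE // mulrC.
Qed.
Next Obligation.
move=> i j l ij jl k e1 e2 e3 e4 a b c; have [a' Ja ->] := clsP a.
have [b' Jb ->] := clsP b; have [c' Jc ->] := clsP c.
have Jab : ideal_pow J ij (a' * b') by rewrite -e1; exact: ideal_powM.
have Jbc : ideal_pow J jl (b' * c') by rewrite -e3; exact: ideal_powM.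
rewrite (assoc_gr_mulE e1 Ja Jb) (assoc_gr_mulE e2 Jab Jc).
by rewrite (assoc_gr_mulE e3 Jb Jc) (assoc_gr_mulE e4 Ja Jbc) mulrA.
Qed.
Next Obligation.
by move=> i e a; have [a' Ja ->] := clsP a; rewrite assoc_gr_mulE // mul1r.
Qed.

Program Definition assoc_gm M : grMod assoc_gr :=
  @GrMod assoc_gr (assoc_gm_ob M) (@assoc_gm_act M) _ _ _ _.
Next Obligation.
move=> M i j k e a; apply: subquot_scaleDr => c d Jc Jd.
- exact: powmodM e _ _.
- by apply: powmodM Jc Jd; rewrite -e -addn1 PoszD addrAC.
- by apply: powmodM Jc Jd; rewrite -e addrA.
Qed.
Next Obligation.
move=> M i j k e x; apply: subquot_scaleDl => c d Jc Jd.
- exact: powmodM e _ _.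
- by apply: powmodM Jc Jd; rewrite -e -addn1 PoszD addrAC.
- by apply: powmodM Jc Jd; rewrite -e addrA.
Qed.
Next Obligation.
move=> M i j ij l jl k e1 e2 e3 e4 a b x; have [a' Ja ->] := clsP a.
have [b' Jb ->] := clsP b; have [x' Jx ->] := clsP x.
have Jab : ideal_pow J ij (a' * b') by rewrite -e1; exact: ideal_powM.
have Jbx : powmod M jl (b' *: x') by exact: powmodM e3 _ _.
rewrite [gr_mul _ _ _](assoc_gr_mulE e1 Ja Jb) (assoc_gm_actE e2 Jab Jx).
by rewrite (assoc_gm_actE e3 Jb Jx) (assoc_gm_actE e4 Ja Jbx) scalerA.
Qed.
Next Obligation.
move=> M j e x; have [x' Jx ->] := clsP x.
by rewrite assoc_gm_actE // scale1r.
Qed.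
End AssociatedGraded.

(* Main.v *)
(** Let 0 -> K -> F -> M -> 0 be exact with F free, so that the Tor_1 (M, A/I^n)
    are the W_n = (K :&: I^n F) / I^n K.  The kernel of G(F) -> G(M) is the sum of
    the (K :&: I^n F) / (K :&: I^(n+1) F), and it receives a map from G(K) whose
    kernel and cokernel are a submodule of the shift of W and a quotient of W.
    If length W_n grows with degree at most d - q, these modules have dimension
    at most k = d + 1 - q and their local cohomology vanishes above k, so
    a_i(G(M)) <= max (a_i(G(A)), a_(i+1)(G(K))) for i >= k.  Replacing M by K and
    iterating until i exceeds the number of generators of I bounds a_i(G(M)) by
    max_j a_j(G(A)), provided that the growth bound holds for all syzygies of M.

    That bound passes from E to the thick subcategory generated by E: growth is
    inherited by stable direct summands and by the middle term of a short exact
    sequence, and every distinguished triangle comes, up to rotation and free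
    summands, from such a sequence.  Over a Gorenstein ring the maximal
    Cohen-Macaulay modules are the finitely generated X with Ext^j(X, A) = 0 for
    all j > 0, which gives the extensions of maps and the cosyzygies needed here.

    Local cohomology is handled as the colimit of the Koszul complexes of the
    powers of the generators of I, where the statement "H^i vanishes in degree n"
    is elementary; it is compared with the derived functors of Gamma_{G_+} by
    showing that graded-injective modules are acyclic for it. *)

Require Import Defs.
From HB Require Import structures.
From mathcomp Require Import all_boot all_order all_algebra.
From mathcomp Require Import generic_quotient ring_quotient.
From mathcomp Require Import mathcomp_extra boolp classical_sets functions.
From mathcomp Require Import constructive_ereal.
From mathcomp Require Import ring lra zify.
Import Defs.

Set Implicit Arguments.
Unset Strict Implicit.
Unset Printing Implicit Defensive.

Import Order.TTheory GRing.Theory Num.Theory.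
Local Open Scope classical_set_scope.
Local Open Scope ring_scope.
Local Open Scope quotient_scope.
#[local] Obligation Tactic := idtac.

(** * Noetherian modules *)

Notation "N <=s N'" := (smod_le N N') (at level 70).

(** The graded modules whose growth matters are kept as subquotients [Z / B] of families inside one
    fixed [A]-module, so that exact sequences become inclusions and a single devissage yields both
    Hilbert polynomials and vanishing of cohomology. Its key step concerns a variable acting
    injectively: every class of local cohomology is killed by a power of the variable, so [H^(i+1)]
    vanishes in degree [n] once [H^i] of the cokernel vanishes in all degrees above [n]. The bound
    is uniform because only [G(A)] contributes a degree; the Tor terms vanish in every degree for
    reasons of dimension. Two obstacles shape the rest. Objects of the thick subcategory are
    controlled only up to stable retracts and shifts in both directions, hence growth is imposed on
    whole orbits under syzygies and cosyzygies. And [gorenstein] supplies just a finite injective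
    resolution of [A]; that [A] has depth [d] is read off from a nonzero maximal Cohen-Macaulay
    module, so the zero module is treated apart. *)

Section Lattice.
Variable A : comNzRingType.
Implicit Types V W : lmodType A.

Lemma smod_ext V (N N' : submodule V) : N <=s N' -> N' <=s N -> N = N'.
Proof.
case: N N' => [p p0 pP] [q q0 qP] /= pq qp.
have e : p = q by apply/funext => x; apply/propext; split; [exact: pq|exact: qp].
subst q; congr Submodule; exact: Prop_irrelevance.
Qed.

Lemma smod_refl V (N : submodule V) : N <=s N. Proof. by []. Qed.
Hint Resolve smod_refl : core.

Lemma smod_trans V (N1 N2 N3 : submodule V) : N1 <=s N2 -> N2 <=s N3 -> N1 <=s N3.
Proof. by move=> h h' x /h /h'. Qed.

Lemma smodN V (N : submodule V) x : N x -> N (- x).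
Proof. by move=> Nx; rewrite -scaleN1r; apply: smodZ. Qed.

Lemma smod_sum V (N : submodule V) (J : finType) (F : J -> V) :
  (forall i, N (F i)) -> N (\sum_i F i).
Proof. by move=> NF; elim/big_ind: _ => //; [exact: smod0|exact: smodD]. Qed.

Program Definition addS V (N N' : submodule V) : submodule V :=
  @Submodule A V (fun z => exists x y, [/\ N x, N' y & z = x + y]) _ _.
Next Obligation. by move=> V N N'; exists 0, 0; split; rewrite ?addr0 //; exact: smod0. Qed.
Next Obligation.
move=> V N N' a _ _ [x [y [Nx Ny ->]]] [x' [y' [Nx' Ny' ->]]].
exists (a *: x + x'), (a *: y + y'); split; [exact: smodP|exact: smodP|].
by rewrite scalerDr addrACA.
Qed.

Program Definition capS V (N N' : submodule V) : submodule V :=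
  @Submodule A V (fun z => N z /\ N' z) _ _.
Next Obligation. by move=> V N N'; split; exact: smod0. Qed.
Next Obligation. by move=> V N N' a x y [? ?] [? ?]; split; exact: smodP. Qed.

Program Definition botS V : submodule V := @Submodule A V (fun z => z = 0) _ _.
Next Obligation. by []. Qed.
Next Obligation. by move=> V a x y -> ->; rewrite scaler0 addr0. Qed.

Program Definition imS V W (f : {linear V -> W}) (N : submodule V) : submodule W :=
  @Submodule A W (fun y => exists2 x, N x & f x = y) _ _.
Next Obligation. by move=> V W f N; exists 0; [exact: smod0|rewrite linear0]. Qed.
Next Obligation.
move=> V W f N a _ _ [x Nx <-] [y Ny <-].
by exists (a *: x + y); [exact: smodP|rewrite linearP].
Qed.

Program Definition scaleS V (a : A) (N : submodule V) : submodule V :=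
  @Submodule A V (fun y => exists2 x, N x & y = a *: x) _ _.
Next Obligation. by move=> V a N; exists 0; [exact: smod0|rewrite scaler0]. Qed.
Next Obligation.
move=> V a N b _ _ [x Nx ->] [y Ny ->].
exists (b *: x + y); first exact: smodP.
by rewrite scalerDr !scalerA mulrC.
Qed.

Program Definition lineS V (x : V) : submodule V :=
  @Submodule A V (fun y => exists a : A, y = a *: x) _ _.
Next Obligation. by move=> V x; exists 0; rewrite scale0r. Qed.
Next Obligation.
move=> V x c _ _ [a ->] [b ->]; exists (c * a + b).
by rewrite scalerDl scalerA.
Qed.

Lemma addSl V (N N' : submodule V) x : N x -> addS N N' x.
Proof. by move=> Nx; exists x, 0; split; rewrite ?addr0 //; exact: smod0. Qed.
Lemma addSr V (N N' : submodule V) x : N' x -> addS N N' x.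
Proof. by move=> Nx; exists 0, x; split; rewrite ?add0r //; exact: smod0. Qed.
Lemma addS_le V (N N' T : submodule V) : N <=s T -> N' <=s T -> addS N N' <=s T.
Proof. by move=> h h' _ [x [y [/h ? /h' ? ->]]]; exact: smodD. Qed.
Lemma addS_mono V (N N' T T' : submodule V) :
  N <=s N' -> T <=s T' -> addS N T <=s addS N' T'.
Proof.
move=> h h'; apply: addS_le => x; [move=> /h|move=> /h'].
  exact: addSl.
exact: addSr.
Qed.
Lemma botS_le V (N : submodule V) : botS V <=s N.
Proof. by move=> x ->; exact: smod0. Qed.

Lemma span_le V (S : set V) (N : submodule V) : (forall x, S x -> N x) -> span S <=s N.
Proof. by move=> SN x; apply. Qed.

Lemma span_mono V (S S' : set V) : (forall x, S x -> S' x) -> span S <=s span S'.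
Proof. by move=> SS; apply: span_le => x /SS; exact: span_mem. Qed.

Lemma span_les V (s : seq V) (N : submodule V) :
  (forall x, x \in s -> N x) -> span [set` s] <=s N.
Proof. exact: span_le. Qed.

Lemma span_mems V (s : seq V) x : x \in s -> span [set` s] x.
Proof. exact: span_mem. Qed.

Lemma span_monos V (s s' : seq V) : {subset s <= s'} -> span [set` s] <=s span [set` s'].
Proof. exact: span_mono. Qed.

Lemma span_consP V (x : V) (s : seq V) z :
  span [set` x :: s] z <-> exists a w, span [set` s] w /\ z = a *: x + w.
Proof.
split.
  suff H : span [set` x :: s] <=s addS (lineS x) (span [set` s]).
    by move=> /H [_ [w [[a ->] sw ->]]]; exists a, w.
  apply: span_les => y; rewrite inE => /orP [/eqP->|ys].
    by apply: addSl; exists 1; rewrite scale1r.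
  by apply: addSr; apply: span_mem.
move=> [a [w [sw ->]]]; apply: smodD.
  by apply: smodZ; apply: span_mems; rewrite mem_head.
by apply: span_monos sw => y ys; rewrite inE ys orbT.
Qed.

Lemma span_nilP V (z : V) : span [set` Nil V] z <-> z = 0.
Proof.
split; last by move=> ->; exact: smod0.
by move=> /(_ (botS V)); apply.
Qed.

Lemma fin_genP V (N : submodule V) :
  fin_gen N <-> exists s : seq V, N = span [set` s].
Proof.
split.
  move=> [n [x Nx]]; exists [seq x i | i : 'I_n].
  apply: smod_ext => z.
    move=> /Nx; apply: span_mono => _ [i _ <-] /=.
    by apply/mapP; exists i; rewrite ?mem_enum.
  move=> h; apply/Nx; apply: span_mono h => y /= /mapP [i _ ->].
  by exists i.
move=> [s ->]; exists (size s), (fun i => nth 0 s i) => z; split; apply: span_mono.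
  move=> y /= /(nthP 0) [i i_lt <-].
  by exists (Ordinal i_lt).
by move=> _ [i _ <-] /=; rewrite mem_nth.
Qed.

Lemma fin_gen_map V W (f : {linear V -> W}) (N : submodule V) :
  fin_gen N -> fin_gen (imS f N).
Proof.
move=> /fin_genP [s ->]; apply/fin_genP; exists (map f s).
apply: smod_ext.
  move=> _ [x sx <-].
  have: span [set` s] <=s preim_smod f (span [set` map f s]).
    by apply: span_les => y ys; apply: span_mems; exact: map_f.
  by apply.
apply: span_les => _ /mapP [x xs ->]; exists x => //; exact: span_mem.
Qed.

Lemma fin_gen_surj V W (f : {linear V -> W}) : (forall y, exists x, f x = y) ->
  fin_gen (full_smod V) -> fin_gen (full_smod W).
Proof.
move=> fs /(fin_gen_map f); congr fin_gen; apply: smod_ext => // y _.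
by have [x <-] := fs y; exists x.
Qed.

Lemma spanE V (s : seq V) z : span [set` s] z ->
  exists c : 'rV[A]_(size s), z = \sum_i c 0 i *: s`_i.
Proof.
elim: s z => [|x s IH] z.
  by move=> /span_nilP ->; exists 0; rewrite big_ord0.
move=> /span_consP [a [w [/IH [c ->] ->]]].
exists (\row_i if unlift ord0 i is Some j then c 0 j else a).
rewrite big_ord_recl /= mxE unlift_none; congr (_ + _); apply: eq_bigr => i _.
by rewrite mxE liftK.
Qed.

Lemma fin_gen_row p : fin_gen (full_smod 'rV[A]_p).
Proof.
exists p, (fun i => delta_mx 0 i : 'rV[A]_p) => x; split=> // _.
rewrite [x]row_sum_delta; apply: smod_sum => i; apply: smodZ; apply: span_mem.
by exists i.
Qed.

End Lattice.
#[global] Hint Resolve smod_refl : core.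

Section Noetherian.
Variable A : comNzRingType.
Implicit Types V W : lmodType A.
Hypothesis A_noeth : noetherian A.

(** Induct on the generators of [T]: the coefficients of the first generator [x] in elements of [N],
    modulo the span of the others, form an ideal [P]. Lifts [y] of generators of [P], with
    generators of the part of [N] inside that span, generate [N]. *)
Lemma fin_gen_sub V (N T : submodule V) : fin_gen T -> N <=s T -> fin_gen N.
Proof.
move=> /fin_genP [s ->]; elim: s N => [|x s IH] N NT.
  apply/fin_genP; exists [::]; apply: smod_ext => //.
  by move=> z /span_nilP ->; exact: smod0.
pose P (a : A^o) := exists2 w, span [set` s] w & N (a *: x + w).
have P0 : P 0 by exists 0; rewrite ?scale0r ?addr0; exact: smod0.
have PP : forall a b c, P b -> P c -> P (a *: b + c).
  move=> a b c [w sw Nw] [w' sw' Nw']; exists (a *: w + w'); first exact: smodP.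
  have -> : (a *: b + c) *: x + (a *: w + w') = a *: (b *: x + w) + (c *: x + w').
    by rewrite scalerDl scalerDr -[a *: b]/(a * b) scalerA addrACA.
  exact: smodP.
have [l PE] := (proj1 (fin_genP _)) (A_noeth (Submodule P0 PP)).
have /choice [y Hy] (a : A^o) : exists y, a \in l -> N y /\ span [set` s] (y - a *: x).
  case: (pselect (a \in l)) => al; last by exists 0.
  have: Submodule P0 PP a by rewrite PE; exact: span_mem.
  move=> [w sw Nw]; exists (a *: x + w) => _; split => //.
  by rewrite addrAC subrr add0r.
have [s' Ns'] := (proj1 (fin_genP _)) (IH (capS N (span [set` s])) (fun z (h : capS _ _ z) => h.2)).
apply/fin_genP; exists (map y l ++ s'); apply: smod_ext; last first.
  apply: span_les => z; rewrite mem_cat => /orP [/mapP [a al ->]|zs].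
    by case: (Hy _ al).
  have : capS N (span [set` s]) z by rewrite Ns'; apply: span_mem.
  by case.
move=> z Nz; have /span_consP [a [w [sw zE]]] := NT _ Nz.
have : Submodule P0 PP a by exists w => //; rewrite -zE.
rewrite PE => al.
have [u [Tu Nu su]] : exists u, [/\ span [set` map y l] u, N u & span [set` s] (u - a *: x)].
  pose Q (b : A^o) := exists u, [/\ span [set` map y l] u, N u & span [set` s] (u - b *: x)].
  have Q0 : Q 0 by exists 0; rewrite scale0r subr0; split; exact: smod0.
  have QQ : forall a b c, Q b -> Q c -> Q (a *: b + c).
    move=> e b c [u [h1 h2 h3]] [v [k1 k2 k3]]; exists (e *: u + v).
    split; [exact: smodP|exact: smodP|].
    have -> : e *: u + v - (e *: b + c) *: x = e *: (u - b *: x) + (v - c *: x).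
      by rewrite scalerDl scalerBr -[e *: b]/(e * b) scalerA opprD addrACA.
    exact: smodP.
  have : span [set` l] <=s Submodule Q0 QQ.
    apply: span_les => b bl; have [h1 h2] := Hy _ bl; exists (y b); split => //.
    by apply: span_mems; exact: map_f.
  by apply.
have : capS N (span [set` s]) (z - u).
  split; first exact: smodB.
  have -> : z - u = w - (u - a *: x) by rewrite zE opprB addrA [a *: x + w]addrC.
  exact: smodB.
rewrite Ns' => zu; rewrite -(subrK u z); apply: smodD.
  by apply: span_monos zu => v vs; rewrite mem_cat vs orbT.
by apply: span_monos Tu => v vs; rewrite mem_cat vs.
Qed.

Lemma acc_stable V (T : submodule V) (N : nat -> submodule V) : fin_gen T ->
  (forall j, N j <=s T) -> (forall j, N j <=s N j.+1) ->
  exists j0, forall j, N j <=s N j0.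
Proof.
move=> fgT NT NS.
have mono i j : (i <= j)%N -> N i <=s N j.
  move=> /subnK <-; elim: (j - i)%N => [|k IH] //; apply: smod_trans IH _.
  by rewrite addSn; exact: NS.
have U0 : exists j, N j 0 by exists 0%N; exact: smod0.
have UP : forall a x y, (exists j, N j x) -> (exists j, N j y) -> exists j, N j (a *: x + y).
  move=> a x y [i Nx] [j Ny]; exists (maxn i j); apply: smodP.
    by apply: mono Nx; rewrite leq_maxl.
  by apply: mono Ny; rewrite leq_maxr.
have /fin_genP [s sE] : fin_gen (Submodule U0 UP).
  by apply: fin_gen_sub fgT _ => x [j]; exact: NT.
have [j0 Hj] : exists j0, forall x, x \in s -> N j0 x.
  have : forall x, x \in s -> exists j, N j x.
    move=> x xs; have : Submodule U0 UP x by rewrite sE; apply: span_mem.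
    by [].
  elim: s {sE} => [|x s IH] Hs; first by exists 0%N.
  have [y ys|j Hj] := IH; first by apply: Hs; rewrite inE ys orbT.
  have [j' Hj'] := Hs x (mem_head _ _).
  exists (maxn j j') => y; rewrite inE => /orP [/eqP ->|ys].
    by apply: mono Hj'; rewrite leq_maxr.
  by apply: mono (Hj _ ys); rewrite leq_maxl.
exists j0 => j x Nx; have : Submodule U0 UP x by exists j.
by rewrite sE; apply: span_le.
Qed.

Lemma max_submodule V (T : submodule V) (P : submodule V -> Prop) (N0 : submodule V) :
  fin_gen T -> P N0 -> N0 <=s T ->
  exists N, [/\ N0 <=s N, N <=s T, P N & forall N', N <=s N' -> N' <=s T -> P N' -> N' <=s N].
Proof.
move=> fgT PN0 N0T; apply: contrapT => noN.
have step (N : {N | [/\ N0 <=s N, N <=s T & P N]}) :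
  exists N' : {N | [/\ N0 <=s N, N <=s T & P N]}, smod_lt (sval N) (sval N').
  case: N => N [h1 h2 h3] /=; apply: contrapT => noN'; apply: noN.
  exists N; split => // N' NN' N'T PN'; apply: contrapT => nle; apply: noN'.
  by unshelve eexists (exist _ N' _) => //; split => //; apply: smod_trans NN'.
have [F HF] := choice step.
pose S := fun j => iter j F (exist _ N0 (And3 (@smod_refl _ _ N0) N0T PN0)).
have [||j0 Hj] := @acc_stable V T (fun j => sval (S j)) fgT.
- by move=> j; case: (svalP (S j)).
- by move=> j /=; case: (HF (S j)).
by have [_] := HF (S j0); apply; exact: (Hj j0.+1).
Qed.

Lemma fin_gen_full_sub V (N : submodule V) :
  fin_gen (full_smod V) -> fin_gen N.
Proof. by move=> h; apply: fin_gen_sub h _. Qed.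

End Noetherian.

Section QuotientMap.
Variables (A : comNzRingType) (V : lmodType A) (N : submodule V).

Definition qpi (x : V) : quot_mod N := \pi_(quot_mod N) x.

Fact qpi_linear : linear qpi.
Proof. by move=> a x y; rewrite /qpi quot_piD; congr (_ + _); rewrite -(quot_scale_pi N a x). Qed.
HB.instance Definition _ := GRing.isLinear.Build A V (quot_mod N) _ qpi qpi_linear.

Lemma qpi_surj (q : quot_mod N) : exists x, qpi x = q.
Proof. by exists (repr q); exact: reprK. Qed.

Lemma qpi0P x : qpi x = 0 <-> N x.
Proof.
rewrite -(linear0 qpi) /qpi; split.
  by move=> /eqP/quot_eqP; rewrite subr0.
by move=> Nx; apply/eqP/quot_eqP; rewrite subr0.
Qed.

Definition qlift (W : lmodType A) (f : {linear V -> W}) (q : quot_mod N) : W := f (repr q).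

Variables (W : lmodType A) (f : {linear V -> W}).
Hypothesis fN : forall x, N x -> f x = 0.

Lemma qlift_pi x : qlift f (qpi x) = f x.
Proof.
apply/eqP; rewrite -subr_eq0 -linearB; apply/eqP/fN/qpi0P.
by rewrite linearB /= [qpi (repr _)]reprK subrr.
Qed.

Lemma qlift_linear : linear (qlift f).
Proof.
move=> a p q; have [x <-] := qpi_surj p; have [y <-] := qpi_surj q.
by rewrite -linearP !qlift_pi linearP.
Qed.

Lemma ex_qlift : exists g : {linear quot_mod N -> W}, forall x, g (qpi x) = f x.
Proof.
pose m := GRing.isLinear.Build A _ _ _ (qlift f) qlift_linear.
pose g : {linear quot_mod N -> W} := HB.pack (qlift f) m.
by exists g => x; exact: qlift_pi.
Qed.
End QuotientMap.

Lemma mk_linear (A : comNzRingType) (V W : lmodType A) (f : V -> W) :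
  linear f -> exists g : {linear V -> W}, forall x, g x = f x.
Proof.
move=> fl; pose m := GRing.isLinear.Build A _ _ _ f fl.
by exists (HB.pack f m : {linear V -> W}).
Qed.

Lemma factor_surj (A : comNzRingType) (V W U : lmodType A) (p : {linear V -> W})
    (f : {linear V -> U}) : (forall y, exists x, p x = y) ->
  (forall x, p x = 0 -> f x = 0) -> exists g : {linear W -> U}, forall x, g (p x) = f x.
Proof.
move=> ps pf; have [s sE] := choice ps.
have E x : f (s (p x)) = f x.
  by apply/eqP; rewrite -subr_eq0 -linearB; apply/eqP/pf; rewrite linearB sE subrr.
have [|g gE] := @mk_linear A W U (fun y => f (s y)).
  move=> a x y; rewrite -{1}[x]sE -{1}[y]sE -linearP E linearP.
  by rewrite /=.
by exists g => x; rewrite gE E.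
Qed.

Lemma factor_inj (A : comNzRingType) (V W U : lmodType A) (u : {linear V -> W})
    (f : {linear U -> W}) : injective u ->
  (forall x, exists y, u y = f x) -> exists g : {linear U -> V}, forall x, u (g x) = f x.
Proof.
move=> ui /choice [g gE]; have [|h hE] := @mk_linear A U V g.
  by move=> a x y; apply: ui; rewrite linearP !gE linearP.
by exists h => x; rewrite hE.
Qed.

Lemma ex_mulmap (A : comNzRingType) (V : lmodType A) (a : A) :
  exists f : {linear V -> V}, forall x, f x = a *: x.
Proof.
by apply: mk_linear => b x y; rewrite scalerDr !scalerA mulrC.
Qed.

Section SubMap.
Variables (A : comNzRingType) (V : lmodType A) (N : submodule V).

Lemma smod_valP (x : smod_type N) : N (val x).
Proof. by apply/smemP; exact: valP. Qed.

Lemma ex_sub (x : V) : N x -> exists y : smod_type N, val y = x.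
Proof. by move=> /smemP h; exists (SmodType h). Qed.

Lemma val_linear : exists f : {linear smod_type N -> V}, forall x, f x = val x.
Proof. by exists (\val : {linear smod_type N -> V}). Qed.

Lemma fin_gen_smod_type : fin_gen N <-> fin_gen (full_smod (smod_type N)).
Proof.
split.
  move=> /fin_genP [s sE]; apply/fin_genP.
  exists (pmap insub s); apply: smod_ext => // x _.
  have NE z : N z <-> span [set` s] z by rewrite sE.
  have /NE := smod_valP x.
  have H (z : V) : span [set` s] z -> forall y : smod_type N, val y = z ->
      span [set` (pmap insub s : seq (smod_type N))] y.
    move=> /spanE [c zE] y yE.
    have sN (i : 'I_(size s)) : s`_i \in smem N.
      by apply/smemP/NE; apply: span_mems; rewrite mem_nth.
    have -> : y = \sum_i c 0 i *: (SmodType (sN i)).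
      apply: val_inj; rewrite yE zE linear_sum; apply: eq_bigr => i _.
      by rewrite linearZ.
    apply: smod_sum => i; apply: smodZ; apply: span_mems.
    rewrite mem_pmap_sub /=; exact: mem_nth.
  by move=> h; exact: H h _ erefl.
move=> h; have -> : N = imS (\val : {linear smod_type N -> V}) (full_smod _).
  apply: smod_ext; first by move=> x /ex_sub [y <-]; exists y.
  by move=> _ [x _ <-]; exact: smod_valP.
exact: fin_gen_map.
Qed.
End SubMap.

(** * Nakayama's lemma over a local ring *)

Section Local.
Variables (A : comNzRingType) (m : ideal A).
Hypotheses (A_noeth : noetherian A) (A_local : local_ring m).
Implicit Types V W : lmodType A.

Lemma ideal_mul (J : ideal A) (a b : A) : J b -> J (a * b).
Proof. exact: (@smodZ _ _ J). Qed.

Lemma not_m1 : ~ m 1.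
Proof. by case: A_local => [[]]. Qed.

Lemma local_unit (a : A) : ~ m a -> exists b : A, b * a = 1.
Proof.
move=> nma; pose L := lineS (V := A^o) a.
case: (pselect (L 1)) => [[b bE]|nL1]; first by exists b; rewrite bE.
have fgA : fin_gen (full_smod A^o) by exact: A_noeth.
have [P [LP _ P1 Pmax]] := max_submodule A_noeth (T := full_smod A^o)
   (P := fun N => ~ N 1) fgA nL1 (fun _ _ => I).
have : maximal_ideal P by split => // K PK K1; exact: Pmax.
case: A_local => _ H /H /(_ a) [+ _] => Pm.
by case: nma; apply: Pm; apply: LP; exists 1; rewrite scale1r.
Qed.

Lemma one_sub_unit (a : A) : m a -> exists b : A, b * (1 - a) = 1.
Proof.
move=> ma; apply: local_unit => m1a; apply: not_m1.
by rewrite -(subrK a 1); exact: smodD.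
Qed.

Lemma mul_smod_spanP V (J : ideal A) (s : seq V) z :
  mul_smod J (span [set` s]) z ->
  exists2 c : 'rV[A]_(size s), (forall i, J (c 0 i)) & z = \sum_i c 0 i *: s`_i.
Proof.
have P0 : exists2 c : 'rV[A]_(size s), (forall i, J (c 0 i)) & 0 = \sum_i c 0 i *: s`_i.
  exists 0 => [i|]; first by rewrite mxE; exact: smod0.
  by rewrite big1 // => i _; rewrite mxE scale0r.
have PP a x y : (exists2 c : 'rV[A]_(size s), (forall i, J (c 0 i)) & x = \sum_i c 0 i *: s`_i) ->
  (exists2 c : 'rV[A]_(size s), (forall i, J (c 0 i)) & y = \sum_i c 0 i *: s`_i) ->
  (exists2 c : 'rV[A]_(size s), (forall i, J (c 0 i)) & a *: x + y = \sum_i c 0 i *: s`_i).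
  move=> [c Jc ->] [c' Jc' ->]; exists (a *: c + c') => [i|].
    by rewrite !mxE; apply: smodD => //; exact: ideal_mul.
  rewrite scaler_sumr -big_split; apply: eq_bigr => i _ /=.
  by rewrite !mxE scalerDl scalerA.
apply: (@mul_smod_ind A V J (span [set` s]) (Submodule P0 PP)).
move=> a x Ja /spanE [c ->]; exists (a *: c) => [i|].
  by rewrite mxE mulrC; exact: ideal_mul.
by rewrite scaler_sumr; apply: eq_bigr => i _; rewrite mxE scalerA.
Qed.

Lemma mul_smod_le V (J : ideal A) (N : submodule V) : mul_smod J N <=s N.
Proof. by apply: mul_smod_ind => a x _; exact: smodZ. Qed.

Lemma mul_smod_mono V (J J' : ideal A) (N N' : submodule V) :
  J <=s J' -> N <=s N' -> mul_smod J N <=s mul_smod J' N'.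
Proof. by move=> h h'; apply: mul_smod_ind => a x /h ? /h' ?; exact: mul_smodP. Qed.

(** Modulo [N] and the other generators, a generator [x] of [H] equals [c x] with [c] in [m]. As
    [1 - c] is a unit, [x] is redundant, and the number of generators drops. *)
Lemma nakayama V (H N : submodule V) : fin_gen H ->
  H <=s addS N (mul_smod m H) -> H <=s N.
Proof.
move=> /fin_genP [s ->]; elim: s => [|x s IH] Hs.
  by move=> z /span_nilP ->; exact: smod0.
suff xs : addS N (span [set` s]) x.
  have le1 : span [set` x :: s] <=s addS N (span [set` s]).
    apply: span_les => y; rewrite inE => /orP [/eqP ->|ys] //.
    by apply: addSr; exact: span_mems.
  have : span [set` s] <=s N.
    apply: IH => z zs.
    have [|u [w [Nu + ->]]] := Hs z; first by apply: span_monos zs => y ys; rewrite inE ys orbT.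
    move=> mw; have : mul_smod m (addS N (span [set` s])) w by apply: mul_smod_mono le1 _ mw.
    have : mul_smod m (addS N (span [set` s])) <=s addS N (mul_smod m (span [set` s])).
      apply: mul_smod_ind => a _ ma [p [q [Np sq ->]]]; rewrite scalerDr.
      apply: smodD; first by apply: addSl; exact: smodZ.
      by apply: addSr; exact: mul_smodP.
    move=> h /h mw'; apply: smodD => //; exact: addSl.
  move=> sN; apply: smod_trans le1 _; exact: addS_le.
have [|u [w [Nu + xE]]] := Hs x; first by apply: span_mems; rewrite mem_head.
move=> /mul_smod_spanP [c mc wE].
have {}wE : w = c 0 ord0 *: x + \sum_(i < size s) c 0 (lift ord0 i) *: s`_i.
  by rewrite wE big_ord_recl.
have [b bE] := one_sub_unit (mc ord0).
have : x = b *: (u + \sum_(i < size s) c 0 (lift ord0 i) *: s`_i).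
  have : (1 - c 0 ord0) *: x = u + \sum_(i < size s) c 0 (lift ord0 i) *: s`_i.
    by rewrite scalerBl scale1r {1}xE wE [c 0 ord0 *: x + _]addrC addrA addrK.
  by move=> <-; rewrite scalerA bE scale1r.
move=> ->; apply: smodZ; apply: smodD; first exact: addSl.
apply: smod_sum => i; apply: smodZ; apply: addSr; apply: span_mems; exact: mem_nth.
Qed.

Lemma nakayama0 V : fin_gen (full_smod V) -> (forall x : V, mul_smod m (full_smod V) x) ->
  is_zero V.
Proof.
move=> fg h x; apply: (@nakayama V (full_smod V) (botS V)) => // y _.
exact: addSr.
Qed.
End Local.

(** * Length *)

Section Length.
Variable A : comNzRingType.
Implicit Types V W : lmodType A.

(** The bottom member need only contain [B], and [chain_up] enlarges the top, so chains can be
    glued, intersected and mapped without fixing their end points. *)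
Inductive chain V (B : submodule V) : submodule V -> nat -> Prop :=
| chain0 X : B <=s X -> chain B X 0
| chainS X Y c : chain B X c -> X <=s Y -> ~ Y <=s X -> chain B Y c.+1.

Definition lenle V (B Z : submodule V) (l : nat) := forall c, chain B Z c -> (c <= l)%N.
Definition haslen V (B Z : submodule V) (l : nat) := chain B Z l /\ lenle B Z l.

Lemma chain_le V (B X : submodule V) c : chain B X c -> B <=s X.
Proof. by elim=> // {}X Y {}c _ h h' _; apply: smod_trans h h'. Qed.

Lemma chain_up V (B X Y : submodule V) c : chain B X c -> X <=s Y -> chain B Y c.
Proof.
case=> [{}X BX XY|{}X Z {}c h XZ ZX ZY]; first by apply: chain0; exact: smod_trans XY.
apply: chainS h _ _; first exact: smod_trans ZY.
by move=> YX; apply: ZX; exact: smod_trans YX.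
Qed.

Lemma chain_cat V (B Z T : submodule V) c c' : chain B Z c -> chain Z T c' ->
  chain B T (c + c').
Proof.
move=> h; elim=> [X ZX|X Y {}c' _ IH XY YX]; first by rewrite addn0; exact: chain_up ZX.
by rewrite addnS; exact: chainS IH XY YX.
Qed.

(** By the modular law a strict inclusion stays strict after intersecting with [Z] or after adding
    [Z], so each of the [c] steps is counted in [c1] or in [c2]. *)
Lemma chain_split V (B Z X : submodule V) c : chain B X c -> B <=s Z ->
  exists c1 c2, [/\ (c <= c1 + c2)%N, chain B (capS X Z) c1 & chain Z (addS X Z) c2].
Proof.
move=> h BZ; elim: h => [{}X BX|{}X Y {}c h [c1 [c2 [cc h1 h2]]] XY YX].
  exists 0%N, 0%N; split => //; apply: chain0; first by move=> x Bx; split; [exact: BX|exact: BZ].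
  by move=> x; exact: addSr.
have cap_le : capS X Z <=s capS Y Z by move=> x [? ?]; split => //; exact: XY.
have add_le : addS X Z <=s addS Y Z by exact: addS_mono.
case: (pselect (capS Y Z <=s capS X Z)) => [capYX|ncap].
  case: (pselect (addS Y Z <=s addS X Z)) => [addYX|nadd].
    case: YX => y Yy; have [|x [z [Xx Zz yE]]] := addYX y; first exact: addSl.
    have [|Xz _] := capYX z; last by rewrite yE; exact: smodD.
    split=> //; have -> : z = y - x by rewrite yE addrC addrA addNr add0r.
    by apply: smodB => //; exact: XY.
  exists c1, c2.+1; split; first by rewrite addnS.
    exact: chain_up h1 _.
  exact: chainS h2 _ _.
exists c1.+1, c2; split; first by rewrite addSn.
  exact: chainS h1 _ _.
exact: chain_up h2 _.
Qed.

Lemma lenle_add V (B Z T : submodule V) l l' : B <=s Z -> lenle B Z l -> lenle Z T l' ->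
  Z <=s T -> lenle B T (l + l').
Proof.
move=> BZ h h' ZT c /chain_split /(_ BZ) [c1 [c2 [cc /chain_up h1 /chain_up h2]]].
apply: leq_trans cc _; apply: leq_add; first by apply: h; apply: h1 => x [].
by apply: h'; apply: h2; exact: addS_le.
Qed.

Lemma lenle0 V (B Z : submodule V) : Z <=s B -> lenle B Z 0.
Proof.
move=> ZB c h; case: h ZB => // X Y {}c /chain_le BX XY YX YB.
by case: YX; apply: smod_trans BX.
Qed.

Lemma lenle0P V (B Z : submodule V) : B <=s Z -> lenle B Z 0 -> Z <=s B.
Proof.
move=> BZ h; apply: contrapT => nZB.
by have := h 1%N (chainS (chain0 (smod_refl (N := B))) BZ nZB).
Qed.

Lemma haslen_ex V (B Z : submodule V) l : B <=s Z -> lenle B Z l -> exists l', haslen B Z l'.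
Proof.
move=> BZ h.
have ex : exists c, `[< chain B Z c >] by exists 0%N; apply/asboolP; exact: chain0.
have bd c : `[< chain B Z c >] -> (c <= l)%N by move=> /asboolP; exact: h.
case: (ex_maxnP ex bd) => c /asboolP hc cmax; exists c; split => // c' hc'.
by apply: cmax; apply/asboolP.
Qed.

Lemma haslen_uniq V (B Z : submodule V) l l' : haslen B Z l -> haslen B Z l' -> l = l'.
Proof. by move=> [h1 h2] [k1 k2]; apply/eqP; rewrite eqn_leq h2 ?k2. Qed.

Lemma haslen_le V (B Z : submodule V) l l' : haslen B Z l -> lenle B Z l' -> (l <= l')%N.
Proof. by move=> [h1 _] h; exact: h. Qed.

Lemma haslen_add V (B Z T : submodule V) l l' : haslen B Z l -> haslen Z T l' ->
  haslen B T (l + l').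
Proof.
move=> [h1 h2] [k1 k2]; split; first exact: chain_cat h1 k1.
by apply: lenle_add h2 k2 _; [exact: chain_le h1|exact: chain_le k1].
Qed.

Lemma haslen0 V (B : submodule V) : haslen B B 0.
Proof. by split; [exact: chain0|exact: lenle0]. Qed.

(** Here [f] is injective only from [Z / B] to [Z' / B']; a chain is pushed forward by taking images
    and adding [B'], which preserves strictness. *)
Lemma lenle_inj V W (f : {linear V -> W}) (B Z : submodule V) (B' Z' : submodule W) l :
  (forall x, Z x -> Z' (f x)) -> (forall x, Z x -> B' (f x) -> B x) -> B' <=s Z' ->
  lenle B' Z' l -> lenle B Z l.
Proof.
move=> fZ fB BZ' h c hc; apply: h.
suff : chain B' (addS (imS f Z) B') c.
  by move/chain_up; apply; apply: addS_le => // _ [x /fZ ? <-].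
have ZZ : Z <=s Z by [].
elim: {1 3}Z c / hc ZZ => [X BX _|X Y c h IH XY YX YZ].
  by apply: chain0 => x; exact: addSr.
apply: chainS (IH (smod_trans XY YZ)) _ _.
  by apply: addS_mono => // _ [x Xx <-]; exists x => //; exact: XY.
move=> YX'; apply: YX => y Yy.
have [|_ [b [[x Xx <-] B'b fyE]]] := YX' (f y); first by apply: addSl; exists y.
rewrite -(subrK x y); apply: smodD => //; apply: (chain_le h); apply: fB.
  by apply: YZ; apply: smodB => //; exact: XY.
by rewrite linearB fyE addrAC subrr add0r.
Qed.

Lemma lenle_surj V W (f : {linear V -> W}) (B Z : submodule V) (B' Z' : submodule W) l :
  (forall x, B x -> B' (f x)) -> (forall y, Z' y -> exists2 x, Z x & B' (y - f x)) ->
  B <=s Z -> lenle B Z l -> lenle B' Z' l.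
Proof.
move=> fB fZ BZ h c hc; apply: h.
suff : chain B (capS Z (preim_smod f Z')) c by move/chain_up; apply => x [].
have ZZ : Z' <=s Z' by [].
elim: {1 3}Z' c / hc ZZ => [X BX _|X Y c h IH XY YX YZ].
  by apply: chain0 => x Bx; split; [exact: BZ|apply: BX; exact: fB].
have BX := chain_le h.
apply: chainS (IH (smod_trans XY YZ)) _ _.
  by move=> x [Zx Xx]; split => //; exact: XY.
move=> YX'; apply: YX => y Yy; have [x Zx Bx] := fZ _ (YZ _ Yy).
rewrite -(subrK (f x) y); apply: smodD; first exact: BX.
have [] // : capS Z (preim_smod f X) x.
apply: YX'; split => //=; have -> : f x = y - (y - f x) by rewrite opprB addrC subrK.
by apply: smodB => //; apply: XY; exact: BX.
Qed.

Lemma lenle_mono V (B Z B' Z' : submodule V) l : B <=s B' -> Z' <=s Z -> B <=s Z ->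
  lenle B Z l -> lenle B' Z' l.
Proof.
move=> BB ZZ BZ; have [f fE] := @mk_linear A V V idfun (fun a x y => erefl).
apply: (@lenle_surj _ _ f) => // [x Bx|y /ZZ Zy]; first by rewrite fE; exact: BB.
by exists y => //; rewrite fE subrr; exact: smod0.
Qed.

Lemma haslen_iso V W (f : {linear V -> W}) (B Z : submodule V) (B' Z' : submodule W) l :
  B <=s Z -> B' <=s Z' ->
  (forall x, Z x -> Z' (f x)) -> (forall x, Z x -> (B x <-> B' (f x))) ->
  (forall y, Z' y -> exists2 x, Z x & B' (y - f x)) ->
  haslen B Z l -> haslen B' Z' l.
Proof.
move=> BZ BZ' fZ fB fs hl.
have h : lenle B' Z' l.
  by apply: lenle_surj fs (BZ) hl.2 => x Bx; apply/fB => //; exact: BZ.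
have [l' hl'] := haslen_ex BZ' h.
suff -> : l = l' by [].
apply/eqP; rewrite eqn_leq (haslen_le hl' h) andbT; apply: (haslen_le hl).
by apply: lenle_inj fZ _ BZ' hl'.2 => x Zx; case: (fB x Zx).
Qed.

Lemma has_chain_haslen V (l : nat) :
  has_length V l <-> haslen (botS V) (full_smod V) l.
Proof.
have E c : has_chain (fun _ : submodule V => True) c <-> chain (botS V) (full_smod V) c.
  split.
    move=> [N _]; elim: c {-2}c (leqnn c) N => [|c IH] c'.
      by rewrite leqn0 => /eqP -> N _; exact: chain0.
    move=> _ N NS; suff H k : (k <= c')%N -> chain (botS V) (N k) k by apply: chain_up (H _ (leqnn _)) _.
    elim: k => [_|k IHk kc]; first by apply: chain0; exact: botS_le.
    by have [h h'] := NS _ kc; apply: chainS (IHk (ltnW kc)) h h'.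
  move=> h; suff [N [_ NS]] : exists N : nat -> submodule V,
     (N c <=s full_smod V) /\ forall i, (i < c)%N -> smod_lt (N i) (N i.+1) by exists N.
  elim: {1}(full_smod V) c / h => [X _|X Y c _ [N [Nc NS]] XY YX]; first by exists (fun=> X).
  exists (fun i => if (i <= c)%N then N i else Y); rewrite ltnn; split=> // i.
  rewrite ltnS => ic; rewrite ic; case: ltnP => [/NS //|ci].
  have -> : i = c by apply/eqP; rewrite eqn_leq ic ci.
  split; first exact: smod_trans XY.
  by move=> YN; apply: YX; exact: smod_trans Nc.
rewrite /has_length /is_max; split.
  by move=> [/E h h']; split => // c /E; exact: h'.
by move=> [h h']; split; [exact/E|move=> c /E; exact: h'].
Qed.
End Length.

(** * Rational polynomials and eventually polynomial length functions *)

Section Polynomials.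
Implicit Types p q : {poly rat}.

Lemma poly_pos_ev p : 0 < lead_coef p -> exists2 e : rat, 0 < e &
  exists n0, forall n, (n0 <= n)%N -> e <= p.[n%:R].
Proof.
elim/poly_ind: p => [|p c IH]; first by rewrite lead_coef0 ltxx.
case: (eqVneq p 0) => [->|p0].
  rewrite mul0r add0r lead_coefC => c0; exists c => //; exists 0%N => n _.
  by rewrite hornerC.
have -> : lead_coef (p * 'X + c%:P) = lead_coef p.
  rewrite lead_coefDl ?lead_coefMX // size_mulX // size_polyC.
  by apply: leq_ltn_trans (leq_b1 _) _; rewrite ltnS size_poly_gt0.
move=> /IH [e e0 [n0 H]]; exists e => //.
(* From here on [n] is at least [|c| / e + 1], which makes [p(n) n + c] at least
   [e (|c| / e + 1) - |c| = e]. *)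
exists (maxn n0 (Num.bound (`|c| / e)).+1) => n; rewrite geq_max => /andP [/H pn nb].
rewrite hornerD hornerM hornerX hornerC.
have nb' : `|c| / e + 1 <= n%:R.
  have : (Num.bound (`|c| / e)).+1%:R <= n%:R :> rat by rewrite ler_nat.
  apply: le_trans; rewrite -natr1 lerD2r; apply: ltW.
  by have := archi_boundP (x := `|c| / e); apply; rewrite divr_ge0 // ltW.
have : e * (`|c| / e + 1) <= p.[n%:R] * n%:R.
  by apply: ler_pM => //; [exact: ltW|rewrite addr_ge0 // divr_ge0 // ltW].
have -> : e * (`|c| / e + 1) = `|c| + e by field; rewrite gt_eqF.
have := ler_norm (- c); rewrite normrN; lra.
Qed.

(** A nonzero polynomial with natural values has positive leading coefficient. If [q] had smaller
    size, [p - q] would stay above a positive constant for large [n], against the upper bound. *)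
Lemma size_le_of_bound (h : nat -> nat) p q n0 :
  (forall n, (n0 <= n)%N -> p.[n%:R] = (h n)%:R) ->
  (forall n, (n0 <= n)%N -> (h n)%:R <= q.[n%:R]) -> (size p <= size q)%N.
Proof.
move=> hp hq; rewrite leqNgt; apply/negP => qp.
have p0 : lead_coef p != 0.
  by rewrite lead_coef_eq0 -size_poly_gt0; apply: leq_trans qp.
have [pn|pp] : lead_coef p < 0 \/ 0 < lead_coef p by move: p0; rewrite neq_lt => /orP.
  have [|e e0 [n1 H]] := @poly_pos_ev (- p); first by rewrite lead_coefN oppr_gt0.
  have := H (maxn n0 n1) (leq_maxr _ _); rewrite hornerN hp ?leq_maxl // => He.
  have := ler0n rat (h (maxn n0 n1)); lra.
have [|e e0 [n1 H]] := @poly_pos_ev (p - q).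
  by rewrite lead_coefDl // size_polyN.
have := H (maxn n0 n1) (leq_maxr _ _); rewrite hornerD hornerN hp ?leq_maxl // => He.
have := hq (maxn n0 n1) (leq_maxl _ _); lra.
Qed.

Lemma poly_antidiff p : exists q, forall n : nat, q.[n.+1%:R] - q.[n%:R] = p.[n%:R].
Proof.
elim: {p}(size p) {-2}p (leqnn (size p)) => [|k IH] p.
  rewrite leqn0 size_poly_eq0 => /eqP ->; exists 0 => n.
  by rewrite !horner0 subrr.
(* The difference of ['X^(k.+1)], which is [r], has leading term [(k + 1) X^k], so this [c] cancels
   the top coefficient of [p]. *)
move=> szp; pose c := p`_k / k.+1%:R.
pose r := \sum_(i < k.+1) ('X^i *+ 'C(k.+1, i) : {poly rat}).
have rE (x : rat) : r.[x] = (x + 1) ^+ k.+1 - x ^+ k.+1.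
  rewrite exprD1n big_ord_recr /= binn mulr1n addrK /r horner_sum.
  by apply: eq_bigr => i _; rewrite hornerMn hornerXn.
have [|q qE] := IH (p - c *: r).
  apply/leq_sizeP => j kj; rewrite coefB coefZ.
  have rj : r`_j = if j == k then k.+1%:R else 0.
    rewrite /r coef_sum big_ord_recr /= coefMn coefXn binSn big1 ?add0r; last first.
      by move=> i _; rewrite coefMn coefXn gtn_eqF ?mul0rn // (leq_trans (ltn_ord i)).
    by case: eqP; rewrite ?mul0rn.
  rewrite rj; case: eqP => [->|/eqP jk]; first by rewrite /c divfK ?subrr // pnatr_eq0.
  rewrite mulr0 subr0; move/leq_sizeP: szp; apply; rewrite ltn_neqAle eq_sym jk //.
exists (q + c *: 'X^(k.+1)) => n; have := qE n.
rewrite !hornerD !hornerZ !hornerXn hornerN hornerZ rE natr1 => {}qE.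
have -> : p.[n%:R] = (q.[n.+1%:R] - q.[n%:R]) + c * (n.+1%:R ^+ k.+1 - n%:R ^+ k.+1) by rewrite qE addrNK.
by rewrite mulrBr; ring.
Qed.

(** Stated at [n.+1] because a variable leads from degree [n] to degree [n.+1]: the values of [q]
    are the lengths of the cokernel in [quog_haslen]. *)
Lemma poly_diff_size p : p != 0 -> exists2 q : {poly rat}, (size q < size p)%N &
  forall n : nat, q.[n.+1%:R] = p.[n.+1%:R] - p.[n%:R].
Proof.
move=> p0; exists (p - (p \Po ('X - 1%:P))); last first.
  move=> n; rewrite hornerD hornerN horner_comp hornerD hornerN hornerX hornerC.
  by rewrite -natr1 addrK.
have szp : size (p \Po ('X - 1%:P)) = size p by rewrite size_comp_poly2 // size_XsubC.
case E : (size p) => [|k]; first by move: p0; rewrite -size_poly_eq0 E.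
rewrite ltnS; apply/leq_sizeP => j kj; rewrite coefB.
case: (eqVneq j k) => [->|jk].
  have -> : (p \Po ('X - 1%:P))`_k = lead_coef (p \Po ('X - 1%:P)) by rewrite lead_coefE szp E.
  by rewrite lead_coef_comp ?size_XsubC // lead_coefXsubC expr1n mulr1 lead_coefE E subrr.
have lt : (k < j)%N by rewrite ltn_neqAle eq_sym jk.
by rewrite !nth_default ?subrr ?szp ?E.
Qed.

Definition ev_poly (h : nat -> nat) := exists p : {poly rat}, exists n0,
  forall n, (n0 <= n)%N -> p.[n%:R] = (h n)%:R.

Lemma ev_polyD (h h' : nat -> nat) : ev_poly h -> ev_poly h' -> ev_poly (fun n => (h n + h' n)%N).
Proof.
move=> [p [n0 hp]] [q [n1 hq]]; exists (p + q), (maxn n0 n1) => n.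
by rewrite geq_max => /andP [? ?]; rewrite hornerD hp // hq // natrD.
Qed.

Lemma ev_poly_shift (h : nat -> nat) : ev_poly h -> ev_poly (fun n => h n.+1).
Proof.
move=> [p [n0 hp]]; exists (p \Po ('X + 1%:P)), n0 => n nn.
by rewrite horner_comp hornerD hornerX hornerC natr1 hp // ltnW.
Qed.

Lemma ev_poly_diff (h u v : nat -> nat) : ev_poly u -> ev_poly v ->
  (forall n, (h n.+1 + v n = h n + u n)%N) -> ev_poly h.
Proof.
move=> [p [n0 hp]] [q [n1 hq]] H.
have [r rE] := poly_antidiff (p - q); pose N := maxn n0 n1.
exists (r + (((h N)%:R - r.[N%:R])%:P)), N => n /subnK <-.
elim: (n - N)%N => [|k IH]; first by rewrite add0n hornerD hornerC addrC subrK.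
have := rE (k + N)%N; rewrite hornerD hornerN hp ?hq; first last.
- by rewrite (leq_trans (leq_maxl n0 n1)) // leq_addl.
- by rewrite (leq_trans (leq_maxr n0 n1)) // leq_addl.
move: IH; rewrite !hornerD !hornerC addSn => IH E.
have := congr1 (fun i : nat => i%:R : rat) (H (k + N)%N); rewrite /= !natrD.
lra.
Qed.
End Polynomials.

(** * Finite length of modules killed by an m-primary ideal *)

Section FiniteLength.
Variables (A : comNzRingType) (m I : ideal A).
Hypotheses (A_noeth : noetherian A) (A_local : local_ring m) (I_primary : primary_to m I).
Implicit Types V : lmodType A.

Lemma lenle_simple V (N : submodule V) z : (forall a : A, m a -> N (a *: z)) ->
  lenle N (addS N (lineS z)) 1.
Proof.
move=> mz c h; suff H X Y : N <=s X -> X <=s Y -> ~ Y <=s X -> Y <=s addS N (lineS z) ->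
    addS N (lineS z) <=s Y.
  move E : (addS N (lineS z)) h => T h; case: h E => // X Y c1 h1 XY YX E.
  case: h1 XY YX => // X1 X2 c2 h2 h3 h4 h5 h6; exfalso; apply: h6.
  apply: smod_trans (H X1 X2 _ _ _ _) => //; rewrite ?E //; exact: chain_le h2.
move=> NX XY YX Yle; apply: contrapT => nle; apply: YX => y Yy.
have [n [_ [Nn [a ->] yE]]] := Yle _ Yy.
case: (pselect (m a)) => ma; first by rewrite yE; apply: smodD; apply: NX => //; exact: mz.
have [b bE] := local_unit A_noeth A_local ma.
exfalso; apply: nle; apply: addS_le; first by move=> x Nx; apply: XY; apply: NX.
move=> _ [c' ->]; apply: smodZ; rewrite -[z]scale1r -bE -scalerA; apply: smodZ.
have -> : a *: z = y - n by rewrite yE addrC addKr.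
by apply: smodB => //; apply: XY; exact: NX.
Qed.

(** Take [N] maximal among the submodules of finite length over [B]. An element [z] outside [N],
    multiplied by suitable powers of the generators of [m], which are nilpotent modulo [I], gives
    [z'] outside [N] with [m z'] inside. Adjoining [z'] raises the length bound by only one. *)
Lemma fin_length V (B Z : submodule V) : fin_gen Z -> B <=s Z ->
  (forall a x, I a -> Z x -> B ((a : A) *: x)) -> exists l, lenle B Z l.
Proof.
move=> fgZ BZ IZ.
have PB : exists l, lenle B B l by exists 0%N; exact: lenle0.
have [N [BN NZ [l Nl] Nmax]] := max_submodule A_noeth (P := fun N => exists l, lenle B N l) fgZ PB BZ.
exists l; suff -> : Z = N by [].
apply: smod_ext => //; apply: contrapT => nZN.
have {nZN} [z Zz Nz] : exists2 z, Z z & ~ N z.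
  apply: contrapT => h; apply: nZN => z Zz; apply: contrapT => Nz; apply: h; exists z => //.
have /fin_genP [s mE] := A_noeth m.
have [z' Zz' [Nz' mz']] : exists2 z, Z z & ~ N z /\ forall a : A, a \in s -> N (a *: z).
  have sm (a : A) : a \in s -> m a by move=> ?; rewrite mE; exact: span_mems.
  elim: s {mE} sm => [|a s IH] sm; first by exists z.
  have [b bs|w Zw [Nw sw]] := IH; first by apply: sm; rewrite inE bs orbT.
  have [e Iae] : exists e, I (a ^+ e).
    by case: I_primary => _ /(_ a) [_]; apply; apply: sm; rewrite mem_head.
  have Nae : N (a ^+ e *: w) by apply: BN; exact: IZ.
  have ex : exists j, `[< N (a ^+ j *: w) >] by exists e; apply/asboolP.
  case: (ex_minnP ex) => [[|j]] /asboolP Nj minj; first by move: Nj; rewrite expr0 scale1r.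
  exists (a ^+ j *: w); first exact: smodZ.
  split; first by move=> /asboolP /minj; rewrite ltnn.
  move=> b; rewrite inE => /orP [/eqP ->|bs]; first by rewrite scalerA -exprS.
  by rewrite scalerA mulrC -scalerA; apply: smodZ; exact: sw.
have mz'' (a : A) : m a -> N (a *: z').
  rewrite mE => sa; have : span [set` s] <=s (colon_ideal (lineS z') N).
    by apply: span_les => b /mz' Nb _ [c ->]; rewrite scalerA mulrC -scalerA; exact: smodZ.
  by move=> /(_ _ sa z'); apply; exists 1; rewrite scale1r.
apply: Nz'; have : addS N (lineS z') <=s N.
  apply: Nmax; first by move=> x; exact: addSl.
    by apply: addS_le => // _ [a ->]; apply: smodZ.
  exists (l + 1)%N; apply: lenle_add (lenle_simple mz'') _ => //.
  by move=> x; exact: addSl.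
by apply; apply: addSr; exists 1; rewrite scale1r.
Qed.
End FiniteLength.

(** * Graded modules over polynomial rings *)

Section GradedFamilies.
Variables (A : comNzRingType) (V : lmodType A) (a : nat -> A).

(* A graded module (Z_n / B_n)_n over the polynomial ring A[X_0, ..., X_(r-1)]
   is encoded by two families B <= Z of submodules of V, with X_k acting as
   multiplication by a k from degree n to degree n + 1. *)
Record gfam (r : nat) := Gfam {
  gf :> nat -> submodule V;
  gfP : forall k n x, (k < r)%N -> gf n x -> gf n.+1 (a k *: x) }.

Definition gle r (N N' : gfam r) := forall n, N n <=s N' n.

Definition noethg r (B Z : gfam r) := forall N : nat -> gfam r,
  (forall j, gle B (N j)) -> (forall j, gle (N j) Z) -> (forall j, gle (N j) (N j.+1)) ->
  exists j0, forall j, gle (N j) (N j0).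

Lemma gle_refl r (N : gfam r) : gle N N. Proof. by []. Qed.

Lemma gle_trans r (N1 N2 N3 : gfam r) : gle N1 N2 -> gle N2 N3 -> gle N1 N3.
Proof. by move=> h h' n; apply: smod_trans (h n) (h' n). Qed.

Lemma gle_mono r (N : nat -> gfam r) : (forall j, gle (N j) (N j.+1)) ->
  forall i j, (i <= j)%N -> gle (N i) (N j).
Proof.
move=> NS i j /subnK <-; elim: (j - i)%N => [|k IH] //; apply: gle_trans IH _.
by rewrite addSn; exact: NS.
Qed.

Lemma noethg_sub r (B Z B' Z' : gfam r) : noethg B Z -> gle B B' -> gle Z' Z -> noethg B' Z'.
Proof.
move=> h BB ZZ N NB NZ; apply: h => j; first exact: gle_trans BB (NB j).
exact: gle_trans (NZ j) ZZ.
Qed.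

Lemma noethg_max r (B Z : gfam r) (P : gfam r -> Prop) : noethg B Z -> gle B Z -> P B ->
  exists N, [/\ gle B N, gle N Z, P N & forall N', gle N N' -> gle N' Z -> P N' -> gle N' N].
Proof.
move=> noeth BZ PB; apply: contrapT => noN.
have step (N : {N | [/\ gle B N, gle N Z & P N]}) :
  exists N' : {N | [/\ gle B N, gle N Z & P N]}, gle (sval N) (sval N') /\ ~ gle (sval N') (sval N).
  case: N => N [h1 h2 h3] /=; apply: contrapT => noN'; apply: noN.
  exists N; split => // N' NN' N'Z PN'; apply: contrapT => nle; apply: noN'.
  by unshelve eexists (exist _ N' _) => //; split => //; apply: gle_trans NN'.
have [F HF] := choice step.
pose S := fun j => iter j F (exist _ B (And3 (@gle_refl _ B) BZ PB)).
have [|||j0 Hj] := noeth (fun j => sval (S j)).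
- by move=> j; case: (svalP (S j)).
- by move=> j; case: (svalP (S j)).
- by move=> j /=; case: (HF (S j)).
by have [_] := HF (S j0); apply; exact: (Hj j0.+1).
Qed.

(** * Hilbert's basis theorem for graded families *)

Section HilbertBasis.
Hypotheses (A_noeth : noetherian A) (V_fg : fin_gen (full_smod V)).

Section Generated.
Variables (K0 : submodule V) (B : nat -> submodule V).

(** [B] together with everything obtained from [K0], placed in degree 0, by the first [k] variables;
    the recursion splits off one factor of the last variable. *)
Fixpoint polyfam (k n : nat) : submodule V :=
  match k with
  | 0 => if n is 0%N then addS K0 (B 0) else B n
  | k'.+1 => (fix aux n := match n with
      | 0 => polyfam k' 0
      | n'.+1 => addS (polyfam k' n'.+1) (scaleS (a k') (aux n')) end) n
  end.

Lemma polyfamSS k n :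
  polyfam k.+1 n.+1 = addS (polyfam k n.+1) (scaleS (a k) (polyfam k.+1 n)).
Proof. by []. Qed.

Lemma polyfam_le k n : B n <=s polyfam k n.
Proof.
elim: k n => [|k IH] [|n] //; first by move=> x; exact: addSr.
by apply: smod_trans (IH _) _ => x; exact: addSl.
Qed.

Lemma polyfam_op r k n x : (forall k n x, (k < r)%N -> B n x -> B n.+1 (a k *: x)) ->
  (k < r)%N -> polyfam r n x -> polyfam r n.+1 (a k *: x).
Proof.
move=> BP; elim: r BP n x => [|r IH] // BP n x; rewrite ltnS leq_eqVlt.
move=> /orP [/eqP ->|kr] h; rewrite polyfamSS; first by apply: addSr; exists x.
have {}IH := IH (fun k n x kr => BP k n x (ltnW kr)).
elim: n x h => [|n IHn] x; first by move=> h; apply: addSl; exact: IH.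
rewrite {1}polyfamSS => -[y [_ [hy [z hz ->] ->]]].
rewrite scalerDr; apply: smodD; first by apply: addSl; apply: IH.
rewrite scalerA mulrC -scalerA; apply: addSr; exists (a k *: z) => //.
by rewrite polyfamSS; exact: IHn.
Qed.
End Generated.

Definition polyg (K0 : submodule V) r (B : gfam r) : gfam r :=
  Gfam (fun k n x kr => @polyfam_op K0 B r k n x (gfP (g := B)) kr).

Definition gdrop r (B : gfam r.+1) : gfam r :=
  @Gfam r B (fun k n x kr => gfP (g := B) (ltnW kr)).

Section Leading.
Variables (K0 : submodule V) (k : nat) (B : gfam k.+1).
Let Z := polyfam K0 B k.
Let b := a k.

Let Zop l n x : (l < k)%N -> Z n x -> Z n.+1 (a l *: x).
Proof. by move=> lk; apply: polyfam_op => // l' n' x' lk'; apply: gfP; exact: ltnW. Qed.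

(* Polynomials of degree < i in X_k, in total degree n + i. *)
Fixpoint lowdeg (i n : nat) : submodule V :=
  if i is i'.+1 then addS (scaleS (b ^+ i') (Z n.+1)) (lowdeg i' n.+1) else B n.

Lemma lowdeg_b i n x : lowdeg i n x -> lowdeg i.+1 n (b *: x).
Proof.
elim: i n x => [|i IH] n x.
  by move=> Bx; apply: addSr; apply: gfP.
move=> [_ [y [[z Zz ->] hy ->]]]; rewrite scalerDr; apply: smodD.
  by apply: addSl; exists z => //; rewrite scalerA -exprS.
by apply: addSr; exact: IH.
Qed.

Lemma lowdeg_op l i n x : (l < k)%N -> lowdeg i n x -> lowdeg i n.+1 (a l *: x).
Proof.
move=> lk; elim: i n x => [|i IH] n x; first by apply: gfP; rewrite ltnW.
move=> [_ [y [[z Zz ->] hy ->]]]; rewrite scalerDr; apply: smodD.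
  apply: addSl; exists (a l *: z); first exact: Zop.
  by rewrite !scalerA mulrC.
by apply: addSr; exact: IH.
Qed.

Lemma lowdeg_Z i n : Z (n + i.+1)%N <=s lowdeg i.+1 n.
Proof.
elim: i n => [|i IH] n.
  by move=> x; rewrite addn1 => Zx; apply: addSl; exists x; rewrite ?expr0 ?scale1r.
by move=> x; rewrite -addSnnS => /IH; exact: addSr.
Qed.

Lemma polyfam_lead n : polyfam K0 B k.+1 n <=s addS (scaleS (b ^+ n) (Z 0)) (lowdeg n 0).
Proof.
elim: n => [|n IH].
  by move=> x Zx; apply: addSl; exists x; rewrite ?expr0 ?scale1r.
rewrite polyfamSS; apply: addS_le.
  by move=> x Zx; apply: addSr; apply: lowdeg_Z.
move=> _ [x /IH [_ [y [[z Zz ->] hy ->]]] ->]; rewrite scalerDr; apply: smodD.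
  by apply: addSl; exists z => //; rewrite scalerA -exprS.
by apply: addSr; exact: lowdeg_b.
Qed.

(** Hilbert's leading coefficients: those of [X_k^i] in elements of [N] of total degree [n + i] and
    of degree at most [i] in [X_k]. *)
Definition leadfam (N : gfam k.+1) (i n : nat) : submodule V :=
  capS (Z n) (colon_smod (b ^+ i) (addS (N (n + i)%N) (lowdeg i n))).

Lemma leadfamP (N : gfam k.+1) i l n x : (l < k)%N -> leadfam N i n x ->
  leadfam N i n.+1 (a l *: x).
Proof.
move=> lk [Zx [y [z [Ny hz E]]]]; split; first exact: Zop.
exists (a l *: y), (a l *: z); split.
- by rewrite addSn; apply: gfP => //; exact: ltnW.
- exact: lowdeg_op.
- by rewrite scalerA mulrC -scalerA E scalerDr.
Qed.

Definition leadg N i : gfam k := Gfam (@leadfamP N i).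

Lemma leadg_B N i : gle B N -> gle (gdrop B) (leadg N i).
Proof.
move=> BN n x Bx; split; first exact: polyfam_le.
apply: addSl; apply: BN; elim: i => [|i IH]; first by rewrite expr0 scale1r addn0.
by rewrite exprS -scalerA addnS; apply: gfP.
Qed.

Lemma leadg_mono N N' i : gle N N' -> gle (leadg N i) (leadg N' i).
Proof.
move=> NN n x [Zx [y [z [Ny hz E]]]]; split => //; exists y, z; split => //.
exact: NN.
Qed.

Lemma leadg_step N i : gle (leadg N i) (leadg N i.+1).
Proof.
move=> n x [Zx [y [z [Ny hz E]]]]; split => //; exists (b *: y), (b *: z); split.
- by rewrite addnS; apply: gfP.
- exact: lowdeg_b.
- by rewrite exprS -scalerA E scalerDr.
Qed.

(** An element of [N'] of degree [i] in [X_k] has the same leading coefficient as some element of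
    [N]; their difference has lower degree in [X_k], and induction applies. *)
Lemma leadg_inj (N N' : gfam k.+1) : gle B N -> gle N N' -> gle N' (polyg K0 B) ->
  (forall i, gle (leadg N' i) (leadg N i)) -> gle N' N.
Proof.
move=> BN NN N'Z LL.
have H i n : capS (N' (n + i)%N) (addS (scaleS (b ^+ i) (Z n)) (lowdeg i n)) <=s N (n + i)%N.
  elim: i n => [|i IH] n x [N'x [_ [t [[z Zz ->] ht xE]]]].
  - have [|_ [y [t' [Ny ht']]]] := LL 0%N n z.
      split=> //; exists x, (- t); split => //; first exact: smodN.
      by rewrite xE addrK.
    move=> zE; rewrite xE zE -addrA; apply: smodD => //; rewrite addn0.
    by apply: BN; exact: smodD.
  - have [|_ [y [t' [Ny ht' zE]]]] := LL i.+1 n z.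
      split=> //; exists x, (- t); split => //; first exact: smodN.
      by rewrite xE addrK.
    rewrite -(subrK y x); apply: smodD => //.
    rewrite addnS -addSn; apply: IH; split.
      by rewrite addSn -addnS; apply: smodB => //; exact: NN.
    have -> : x - y = t' + t by rewrite xE zE -[y + t' + t]addrA addrAC subrr add0r.
    exact: (@smodD _ _ (lowdeg i.+1 n)).
move=> n x N'x; apply: (H n 0%N); split => //; apply: polyfam_lead; exact: N'Z.
Qed.
End Leading.

Theorem hilbert_basis (K0 : submodule V) r (B : gfam r) : noethg B (polyg K0 B).
Proof.
elim: r B => [|r IH] B N NB NZ NS.
  have [|||j0 Hj] := @acc_stable A A_noeth V (full_smod V) (fun j => N j 0%N) => //.
    by move=> j; exact: NS.
  exists j0 => j [|n] //; apply: smod_trans (NZ j n.+1) _; exact: NB.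
have mono := gle_mono NS.
have monoL j i j' i' : (j <= j')%N -> (i <= i')%N -> gle (leadg K0 B (N j) i) (leadg K0 B (N j') i').
  move=> jj ii; apply: gle_trans (leadg_mono (mono _ _ jj)) _.
  by apply: gle_mono ii => i2; exact: leadg_step.
have st (L : nat -> gfam r) : (forall j, gle (gdrop B) (L j)) -> 
    (forall j, gle (L j) (polyg K0 (gdrop B))) -> (forall j, gle (L j) (L j.+1)) ->
    exists j0, forall j, gle (L j) (L j0) by exact: IH.
have [|||j0 Hj0] := st (fun j => leadg K0 B (N j) j).
- by move=> j; exact: leadg_B.
- by move=> j n x [].
- by move=> j; exact: monoL.
have /choice [F HF] i : exists ji, forall j, gle (leadg K0 B (N j) i) (leadg K0 B (N ji) i).
  apply: st => [j|j n x []|j] //; first exact: leadg_B.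
  exact: leadg_mono.
(* The coefficient families increase in both indices. The diagonal is stationary from [j0] on, which
   settles [i >= j0]; the finitely many [i < j0] have their own bounds [F i]. *)
pose J := maxn j0 (\max_(i < j0) F i).
exists J => j; case: (leqP j J) => [/mono //|/ltnW Jj].
apply: leadg_inj (mono _ _ Jj) (NZ j) _; first exact: NB.
move=> i; case: (ltnP i j0) => [ij|ji].
  apply: gle_trans (HF i j) _; apply: leadg_mono; apply: mono.
  rewrite leq_max; apply/orP; right; exact: (leq_bigmax (Ordinal ij)).
apply: gle_trans (_ : gle _ (leadg K0 B (N (maxn i j)) (maxn i j))) _.
  by apply: monoL; rewrite ?leq_maxl ?leq_maxr.
by apply: gle_trans (Hj0 _) _; apply: monoL => //; exact: leq_maxl.
Qed.
End HilbertBasis.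

(** * Devissage along the variables *)

Section Devissage.
Variable r : nat.
Implicit Types B Z T : gfam r.

Definition zeroop k B Z := forall n x, Z n x -> B n.+1 (a k *: x).
Definition injop k B Z := forall n x, Z n x -> B n.+1 (a k *: x) -> B n x.

(** [Z] modulo this family is the cokernel of multiplication by [X_k] on [Z / B]. *)
Definition quofam k B Z n : submodule V :=
  if n is n'.+1 then addS (B n) (scaleS (a k) (Z n')) else B 0.

Lemma quofamP k B Z l n x : (l < r)%N -> quofam k B Z n x -> quofam k B Z n.+1 (a l *: x).
Proof.
move=> lr; case: n => [|n]; first by move=> Bx; apply: addSl; apply: gfP.
move=> [y [_ [By [z Zz ->] ->]]]; rewrite scalerDr; apply: smodD.
  by apply: addSl; apply: gfP.
apply: addSr; exists (a l *: z); first exact: gfP.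
by rewrite !scalerA mulrC.
Qed.
Definition quog k B Z : gfam r := Gfam (@quofamP k B Z).

Lemma quog_ge k B Z : gle B (quog k B Z).
Proof. by move=> [|n] x //; exact: addSl. Qed.
Lemma quog_le k B Z : (k < r)%N -> gle B Z -> gle (quog k B Z) Z.
Proof.
move=> kr BZ [|n]; first exact: BZ.
by apply: addS_le; [exact: BZ|move=> _ [x Zx ->]; exact: gfP].
Qed.

Definition kerfam k B Z n : submodule V := capS (Z n) (colon_smod (a k) (B n.+1)).
Lemma kerfamP k B Z l n x : (l < r)%N -> kerfam k B Z n x -> kerfam k B Z n.+1 (a l *: x).
Proof.
move=> lr [Zx Bx]; split; first exact: gfP.
by rewrite /= scalerA mulrC -scalerA; apply: gfP.
Qed.
Definition kerg k B Z : gfam r := Gfam (@kerfamP k B Z).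

Variable Phi : gfam r -> gfam r -> Prop.
Hypothesis D1 : forall B Z T, gle B Z -> gle Z T -> Phi B Z -> Phi Z T -> Phi B T.
Hypothesis D2 : forall B Z, gle B Z -> noethg B Z ->
  (forall k, (k < r)%N -> zeroop k B Z) -> Phi B Z.
Hypothesis D3 : forall B Z k, (k < r)%N -> gle B Z -> noethg B Z -> injop k B Z ->
  Phi (quog k B Z) Z -> Phi B Z.

(** Go through the variables: when the kernel of [X_l] on [Z' / B] is nonzero, replace [Z'] by it.
    Both alternatives pass to subfamilies, so earlier variables keep theirs. *)
Lemma zero_or_inj B Z : gle B Z -> ~ gle Z B -> forall l, (l <= r)%N ->
  exists Z', [/\ gle B Z', gle Z' Z, ~ gle Z' B
    & forall k, (k < l)%N -> zeroop k B Z' \/ injop k B Z'].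
Proof.
move=> BZ ZB; elim=> [|l IH] lr; first by exists Z; split.
have [Z' [BZ' Z'Z Z'B Hk]] := IH (ltnW lr).
case: (pselect (gle (kerg l B Z') B)) => [inj|ninj].
  exists Z'; split => // k; rewrite ltnS leq_eqVlt => /orP [/eqP ->|/Hk //].
  by right=> n x Zx Bx; apply: inj.
have sub : gle (kerg l B Z') Z' by move=> n x [].
exists (kerg l B Z'); split => //.
- by move=> n x Bx; split; [exact: BZ'|apply: gfP].
- exact: gle_trans Z'Z.
- move=> k; rewrite ltnS leq_eqVlt => /orP [/eqP ->|/Hk [h|h]].
  + by left => n x [].
  + by left => n x /sub; exact: h.
  + by right => n x /sub; exact: h.
Qed.

(** Induction on the number of variables acting nontrivially on [Z / B]. Above a maximal [N] with
    [Phi B N] lies a nonzero piece on which every variable is zero or injective. If [X_k] is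
    injective there, it is zero on its own cokernel, so the induction hypothesis holds for the
    cokernel and [D3] contradicts maximality. *)
Theorem devissage B Z : gle B Z -> noethg B Z -> Phi B Z.
Proof.
pose nz B Z := [set k : 'I_r | ~~ `[< zeroop k B Z >]]%SET.
elim: {B Z}(#|nz B Z|) {-2}B {-2}Z (leqnn #|nz B Z|) => [|c IH] B Z.
  rewrite leqn0 cards_eq0 => /eqP nz0 BZ noeth; apply: D2 => // k kr.
  have : Ordinal kr \notin nz B Z by rewrite nz0 inE.
  by rewrite inE negbK => /asboolP.
move=> cB BZ noeth.
have PB : Phi B B.
  apply: D2 => //; first exact: noethg_sub noeth (@gle_refl _ B) BZ.
  by move=> k kr n x; exact: gfP.
have [N [BN NZ PN Nmax]] := noethg_max noeth BZ PB.
case: (pselect (gle Z N)) => [ZN|nZN]; first by apply: (D1 BN NZ PN); apply: D2 => //;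
  [exact: noethg_sub noeth BN (@gle_refl _ Z)|move=> k kr n x /ZN; exact: gfP].
have [Z' [NZ' Z'Z nZ'N Hk]] := zero_or_inj NZ nZN (leqnn r).
have noeth' : noethg N Z' by exact: noethg_sub noeth BN Z'Z.
exfalso; apply: nZ'N; apply: Nmax => //; apply: (D1 (Z := N)) => //.
case: (pselect (forall k, (k < r)%N -> zeroop k N Z')) => [h|]; first exact: D2.
move=> /existsNP [k /not_implyP [kr nzk]].
have [//|injk] := Hk k kr.
apply: (D3 kr) => //; apply: IH; last 1 first.
- exact: noethg_sub noeth' (@quog_ge _ _ _) (@gle_refl _ Z').
- have sub B' : gle N B' -> nz B' Z' \subset nz B Z.
    move=> NB'; apply/fintype.subsetP => l; rewrite !inE; apply: contra => /asboolP h.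
    by apply/asboolP => n x /Z'Z /h /BN /NB'.
  have := sub _ (@quog_ge k N Z'); move=> s1.
  rewrite -ltnS; apply: leq_trans cB; apply: proper_card; rewrite properE s1 /=.
  apply/subsetPn; exists (Ordinal kr); rewrite inE.
    by apply/asboolP => h; apply: nzk => n x /Z'Z /h /BN.
  by rewrite negbK; apply/asboolP => n x Zx; apply: addSr; exists x.
- exact: quog_le.
Qed.
End Devissage.
End GradedFamilies.

(** * Colimits of Koszul complexes *)

(** Commuting additive operators suffice for Koszul complexes; this covers elements of [A] acting on
    a module ([mulops]) and homogeneous classes acting on a graded module ([totops]). *)
Record opmod := Opmod {
  om :> zmodType;
  op : nat -> om -> om;
  opB : forall k x y, op k (x - y) = op k x - op k y;
  opC : forall j k x, op j (op k x) = op k (op j x) }.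

Section Operators.
Variable V : opmod.

Lemma op0 k : op k (0 : V) = 0.
Proof. by have := opB k (0 : V) 0; rewrite !subrr. Qed.

Definition opn k t (x : V) : V := iter t (op k) x.

Lemma opnB k t x y : opn k t (x - y) = opn k t x - opn k t y.
Proof. by elim: t => [|t IH] //=; rewrite IH opB. Qed.
Lemma opn0 k t : opn k t 0 = 0.
Proof. by elim: t => [|t IH] //=; rewrite IH op0. Qed.
Lemma opnC1 j k t x : op j (opn k t x) = opn k t (op j x).
Proof. by elim: t => [|t IH] //=; rewrite opC IH. Qed.
Lemma opnC j k s t x : opn j s (opn k t x) = opn k t (opn j s x).
Proof. by elim: s => [|s IH] //=; rewrite IH opnC1. Qed.
Lemma opnD k s t x : opn k (s + t) x = opn k s (opn k t x).
Proof. by rewrite /opn iterD. Qed.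

Record gset (R : nat) := Gset {
  gs :> nat -> V -> Prop;
  gs0 : forall n, gs n 0;
  gsB : forall n x y, gs n x -> gs n y -> gs n (x - y);
  gsop : forall k n x, (k < R)%N -> gs n x -> gs n.+1 (op k x) }.

Lemma gsN R (Z : gset R) n x : Z n x -> Z n (- x).
Proof. by rewrite -sub0r; apply: gsB; exact: gs0. Qed.

Lemma gsopn R (Z : gset R) k t n x : (k < R)%N -> Z n x -> Z (n + t)%N (opn k t x).
Proof.
by move=> kR; elim: t => [|t IH] Zx; rewrite ?addn0 // addnS; apply: gsop => //; exact: IH.
Qed.
End Operators.

(** The exterior algebra on [r] generators with coefficients in [V]: [c.1] collects the terms
    without the last generator and [c.2] those with it. *)
Fixpoint cochain (V : zmodType) (r : nat) : zmodType :=
  if r is r'.+1 then (cochain V r' * cochain V r')%type else V.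

Fixpoint cmap (V W : zmodType) t (g : nat -> V -> W) r n : cochain V r -> cochain W r :=
  match r with
  | 0 => g n
  | r'.+1 => fun c => (cmap t g n c.1, cmap t g (n + t)%N c.2)
  end.

Fixpoint fop (V : zmodType) (g : V -> V) r : cochain V r -> cochain V r :=
  match r with 0 => g | r'.+1 => fun c => (fop g c.1, fop g c.2) end.

Lemma pair_ext (S T : Type) (p q : S * T) : p.1 = q.1 -> p.2 = q.2 -> p = q.
Proof. by case: p q => [? ?] [? ?] /= -> ->. Qed.

Lemma subf0 (V W : zmodType) (f : V -> W) :
  (forall x y, f (x - y) = f x - f y) -> f 0 = 0.
Proof. by move=> fB; have := fB 0 0; rewrite !subrr. Qed.

Lemma subrACA (V : zmodType) (a b c d : V) : a - b - (c - d) = a - c - (b - d).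
Proof. by rewrite !opprD !opprK addrACA. Qed.

Section Koszul.
Variable V : opmod.
Variable R : nat.
Implicit Types Z B T : gset V R.

(* The differential of the Koszul complex of the t-th powers of the first r
   operators, as iterated mapping cones. *)
Fixpoint kd t r : cochain V r -> cochain V r :=
  match r with
  | 0 => fun=> 0
  | r'.+1 => fun c => (kd t c.1, fop (opn r' t) c.1 - kd t c.2)
  end.

(* The transition map from t-th to (s + t)-th powers. *)
Fixpoint kphi s r : cochain V r -> cochain V r :=
  match r with
  | 0 => id
  | r'.+1 => fun c => (kphi s c.1, fop (opn r' s) (kphi s c.2))
  end.

(* Cochains of degree i - 1 with coefficients in Z, of internal degree n. *)
Fixpoint kin (Z : nat -> V -> Prop) t r i n : cochain V r -> Prop :=
  match r with
  | 0 => fun c => if i is 1%N then Z n c else c = 0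
  | r'.+1 => fun c => kin Z t i n c.1 /\
       if i is i'.+1 then kin Z t i' (n + t)%N c.2 else c.2 = 0
  end.

(* The vanishing in degree n of the i-th local cohomology module of Z / B,
   computed as a colimit of Koszul cohomology modules. *)
Definition van Z B r i n := forall t (c : cochain V r),
  kin Z t i.+1 n c -> kin B t i.+2 n (kd t c) ->
  exists s (y : cochain V r),
    kin Z (s + t) i n y /\ kin B (s + t) i.+1 n (kphi s c - kd (s + t) y).

Lemma fopB (g : V -> V) r (x y : cochain V r) : (forall x y, g (x - y) = g x - g y) ->
  fop g (x - y) = fop g x - fop g y.
Proof.
by move=> gB; elim: r x y => [|r IH] x y //=; apply: pair_ext => /=; rewrite IH.
Qed.

Lemma fopnB k t r (x y : cochain V r) :
  fop (opn k t) (x - y) = fop (opn k t) x - fop (opn k t) y.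
Proof. by apply: fopB => ? ?; rewrite opnB. Qed.

Lemma fopn0 k t r : fop (opn k t) (0 : cochain V r) = 0.
Proof. by apply: subf0 => x y; exact: fopnB. Qed.
Lemma fopnN k t r (x : cochain V r) : fop (opn k t) (- x) = - fop (opn k t) x.
Proof. by rewrite -sub0r fopnB fopn0 sub0r. Qed.
Lemma fopnD k t r (x y : cochain V r) :
  fop (opn k t) (x + y) = fop (opn k t) x + fop (opn k t) y.
Proof. by rewrite -[y]opprK fopnB !fopnN. Qed.

Lemma fopnC j k s t r (c : cochain V r) :
  fop (opn j s) (fop (opn k t) c) = fop (opn k t) (fop (opn j s) c).
Proof. by elim: r c => [|r IH] c; [exact: opnC|apply: pair_ext; exact: IH]. Qed.

Lemma fopnDn k s t r (c : cochain V r) :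
  fop (opn k (s + t)) c = fop (opn k s) (fop (opn k t) c).
Proof. by elim: r c => [|r IH] c; [exact: opnD|apply: pair_ext; exact: IH]. Qed.

Lemma fopn_0 k r (c : cochain V r) : fop (opn k 0) c = c.
Proof. by elim: r c => [|r IH] c //; apply: pair_ext; exact: IH. Qed.

Lemma kdB t r (x y : cochain V r) : kd t (x - y) = kd t x - kd t y.
Proof.
elim: r x y => [|r IH] x y /=; first by rewrite subrr.
by apply: pair_ext => /=; rewrite !IH // fopnB subrACA.
Qed.
Lemma kd0 t r : kd t (0 : cochain V r) = 0.
Proof. by apply: subf0 => x y; exact: kdB. Qed.
Lemma kdN t r (x : cochain V r) : kd t (- x) = - kd t x.
Proof. by rewrite -sub0r kdB kd0 sub0r. Qed.
Lemma kdD t r (x y : cochain V r) : kd t (x + y) = kd t x + kd t y.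
Proof. by rewrite -[y]opprK kdB !kdN. Qed.

Lemma kd_fop t k s r (c : cochain V r) : kd t (fop (opn k s) c) = fop (opn k s) (kd t c).
Proof.
elim: r c => [|r IH] c /=; first by rewrite opn0.
by apply: pair_ext => /=; rewrite ?fopnB !IH // fopnC.
Qed.

Lemma kd_kd t r (c : cochain V r) : kd t (kd t c) = 0.
Proof.
elim: r c => [|r IH] c //=; apply: pair_ext => /=; first exact: IH.
by rewrite kdB IH subr0 kd_fop subrr.
Qed.

Lemma kphiB s r (x y : cochain V r) : kphi s (x - y) = kphi s x - kphi s y.
Proof. by elim: r x y => [|r IH] x y //=; apply: pair_ext => /=; rewrite !IH // fopnB. Qed.
Lemma kphi0 s r : kphi s (0 : cochain V r) = 0.
Proof. by apply: subf0 => x y; exact: kphiB. Qed.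

Lemma kphi_fop s k t r (c : cochain V r) :
  kphi s (fop (opn k t) c) = fop (opn k t) (kphi s c).
Proof. by elim: r c => [|r IH] c //=; apply: pair_ext => /=; rewrite !IH // fopnC. Qed.

Lemma kphi_kd s t r (c : cochain V r) : kphi s (kd t c) = kd (s + t) (kphi s c).
Proof.
elim: r c => [|r IH] c //=; apply: pair_ext => /=; first exact: IH.
by rewrite kphiB fopnB kphi_fop fopnDn IH kd_fop.
Qed.

Lemma kphi_kphi s s' r (c : cochain V r) : kphi s (kphi s' c) = kphi (s + s') c.
Proof.
by elim: r c => [|r IH] c //=; apply: pair_ext => /=; rewrite ?IH // kphi_fop IH fopnDn.
Qed.

Lemma kin0 Z t r i n : kin Z t i n (0 : cochain V r).
Proof.
elim: r i n => [|r IH] i n /=; first by case: i => [|[|i]] //; exact: gs0.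
by split; [exact: IH|case: i => // i; exact: IH].
Qed.

Lemma kinB Z t r i n (x y : cochain V r) : kin Z t i n x -> kin Z t i n y ->
  kin Z t i n (x - y).
Proof.
elim: r i n x y => [|r IH] i n x y /=.
  by case: i => [|[|i]]; [move=> -> ->; rewrite subrr|exact: gsB|move=> -> ->; rewrite subrr].
move=> [h1 h2] [k1 k2]; split; first exact: IH.
by case: i h2 k2 {h1 k1} => [|i]; [move=> /= -> ->; rewrite subrr|exact: IH].
Qed.
Lemma kinN Z t r i n (x : cochain V r) : kin Z t i n x -> kin Z t i n (- x).
Proof. by rewrite -sub0r; apply: kinB; exact: kin0. Qed.
Lemma kinD Z t r i n (x y : cochain V r) : kin Z t i n x -> kin Z t i n y ->
  kin Z t i n (x + y).
Proof. by move=> Zx Zy; rewrite -[y]opprK; apply: kinB => //; exact: kinN. Qed.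

Lemma kin_mono (Z B : nat -> V -> Prop) t r i n (x : cochain V r) :
  (forall n' x, (n <= n')%N -> Z n' x -> B n' x) ->
  kin Z t i n x -> kin B t i n x.
Proof.
elim: r i n x => [|r IH] i n x ZB /=; first by case: i => [|[|i]] //; exact: ZB.
move=> [h1 h2]; split; first exact: IH.
case: i h2 {h1} => // i; apply: IH => n' y nn; apply: ZB.
exact: leq_trans (leq_addr _ _) nn.
Qed.

Lemma kin_i0 Z t r n (x : cochain V r) : kin Z t 0 n x -> x = 0.
Proof. by elim: r n x => [|r IH] n x //= [/IH h1 h2]; apply: pair_ext. Qed.

Lemma kin_big Z t r i n (x : cochain V r) : (r.+1 < i)%N -> kin Z t i n x -> x = 0.
Proof.
elim: r i n x => [|r IH] [|i] n x //=; first by case: i.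
move=> ri [h1 h2]; apply: pair_ext; [apply: IH h1|exact: IH h2].
by apply: leq_trans ri; rewrite ltnW.
Qed.

Lemma kin_fop Z t k s r i n (x : cochain V r) : (k < R)%N ->
  kin Z t i n x -> kin Z t i (n + s) (fop (opn k s) x).
Proof.
move=> kR; elim: r i n x => [|r IH] i n x /=.
  by case: i => [|[|i]]; [move=> ->; rewrite opn0|exact: gsopn|move=> ->; rewrite opn0].
move=> [h1 h2]; split; first exact: IH.
by case: i h2 {h1} => [->|i h2]; [rewrite fopn0|rewrite /= addnAC; exact: IH].
Qed.

Lemma kin_kd Z t r i n (x : cochain V r) : (r <= R)%N ->
  kin Z t i n x -> kin Z t i.+1 n (kd t x).
Proof.
elim: r i n x => [|r IH] i n x rR /=.
  by case: i => [|i] // _; exact: gs0.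
move=> [h1 h2]; split; first by apply: IH => //; exact: ltnW.
apply: kinB; first exact: kin_fop.
by case: i h2 {h1} => [->|i h2]; [rewrite kd0; exact: kin0|apply: IH => //; exact: ltnW].
Qed.

Lemma kin_phi Z s t r i n (x : cochain V r) : (r <= R)%N ->
  kin Z t i n x -> kin Z (s + t) i n (kphi s x).
Proof.
elim: r i n x => [|r IH] i n x rR //= [h1 h2]; split; first by apply: IH => //; exact: ltnW.
case: i h2 {h1} => [->|i h2]; first by rewrite kphi0 fopn0.
rewrite /= [(s + t)%N]addnC addnA [(t + s)%N]addnC; apply: kin_fop => //.
by apply: IH => //; exact: ltnW.
Qed.

Definition gsle Z B := forall n x, Z n x -> B n x.

Lemma kin_le Z B t r i n (x : cochain V r) : gsle Z B -> kin Z t i n x -> kin B t i n x.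
Proof. by move=> ZB; apply: kin_mono => n' y _; exact: ZB. Qed.

(** The middle of the long exact sequence of [0 -> Z/B -> T/B -> T/Z -> 0]: a cocycle is first
    bounded modulo [Z], and what remains is a cocycle of [Z/B]. *)
Lemma van_ext B Z T r i n : (r <= R)%N -> gsle B Z -> gsle Z T ->
  van Z B r i n -> van T Z r i n -> van T B r i n.
Proof.
move=> rR BZ ZT h1 h2 t c cT dc.
have [s [y [yT hy]]] := h2 t c cT (kin_le BZ dc).
have [|s' [y' [yZ hy']]] := h1 (s + t)%N _ hy.
  by rewrite kdB kd_kd subr0 -kphi_kd; exact: kin_phi.
exists (s' + s)%N, (kphi s' y + y'); rewrite -addnA; split.
  by apply: kinD; [exact: kin_phi|exact: kin_le yZ].
move: hy'; rewrite kphiB kphi_kphi kphi_kd.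
by rewrite kdD opprD addrA.
Qed.

(** The connecting map sends the class of [c] to that of [kd t c]. Once [y] bounds the latter,
    [kphi s c - y] is a cocycle modulo [B]. *)
Lemma van_quot B Z T r i n : (r <= R)%N -> gsle B Z -> gsle Z T ->
  van T B r i n -> van Z B r i.+1 n -> van T Z r i n.
Proof.
move=> rR BZ ZT h1 h2 t c cT dc.
have [|s [y [yZ hy]]] := h2 t _ dc; first by rewrite kd_kd; exact: kin0.
have [| |s' [y' [yT hy']]] := h1 (s + t)%N (kphi s c - y).
- by apply: kinB; [exact: kin_phi|exact: kin_le yZ].
- by rewrite kdB -kphi_kd.
exists (s' + s)%N, y'; rewrite -addnA; split => //.
have -> : kphi (s' + s) c - kd (s' + (s + t)) y' =
   (kphi s' (kphi s c - y) - kd (s' + (s + t)) y') + kphi s' y.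
  by rewrite kphiB kphi_kphi addrAC subrK.
by apply: kinD; [exact: kin_le hy'|exact: kin_phi].
Qed.

Lemma van_big B Z r i n : (r < i)%N -> van Z B r i n.
Proof.
move=> ri t c cZ _; exists 0%N, 0; split; first exact: kin0.
by rewrite (kin_big _ cZ) // kphi0 kd0 subr0; exact: kin0.
Qed.

Lemma van_triv B Z r i n : (forall n' x, (n <= n')%N -> Z n' x -> B n' x) -> van Z B r i n.
Proof.
move=> ZB t c cZ _; exists 0%N, 0; split; first exact: kin0.
rewrite kd0 subr0.
have -> : kphi 0 c = c by elim: (r) (c) => [|r' IH] c' //=; apply: pair_ext; rewrite /= IH ?fopn_0.
exact: kin_mono cZ.
Qed.

(** In positive cohomological degree the transition map [kphi 1] multiplies every coefficient by
    some operator, so one step of the colimit kills it. *)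
Lemma van_zero B Z r i n : (r <= R)%N ->
  (forall k n x, (k < r)%N -> Z n x -> B n.+1 (op k x)) -> van Z B r i.+1 n.
Proof.
move=> rR ZB t c cZ _; exists 1%N, 0; split; first exact: kin0.
rewrite kd0 subr0.
have fopz k r' j n' (x : cochain V r') : (k < r)%N -> kin Z (1 + t) j n' x ->
    kin B (1 + t) j n'.+1 (fop (opn k 1) x).
  move=> kr; elim: r' j n' x => [|r' IH] j n' x /=.
    by case: j => [|[|j]]; [move=> ->; rewrite op0|exact: ZB|move=> ->; rewrite op0].
  move=> [h1 h2]; split; first exact: IH.
  by case: j h2 {h1} => [->|j h2]; [rewrite fopn0|rewrite /= addSn; exact: IH].
suff H r' j n' (x : cochain V r') : (r' <= r)%N -> kin Z t j.+2 n' x ->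
  kin B (1 + t) j.+2 n' (kphi 1 x) by exact: H.
elim: r' j n' x => [|r' IH] j n' x //= rr' [h1 h2]; split.
  by apply: IH => //; exact: ltnW.
have -> : (n' + (1 + t) = (n' + t).+1)%N by lia.
apply: fopz => //; apply: kin_phi => //.
by apply: leq_trans rR; exact: ltnW.
Qed.

Section Homotopy.
Variable k : nat.
(** Contraction with the [k]-th generator; by [kh_homotopy] it makes [X_k^t] null-homotopic on the
    Koszul complex of [t]-th powers. *)
Fixpoint kh r : cochain V r -> cochain V r :=
  match r with
  | 0 => fun=> 0
  | r'.+1 => fun c => if k == r' then (c.2, 0) else (kh c.1, - kh c.2)
  end.

Lemma khB r (x y : cochain V r) : kh (x - y) = kh x - kh y.
Proof.
elim: r x y => [|r IH] x y /=; first by rewrite subrr.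
case: eqP => _; apply: pair_ext => //=; rewrite ?subrr // IH // opprB opprK addrC //.
Qed.

Lemma kh_fop j s r (c : cochain V r) : kh (fop (opn j s) c) = fop (opn j s) (kh c).
Proof.
elim: r c => [|r IH] c /=; first by rewrite opn0.
by case: eqP => _; apply: pair_ext => //=; rewrite ?fopn0 ?IH ?fopnN.
Qed.

Lemma kh_homotopy t r (c : cochain V r) : (k < r)%N ->
  kd t (kh c) + kh (kd t c) = fop (opn k t) c.
Proof.
elim: r c => [|r IH] c //=; rewrite ltnS leq_eqVlt; case: eqP => [->|_] /= kr.
  apply: pair_ext => /=; first by rewrite addrC subrK.
  by rewrite kd0 subr0 addr0.
apply: pair_ext => /=; first exact: IH.
by rewrite khB kh_fop kdN opprK opprB [X in _ + X]addrC addrACA subrr add0r IH.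
Qed.

Lemma kin_kh Z t r i n (c : cochain V r) : kin Z t i.+1 n c -> kin Z t i (n + t) (kh c).
Proof.
elim: r i n c => [|r IH] i n c /=; first by move=> _; case: i => [|[|i]] //; exact: gs0.
move=> [h1 h2]; case: eqP => _ /=; split => //.
- by case: i {h1 h2} => // i; exact: kin0.
- exact: IH.
- case: i h2 {h1} => [/kin_i0 ->|i h2]; last by apply: kinN; exact: IH.
  by rewrite (subf0 (@khB r)) oppr0.
Qed.
End Homotopy.

Lemma fop_inj_kin B Z k t r i n (c : cochain V r) :
  (forall n x, Z n x -> B n.+1 (op k x) -> B n x) ->
  kin Z t i n c -> kin B t i n.+1 (fop (opn k 1) c) -> kin B t i n c.
Proof.
move=> inj; elim: r i n c => [|r IH] i n c /=; first by case: i => [|[|i]] //; exact: inj.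
move=> [h1 h2] [k1 k2]; split; first exact: IH.
by case: i h2 k2 {h1 k1} => // i h2; rewrite addSn; exact: IH.
Qed.

Lemma kin_quot B Z (Q : nat -> V -> Prop) k t r i n (c : cochain V r) :
  (forall n x, Q n.+1 x -> exists b z, [/\ B n.+1 b, Z n z & x = b + op k z]) ->
  kin Q t i n.+1 c ->
  exists b u, [/\ kin B t i n.+1 b, kin Z t i n u & c = b + fop (opn k 1) u].
Proof.
move=> HQ; elim: r i n c => [|r IH] i n c /=.
  case: i => [|[|i]].
  - by move=> ->; exists 0, 0; rewrite op0 addr0.
  - by move=> /HQ [b [z [Bb Zz ->]]]; exists b, z.
  - by move=> ->; exists 0, 0; rewrite op0 addr0.
case: c => c1 c2 /= [/IH [b1 [u1 [h1 h2 ->]]]].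
case: i {h1 h2} (h1) (h2) => [|i] h1 h2.
  by move=> ->; exists (b1, 0), (u1, 0); split => //=; apply: pair_ext; rewrite //= fopn0 addr0.
rewrite addSn => /IH [b2 [u2 [k1 k2 ->]]].
by exists (b1, b2), (u1, u2).
Qed.

(** If [H^i] of the cokernel of [X_k] vanishes in degree [n' + 1], then [X_k] is injective on
    [H^(i+1)] from degree [n'] to [n' + 1]; but every class is killed by a power of [X_k]. *)
Lemma van_inj B Z Q k r i n : (r <= R)%N -> (k < r)%N -> gsle B Z -> gsle B Q ->
  (forall n x, Z n x -> Q n.+1 (op k x)) ->
  (forall n x, Z n x -> B n.+1 (op k x) -> B n x) ->
  (forall n x, Q n.+1 x -> exists b z, [/\ B n.+1 b, Z n z & x = b + op k z]) ->
  (forall n', (n <= n')%N -> van Z Q r i n'.+1) -> van Z B r i.+1 n.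
Proof.
move=> rR kr BZ BQ ZQ inj HQ H t c cZ dc; have kR := leq_trans kr rR.
(* [X_k^e] kills the class of [c'], with witness [y]. The homotopy provides [e = t], and the
   induction lowers [e] to 0. *)
suff main e t' (c' : cochain V r) y : kin Z t' i.+2 n c' -> kin B t' i.+3 n (kd t' c') ->
    kin Z t' i.+1 (n + e) y -> kin B t' i.+2 (n + e) (fop (opn k e) c' - kd t' y) ->
    exists s (y' : cochain V r), kin Z (s + t') i.+1 n y' /\
      kin B (s + t') i.+2 n (kphi s c' - kd (s + t') y').
  apply: (main t t c (kh k c)) => //; first exact: kin_kh.
  rewrite -(kh_homotopy t c kr) addrAC subrr add0r; exact: kin_kh.
elim: e t' c' y => [|e IH] t' c' y c'Z dc' yZ hy.
  exists 0%N, y; rewrite addn0 in yZ hy; split => //.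
  have -> : kphi 0 c' = c' by elim: (r) (c') => [|r' IH] c1 //=; apply: pair_ext; rewrite /= IH ?fopn_0.
  by rewrite -[c'](fopn_0 k).
rewrite addnS in yZ hy; pose c1 := fop (opn k e) c'.
have c1Z : kin Z t' i.+2 (n + e) c1 by exact: kin_fop.
have E1 : fop (opn k e.+1) c' = fop (opn k 1) c1 by rewrite -add1n fopnDn.
have opQ j n' t1 r' (x : cochain V r') : kin Z t1 j n' x -> kin Q t1 j n'.+1 (fop (opn k 1) x).
  elim: r' j n' x => [|r' IH'] j n' x /=.
    by case: j => [|[|j]]; [move=> ->; rewrite op0|exact: ZQ|move=> ->; rewrite op0].
  move=> [h1 h2]; split; first exact: IH'.
  by case: j h2 {h1} => [->|j h2]; [rewrite fopn0|rewrite /= addSn; exact: IH'].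
(* [y] is a cocycle modulo [Q], as its differential is a multiple of [X_k] up to [B]. Bounding it
   and dividing the rest by [X_k] gives the witness [u] for [X_k^e]. *)
have [|s [w [wZ]]] := H (n + e)%N (leq_addr _ _) t' y yZ.
  have -> : kd t' y = fop (opn k 1) c1 - (fop (opn k e.+1) c' - kd t' y) by rewrite E1 opprB addrC subrK.
  apply: kinB; first exact: opQ.
  exact: kin_le hy.
move=> /(kin_quot HQ) [b [u [bB uZ E]]].
have [||||s2 [y' [y'Z hy']]] := IH (s + t')%N (kphi s c') u.
- exact: kin_phi.
- by rewrite -kphi_kd; exact: kin_phi.
- exact: uZ.
- apply: (fop_inj_kin inj (k := k)).
    apply: kinB; last exact: kin_kd.
    by rewrite -kphi_fop; exact: kin_phi.
  have Eu : fop (opn k 1) u = kphi s y - kd (s + t') w - b by rewrite E addrAC subrr add0r.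
  rewrite fopnB -!kphi_fop -kd_fop Eu !kdB kd_kd subr0 opprB addrCA addrC.
  apply: kinD; last by apply: kin_kd.
  by rewrite -E1 -kphi_kd -kphiB; apply: kin_phi.
by exists (s2 + s)%N, y'; rewrite -addnA -kphi_kphi.
Qed.
End Koszul.

Section Transport.
Variables (V W : opmod) (R : nat).
Variables (B Z : gset V R) (B' Z' : gset W R) (g : nat -> V -> W).
Hypothesis gB : forall n x y, Z n x -> Z n y -> g n (x - y) = g n x - g n y.
Hypothesis gop : forall k n x, (k < R)%N -> Z n x -> g n.+1 (op k x) = op k (g n x).
Hypothesis gZ : forall n x, Z n x -> Z' n (g n x).
Hypothesis BZ : gsle B Z.
Hypothesis gBB : forall n x, B n x -> B' n (g n x).
Hypothesis ginj : forall n x, Z n x -> B' n (g n x) -> B n x.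
Hypothesis gsur : forall n y, Z' n y -> exists2 x, Z n x & B' n (y - g n x).

Let g0 n : g n 0 = 0.
Proof. by have := gB (gs0 Z n) (gs0 Z n); rewrite !subrr. Qed.

Lemma cmap_kin (C : gset V R) (C' : gset W R) t r i n (c : cochain V r) :
  (forall n x, C n x -> C' n (g n x)) ->
  kin C t i n c -> kin C' t i n (cmap t g n c).
Proof.
move=> CC; elim: r i n c => [|r IH] i n c /=.
  by case: i => [|[|i]]; [move=> ->; rewrite g0|exact: CC|move=> ->; rewrite g0].
move=> [h1 h2]; split; first exact: IH.
case: i h2 {h1} => [->|i h2]; last exact: IH.
by elim: (r) (n + t)%N => [|r' IHr] n' /=; [exact: g0|apply: pair_ext; exact: IHr].
Qed.

Lemma cmap0 t r n : cmap t g n (0 : cochain V r) = 0.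
Proof. by elim: r n => [|r IH] n /=; [exact: g0|apply: pair_ext; exact: IH]. Qed.

Lemma cmapB t r i j n (x y : cochain V r) : kin Z t i n x -> kin Z t j n y ->
  cmap t g n (x - y) = cmap t g n x - cmap t g n y.
Proof.
elim: r i j n x y => [|r IH] i j n x y /=.
  case: i => [|[|i]]; case: j => [|[|j]]; rewrite ?g0; try exact: gB;
    move=> h h'; rewrite ?h ?h' ?subr0 ?sub0r ?g0 ?subr0 //; rewrite -sub0r gB //; rewrite ?g0 ?sub0r //; exact: gs0.
move=> [h1 h2] [k1 k2]; apply: pair_ext; first exact: IH h1 k1.
case: i h2 {h1} => [|i] /= h2; case: j k2 {k1} => [|j] /= k2.
- by apply: (IH 0%N 0%N); rewrite ?h2 ?k2; exact: kin0.
- by apply: (IH 0%N j) => //; rewrite h2; exact: kin0.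
- by apply: (IH _ 0%N) => //; [exact: h2|rewrite k2; exact: kin0].
- exact: IH h2 k2.
Qed.

Lemma cmap_op t k s r i n (c : cochain V r) : (k < R)%N -> kin Z t i n c ->
  cmap t g (n + s) (fop (opn k s) c) = fop (opn k s) (cmap t g n c).
Proof.
move=> kR; elim: r i n c => [|r IH] i n c /=.
  move=> h; have {h} Zc : Z n c by case: i h => [|[|i]] //= ->; exact: gs0.
  elim: s => [|s IHs]; first by rewrite addn0.
  by rewrite addnS gop ?IHs //; exact: gsopn.
move=> [h1 h2]; apply: pair_ext => /=; first exact: IH h1.
rewrite addnAC; case: i h2 {h1} => [->|i h2]; last exact: IH h2.
by rewrite fopn0 !cmap0 fopn0.
Qed.

Lemma cmap_kd t r i n (c : cochain V r) : (r <= R)%N -> kin Z t i n c ->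
  cmap t g n (kd t c) = kd t (cmap t g n c).
Proof.
elim: r i n c => [|r IH] i n c rR /=; first by rewrite g0.
move=> [h1 h2]; apply: pair_ext => /=; first by apply: IH h1; exact: ltnW.
have rR' := ltnW rR.
have [j h2'] : exists j, kin Z t j (n + t) c.2.
  by case: i h2 {h1} => [->|i h2]; [exists 0%N; exact: kin0|exists i].
rewrite (@cmapB _ _ i j.+1) ?(cmap_op _ rR h1) ?(IH _ _ _ rR' h2') //.
  exact: kin_fop.
exact: kin_kd.
Qed.

Lemma cmap_phi s t r i n (c : cochain V r) : (r <= R)%N -> kin Z t i n c ->
  cmap (s + t) g n (kphi s c) = kphi s (cmap t g n c).
Proof.
elim: r i n c => [|r IH] i n c rR //= [h1 h2].
have rR' := ltnW rR.
apply: pair_ext => /=; first exact: IH h1.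
have [j h2'] : exists j, kin Z t j (n + t) c.2.
  by case: i h2 {h1} => [->|i h2]; [exists 0%N; exact: kin0|exists i].
have -> : (n + (s + t) = n + t + s)%N by lia.
by rewrite (cmap_op _ rR (kin_phi _ rR' h2')) (IH _ _ _ rR' h2').
Qed.

Lemma cmap_inj t r i n (c : cochain V r) : kin Z t i n c -> kin B' t i n (cmap t g n c) ->
  kin B t i n c.
Proof.
elim: r i n c => [|r IH] i n c /=; first by case: i => [|[|i]] //; exact: ginj.
move=> [h1 h2] [k1 k2]; split; first exact: IH.
by case: i h2 k2 {h1 k1} => // i; exact: IH.
Qed.

Lemma cmap_sur t r i n (c : cochain W r) : kin Z' t i n c ->
  exists2 b, kin Z t i n b & kin B' t i n (c - cmap t g n b).
Proof.
elim: r i n c => [|r IH] i n c /=.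
  case: i => [|[|i]]; [move=> ->; exists 0; rewrite ?g0 ?subr0 //|exact: gsur|move=> ->].
  by exists 0; rewrite ?g0 ?subr0.
move=> [/IH [b1 h1 k1]]; case: i h1 k1 => [|i] h1 k1 h2.
  exists (b1, 0); split => //=; first by rewrite h2 cmap0 subr0.
have [b2 h3 k3] := IH _ _ _ h2.
by exists (b1, b2).
Qed.

(** The assumptions make [g] an isomorphism from [Z / B] to [Z' / B']. It is additive on [Z] only
    and depends on the degree, as [taug] requires. *)
Lemma van_transport r i n : (r <= R)%N -> van Z B r i n -> van Z' B' r i n.
Proof.
move=> rR H t c' cZ' dc'; have [c cZ bc] := cmap_sur cZ'.
have dc : kin B t i.+2 n (kd t c).
  apply: cmap_inj; first exact: kin_kd.
  rewrite (cmap_kd rR cZ).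
  have -> : kd t (cmap t g n c) = kd t c' - kd t (c' - cmap t g n c) by rewrite kdB opprB addrC subrK.
  by apply: kinB => //; exact: kin_kd.
have [s [y [yZ hy]]] := H t c cZ dc.
exists s, (cmap (s + t) g n y); split; first exact: (cmap_kin gZ yZ).
have -> : kphi s c' - kd (s + t) (cmap (s + t) g n y) =
   kphi s (c' - cmap t g n c) + cmap (s + t) g n (kphi s c - kd (s + t) y).
  rewrite (@cmapB _ _ i.+1 i.+1); [|exact: kin_phi|exact: kin_kd].
  by rewrite (cmap_kd rR yZ) kphiB (cmap_phi s rR cZ) addrA subrK.
by apply: kinD; [exact: kin_phi|exact: (cmap_kin gBB hy)].
Qed.
End Transport.

Section DegreeZero.
Variables (V : opmod) (R : nat).
Implicit Types Z B C : gset V R.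

Fixpoint kiota r (x : V) : cochain V r :=
  match r with 0 => x | r'.+1 => (kiota r' x, 0) end.

Lemma kiotaB r x y : kiota r (x - y) = kiota r x - kiota r y.
Proof.
by elim: r => [|r IH] //=; apply: pair_ext => /=; rewrite ?subrr.
Qed.

Lemma kiota_fop k s r x : fop (opn k s) (kiota r x) = kiota r (opn k s x).
Proof. by elim: r => [|r IH] //=; apply: pair_ext => /=; rewrite ?fopn0. Qed.

Lemma kiota_phi s r x : kphi s (kiota r x) = kiota r x.
Proof. by elim: r => [|r IH] //=; apply: pair_ext => /=; rewrite ?kphi0 ?fopn0. Qed.

Lemma kin_kiota Z t r n x : Z n x -> kin Z t 1 n (kiota r x).
Proof. by move=> Zx; elim: r => [|r IH] //=; split => //; exact: kin0. Qed.

Lemma kin1P Z t r n (c : cochain V r) : kin Z t 1 n c -> exists2 x, Z n x & c = kiota r x.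
Proof.
elim: r n c => [|r IH] n c /=; first by exists c.
move=> [/IH [x Zx E]] /kin_i0 E2; exists x => //; exact: pair_ext.
Qed.

Lemma kin_kiota_inj B t r n x : kin B t 1 n (kiota r x) -> B n x.
Proof. by elim: r => [|r IH] //= [/IH]. Qed.

Lemma kd_kiota B t r n x : kin B t 2 n (kd t (kiota r x)) <->
  forall k, (k < r)%N -> B (n + t)%N (opn k t x).
Proof.
elim: r => [|r IH] /=; first by split.
rewrite kd0 subr0 kiota_fop; split.
  move=> [/IH h1 /kin_kiota_inj h2] k; rewrite ltnS leq_eqVlt => /orP [/eqP -> //|]; exact: h1.
move=> h; split; first by apply/IH => k kr; apply: h; exact: ltnW.
by apply: kin_kiota; exact: h.
Qed.

Lemma van0 B Z r n : van Z B r 0 n <->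
  forall x t, Z n x -> (forall k, (k < r)%N -> B (n + t)%N (opn k t x)) -> B n x.
Proof.
split.
  move=> H x t Zx /kd_kiota hx; have [s [y [/kin_i0 -> ]]] := H t _ (kin_kiota t r Zx) hx.
  by rewrite kd0 subr0 kiota_phi => /kin_kiota_inj.
move=> H t c /kin1P [x Zx ->] /kd_kiota hx; exists 0%N, 0; split; first exact: kin0.
by rewrite kd0 subr0 kiota_phi; apply: kin_kiota; exact: H hx.
Qed.

(** As [H^1] of [C / B] vanishes, torsion elements of [Z / C] lift to torsion elements of
    [Z / B]. *)
Lemma torsion_lift B C Z r n x t : (r <= R)%N -> van C B r 1 n -> Z n x ->
  (forall k, (k < r)%N -> C (n + t)%N (opn k t x)) ->
  exists s u, C n u /\ forall k, (k < r)%N -> B (n + s)%N (opn k s (x - u)).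
Proof.
move=> rR H Zx /kd_kiota hx; have [|s [y [/kin1P [u Cu ->]]]] := H t _ hx.
  by rewrite kd_kd; exact: kin0.
rewrite kphi_kd kiota_phi -kdB -kiotaB => /kd_kiota h.
by exists (s + t)%N, u.
Qed.

(** The divisibility hypothesis says that the part of [Z / B] that is torsion for the first [k]
    variables maps onto its localization at [X_k]. In the mapping cone over the last variable this
    kills the only new cohomology, in degree 1; the rest vanishes by induction. *)
Lemma van_acyclic B Z : gsle B Z ->
  (forall k t n x, (k < R)%N -> Z (n + t)%N x ->
     (forall j, (j < k)%N -> B (n + t + t)%N (opn j t x)) ->
     exists s z, [/\ Z n z, B (n + t + s)%N (opn k (s + t) z - opn k s x)
        & forall j, (j < k)%N -> B (n + t)%N (opn j t z)]) ->
  forall r i n, (r <= R)%N -> van Z B r i.+1 n.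
Proof.
move=> BZ inj; elim=> [|r IH] i n rR; first exact: van_big.
have rR' := ltnW rR.
move=> t [c1 c2] /= [cZ1 cZ2] [dc1 dc2].
have [s [y [yZ hy]]] := IH i n rR' t c1 cZ1 dc1.
pose T := (s + t)%N.
(* Once [y] bounds [c1], this is what remains to be bounded in the cone, one cohomological degree
   lower; for [i = 0] it is a single element [x]. *)
pose c3 := fop (opn r s) (kphi s c2) - fop (opn r T) y.
have ET : (n + T = n + t + s)%N by rewrite /T; lia.
have c3Z : kin Z T i.+1 (n + T) c3.
  apply: kinB; last exact: kin_fop.
  rewrite ET; apply: kin_fop => //; exact: kin_phi.
have dc3 : kin B T i.+2 (n + T) (kd T c3).
  have -> : kd T c3 = fop (opn r T) (kphi s c1 - kd T y) -
      fop (opn r s) (kphi s (fop (opn r t) c1 - kd t c2)).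
    rewrite /c3 kdB !kd_fop kphiB !fopnB kphi_fop -fopnDn -/T kphi_kd -/T.
    by rewrite subrACA subrr sub0r opprB.
  apply: kinB; first exact: kin_fop.
  rewrite ET; apply: kin_fop => //; exact: kin_phi.
case: i cZ1 cZ2 dc1 dc2 yZ hy c3Z dc3 => [|i] cZ1 cZ2 dc1 dc2 yZ hy c3Z dc3.
  have [x Zx c3E] := kin1P c3Z.
  have hx : forall k, (k < r)%N -> B (n + T + T)%N (opn k T x).
    by apply/kd_kiota; rewrite -c3E.
  have [s' [z [Zz hz1 hz2]]] := inj r T n x rR Zx hx.
  exists (s' + s)%N, (kphi s' y + kiota r z, 0); rewrite -addnA -/T; split.
    split => /=; last exact: kin0.
    apply: kinD; [exact: kin_phi|exact: kin_kiota].
  split=> /=.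
    have -> : kphi (s' + s) c1 - kd (s' + T) (kphi s' y + kiota r z) =
        kphi s' (kphi s c1 - kd T y) - kd (s' + T) (kiota r z).
      by rewrite kphiB kphi_kphi kdD kphi_kd opprD addrA.
    apply: kinB; first exact: kin_phi.
    apply/kd_kiota => k kr; rewrite opnD addnCA addnC; apply: gsopn (hz2 _ kr).
    exact: ltn_trans rR.
  rewrite kd0 subr0.
  have -> : fop (opn r (s' + s)) (kphi (s' + s) c2) -
      fop (opn r (s' + T)) (kphi s' y + kiota r z) =
      kiota r (opn r s' x - opn r (s' + T) z).
    have kx : kiota r x = kphi s' c3 by rewrite c3E kiota_phi.
    rewrite kiotaB -!kiota_fop kx /c3.
    by rewrite kphiB !kphi_fop fopnB fopnD -!fopnDn kphi_kphi opprD addrA.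
  apply: kin_kiota; rewrite -opprB; apply: gsN.
  by have -> : (n + (s' + T) = n + T + s')%N by lia.
have [s' [w [wZ hw]]] := IH i (n + T)%N rR' T c3 c3Z dc3.
exists (s' + s)%N, (kphi s' y, - fop (opn r s') w); rewrite -addnA -/T; split.
  split => /=; first exact: kin_phi.
  apply: kinN; have -> : (n + (s' + T) = n + T + s')%N by lia.
  exact: kin_fop.
split => /=.
  by rewrite -kphi_kphi -kphi_kd -kphiB; exact: kin_phi.
rewrite kdN opprK kd_fop.
have -> : fop (opn r (s' + s)) (kphi (s' + s) c2) - (fop (opn r (s' + T)) (kphi s' y) +
    fop (opn r s') (kd (s' + T) w)) = fop (opn r s') (kphi s' c3 - kd (s' + T) w).
  by rewrite fopnB /c3 kphiB !kphi_fop fopnB -!fopnDn kphi_kphi opprD addrA.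
have -> : (n + (s' + T) = n + T + s')%N by lia.
exact: kin_fop.
Qed.
End DegreeZero.

(** * Vanishing and lengths for families of submodules *)

Section MulOps.
Variables (A : comNzRingType) (V : lmodType A) (a : nat -> A).

Program Definition mulops : opmod := @Opmod V (fun k x => a k *: x) _ _.
Next Obligation. by move=> k x y /=; rewrite scalerBr. Qed.
Next Obligation. by move=> j k x /=; rewrite !scalerA mulrC. Qed.

Program Definition gsof r (N : gfam V a r) : gset mulops r := @Gset mulops r (fun n x => N n x) _ _ _.
Next Obligation. by move=> r N n; exact: smod0. Qed.
Next Obligation. by move=> r N n x y /=; exact: smodB. Qed.
Next Obligation. by move=> r N k n x kr /=; exact: gfP. Qed.

Variable r : nat.
Implicit Types B Z T : gfam V a r.

Definition lvan Z B i n := van (gsof Z) (gsof B) r i n.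

Definition finlen B Z := forall n, exists l, lenle (B n) (Z n) l.

Lemma finlen_sub B Z B' Z' : gle B Z -> gle B B' -> gle Z' Z -> finlen B Z -> finlen B' Z'.
Proof.
move=> BZ BB ZZ h n; have [l hl] := h n; exists l.
exact: lenle_mono (BB n) (ZZ n) (BZ n) hl.
Qed.

(** When the variables act as zero, replacing [Z] by [B] from degree [j] on still gives a graded
    family; the ascending chain of these truncations is stationary. *)
Lemma zero_ops_bounded B Z : gle B Z -> noethg B Z ->
  (forall k, (k < r)%N -> zeroop k B Z) -> exists n0, forall n, (n0 <= n)%N -> Z n <=s B n.
Proof.
move=> BZ noeth zop.
pose N j n := if (n < j)%N then Z n else B n.
have NB j n : B n <=s N j n by rewrite /N; case: ifP => _ //; exact: BZ.
have NZ j n : N j n <=s Z n by rewrite /N; case: ifP => _ //; exact: BZ.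
have NP j k n x : (k < r)%N -> N j n x -> N j n.+1 (a k *: x).
  by move=> kr /NZ Zx; apply: NB; exact: zop.
have [j n x|j n x|j n x|j0 Hj] := noeth (fun j => Gfam (NP j)).
- exact: NB.
- exact: NZ.
- move=> /= ; rewrite /N; case: ifP => [nj|_ Bx]; first by rewrite (leq_trans nj).
  by case: ifP => // _; exact: BZ.
exists j0 => n jn x Zx; have := Hj n.+1 n x; rewrite /= /N ltnSn ltnNge jn /=; exact.
Qed.

Lemma injop_opn B Z k : (k < r)%N -> gle B Z -> injop k B Z ->
  forall t n x, Z n x -> B (n + t)%N (opn (V := mulops) k t x) -> B n x.
Proof.
move=> kr BZ inj; elim=> [|t IH] n x Zx; first by rewrite addn0.
rewrite addnS => /inj H; apply: IH => //; apply: H.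
exact: (@gsopn mulops r (gsof Z)).
Qed.

Lemma lvan_inj B Z k i n : (k < r)%N -> gle B Z -> injop k B Z ->
  (forall n', (n <= n')%N -> lvan Z (quog k B Z) i n'.+1) -> lvan Z B i.+1 n.
Proof.
move=> kr BZ inj H; apply: (@van_inj mulops r _ _ (gsof (quog k B Z)) k) => //.
- exact: quog_ge.
- by move=> n' x Zx; apply: addSr; exists x.
- by move=> n' x [b [_ [Bb [z Zz ->] ->]]]; exists b, z.
Qed.

Lemma lvan_ext B Z T i n : gle B Z -> gle Z T -> lvan Z B i n -> lvan T Z i n -> lvan T B i n.
Proof. by move=> BZ ZT; exact: (@van_ext mulops r). Qed.

Lemma lvan_quot B Z T i n : gle B Z -> gle Z T -> lvan T B i n -> lvan Z B i.+1 n -> lvan T Z i n.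
Proof. by move=> BZ ZT; exact: (@van_quot mulops r). Qed.

(** In the injective step [H^0] vanishes and [H^(i+1)] in degree [n] depends only on [H^i] of the
    cokernel in degrees above [n], so the same [eta] works for all [i]. *)
Lemma lvan_eventually B Z : gle B Z -> noethg B Z ->
  exists eta, forall n, (eta <= n)%N -> forall i, lvan Z B i n.
Proof.
move: B Z; apply: devissage.
- move=> B Z T BZ ZT [e1 h1] [e2 h2]; exists (maxn e1 e2) => n.
  by rewrite geq_max => /andP [n1 n2] i; apply: lvan_ext; [exact: BZ|exact: ZT|exact: h1|exact: h2].
- move=> B Z BZ noeth zop; have [n0 h] := zero_ops_bounded BZ noeth zop.
  by exists n0 => n nn i; apply: van_triv => n' x nn'; apply: h; exact: leq_trans nn'.
- move=> B Z k kr BZ noeth inj [e h]; exists e => n en [|i].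
    apply/van0 => x t Zx hx; apply: (injop_opn kr BZ inj (t := t)) => //; exact: hx.
  by apply: (lvan_inj kr) => // n' nn'; apply: h; rewrite (leq_trans en) // ltnW.
Qed.

(** When [X_k] is injective, the lengths of its cokernel are the first differences of [h], and [h]
    is recovered by summation. *)
Lemma hilbert_poly B Z : gle B Z -> noethg B Z -> finlen B Z ->
  exists2 h, (forall n, haslen (B n) (Z n) (h n)) & ev_poly h.
Proof.
move: B Z; apply: devissage.
- move=> B Z T BZ ZT h1 h2 fin.
  have [u hu pu] := h1 (finlen_sub (gle_trans BZ ZT) (@gle_refl _ _ _ _ B) ZT fin).
  have [v hv pv] := h2 (finlen_sub (gle_trans BZ ZT) BZ (@gle_refl _ _ _ _ T) fin).
  exists (fun n => (u n + v n)%N); last exact: ev_polyD.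
  by move=> n; exact: haslen_add.
- move=> B Z BZ noeth zop fin; have [n0 h0] := zero_ops_bounded BZ noeth zop.
  have /choice [h hh] n : exists l, haslen (B n) (Z n) l.
    by have [l hl] := fin n; exact: haslen_ex hl.
  exists h => //; exists 0, n0 => n nn; rewrite horner0.
  by have := haslen_le (hh n) (lenle0 (h0 n nn)); rewrite leqn0 => /eqP ->.
- move=> B Z k kr BZ noeth inj HQ fin.
  have [|hQ hQl pQ] := HQ.
    exact: finlen_sub BZ (@quog_ge _ _ _ _ _ _ _) (@gle_refl _ _ _ _ Z) fin.
  have /choice [h hh] n : exists l, haslen (B n) (Z n) l.
    by have [l hl] := fin n; exact: haslen_ex hl.
  exists h => //; apply: (ev_poly_diff (u := fun n => hQ n.+1) (v := fun=> 0%N)).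
  + exact: ev_poly_shift.
  + by exists 0, 0%N => n _; rewrite horner0.
  move=> n; rewrite addn0; apply: (haslen_uniq (hh n.+1)).
  apply: haslen_add (hQl n.+1).
  have [f fE] := @ex_mulmap A V (a k).
  apply: (haslen_iso (f := f)) (hh n) => //.
  + by move=> x; exact: addSl.
  + by move=> x Zx; apply: addSr; exists x => //.
  + by move=> x Zx; rewrite fE; split; [apply: gfP|exact: inj].
  + by move=> y [b [_ [Bb [z Zz ->] ->]]]; exists z => //; rewrite fE addrK.
Qed.

Lemma quog_haslen B Z k h hQ n : (k < r)%N -> gle B Z -> injop k B Z ->
  haslen (B n) (Z n) (h n) -> haslen (quog k B Z n.+1) (Z n.+1) (hQ n.+1) ->
  haslen (B n.+1) (Z n.+1) (h n.+1) -> h n.+1 = (h n + hQ n.+1)%N.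
Proof.
move=> kr BZ inj hn hQn hSn; apply: (haslen_uniq hSn).
apply: haslen_add hQn; have [f fE] := @ex_mulmap A V (a k).
apply: (haslen_iso (f := f)) hn => //.
+ by move=> x; exact: addSl.
+ by move=> x Zx; apply: addSr; exists x => //.
+ by move=> x Zx; rewrite fE; split; [apply: gfP|exact: inj].
+ by move=> y [b [_ [Bb [z Zz ->] ->]]]; exists z => //; rewrite fE addrK.
Qed.

Definition growth B Z k := exists (q : {poly rat}) (n0 : nat), (size q <= k)%N /\
  forall n, (n0 <= n)%N -> exists2 l, lenle (B n) (Z n) l & l%:R <= q.[n%:R].

Lemma growth_sub B Z B' Z' k : gle B Z -> gle B B' -> gle Z' Z -> growth B Z k -> growth B' Z' k.
Proof.
move=> BZ BB ZZ [q [n0 [sq h]]]; exists q, n0; split => // n /h [l hl lq].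
by exists l => //; exact: lenle_mono (BB n) (ZZ n) (BZ n) hl.
Qed.

(* Vanishing above the dimension, by devissage: when some X_j acts injectively,
   the lengths of the quotient by X_j grow with one degree less. *)
Lemma lvan_growth B Z k i n : gle B Z -> noethg B Z -> finlen B Z -> growth B Z k ->
  (k < i)%N -> lvan Z B i n.
Proof.
move=> BZ noeth.
move: B Z BZ noeth k i n; apply: devissage.
- move=> B Z T BZ ZT h1 h2 k i n fin gr ki.
  have BT := gle_trans BZ ZT.
  apply: lvan_ext; [exact: BZ|exact: ZT|apply: (h1 k) => //|apply: (h2 k) => //].
  + exact: finlen_sub BT (@gle_refl _ _ _ _ B) ZT fin.
  + exact: growth_sub BT (@gle_refl _ _ _ _ B) ZT gr.
  + exact: finlen_sub BT BZ (@gle_refl _ _ _ _ T) fin.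
  + exact: growth_sub BT BZ (@gle_refl _ _ _ _ T) gr.
- move=> B Z BZ noeth zop k [|i] n fin gr ki //.
  by apply: van_zero => // l n' x lr Zx; exact: zop.
- move=> B Z j jr BZ noeth inj HQ k [|i] n fin [q [n0 [sq hq]]] // ki.
  have [h hh [p [n1 hp]]] := hilbert_poly BZ noeth fin.
  have sp : (size p <= k)%N.
    apply: leq_trans sq; apply: (@size_le_of_bound h p q (maxn n0 n1)) => m.
      by rewrite geq_max => /andP [_]; exact: hp.
    rewrite geq_max => /andP [/hq [l hl lq] _]; apply: le_trans lq.
    by rewrite ler_nat; exact: haslen_le (hh m) hl.
  (* If the lengths vanish from [n1] on, injectivity of [X_j] makes [Z / B] zero in every degree.
     Otherwise the difference polynomial has smaller size, so the cokernel satisfies the bound for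
     [k - 1]. *)
  case: (eqVneq p 0) => [p0|p0].
    apply: van_triv => n' x _ Zx.
    apply: (injop_opn jr BZ inj (t := n1)) => //.
    have Z0 : Z (n' + n1)%N <=s B (n' + n1)%N.
      have := hh (n' + n1)%N; have := hp (n' + n1)%N (leq_addl _ _).
      rewrite p0 horner0 => /esym/eqP; rewrite pnatr_eq0 => /eqP -> [_].
      by apply: lenle0P; exact: BZ.
    by apply: Z0; exact: (@gsopn mulops r (gsof Z)).
  have Qfin : finlen (quog j B Z) Z.
    exact: finlen_sub BZ (@quog_ge _ _ _ _ _ _ _) (@gle_refl _ _ _ _ Z) fin.
  have [p' sp' p'E] := poly_diff_size p0.
  apply: (lvan_inj jr) => // n' _; apply: (HQ k.-1) => //; last first.
    by case: (k) sp ki => [|k'] //; rewrite leqn0 size_poly_eq0 (negPf p0).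
  have [hQ hhQ _] := hilbert_poly (@quog_le _ _ _ _ _ _ _ jr BZ)
      (noethg_sub noeth (@quog_ge _ _ _ _ _ _ _) (@gle_refl _ _ _ _ Z)) Qfin.
  exists p', n1.+1; split.
    by rewrite -ltnS; apply: leq_trans sp' _; apply: leq_trans sp (leqSpred _).
  move=> [|m] // n1m; exists (hQ m.+1); first by case: (hhQ m.+1).
  rewrite p'E hp ?hp //; last exact: ltnW.
  by rewrite (quog_haslen jr BZ inj (hh m) (hhQ m.+1) (hh m.+1)) natrD [X in X - _]addrC addrK.
Qed.
End MulOps.

Section MapFamilies.
Variables (A : comNzRingType) (V W : lmodType A) (a : nat -> A) (r : nat).
Variables (f : {linear V -> W}) (B Z : gfam V a r) (B' Z' : gfam W a r).

Lemma lvan_map i n : gle B Z ->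
  (forall n x, Z n x -> Z' n (f x)) -> (forall n x, B n x -> B' n (f x)) ->
  (forall n x, Z n x -> B' n (f x) -> B n x) ->
  (forall n y, Z' n y -> exists2 x, Z n x & B' n (y - f x)) ->
  lvan Z B i n -> lvan Z' B' i n.
Proof.
move=> BZ fZ fB fi fs.
apply: (@van_transport (mulops V a) (mulops W a) r _ _ (gsof B') (gsof Z') (fun=> f)) => //.
- by move=> n' x y _ _; rewrite linearB.
- by move=> k n' x _ _ /=; rewrite linearZ.
Qed.
End MapFamilies.

(** * Adic filtrations and syzygies *)

Section Adic.
Variables (A : comNzRingType) (m I : ideal A).
Hypotheses (A_noeth : noetherian A) (A_local : local_ring m) (I_primary : primary_to m I).
Variables (a : nat -> A) (r : nat).
Hypothesis aI : forall k, (k < r)%N -> I (a k).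
Hypothesis Ia : forall N : ideal A, (forall k, (k < r)%N -> N (a k)) -> I <=s N.

Section OneModule.
Variable V : lmodType A.
Implicit Types K : submodule V.

Lemma mul_full K : mul_smod (full_smod A^o) K = K.
Proof.
apply: smod_ext; first exact: mul_smod_le.
by move=> x Kx; rewrite -[x]scale1r; apply: mul_smodP.
Qed.

Lemma adic0 K : mul_smod (ideal_pow I 0) K = K.
Proof. exact: mul_full. Qed.

Lemma adic_step K n (c : A) x : I c -> mul_smod (ideal_pow I n) K x ->
  mul_smod (ideal_pow I n.+1) K (c *: x).
Proof.
move=> Ic; suff H : mul_smod (ideal_pow I n) K <=s colon_smod c (mul_smod (ideal_pow I n.+1) K) by exact: H.
apply: mul_smod_ind.
move=> b y Ib Ky; change (mul_smod (ideal_pow I n.+1) K (c *: (b *: y))); rewrite scalerA; apply: mul_smodP => //.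
exact: (mul_smodP (M := A^o) Ic Ib).
Qed.

Lemma adicP K l n x : (l < r)%N -> mul_smod (ideal_pow I n) K x ->
  mul_smod (ideal_pow I n.+1) K (a l *: x).
Proof. by move=> lr; apply: adic_step; exact: aI. Qed.

Definition adic K : gfam V a r := Gfam (adicP (K := K)).

Lemma adic_antimono K i j : (i <= j)%N ->
  mul_smod (ideal_pow I j) K <=s mul_smod (ideal_pow I i) K.
Proof. by move=> ij; apply: mul_smod_mono => //; exact: ideal_pow_le. Qed.

(** [adic K] modulo [gshift (adic K)] is the associated graded module of [K]. *)
Definition gshift (N : gfam V a r) : gfam V a r :=
  @Gfam _ V a r (fun n => N n.+1) (fun k n x kr => gfP (g := N) kr).

Lemma gcapP (N N' : gfam V a r) l n x : (l < r)%N -> capS (N n) (N' n) x ->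
  capS (N n.+1) (N' n.+1) (a l *: x).
Proof. by move=> lr [h h']; split; exact: gfP. Qed.
Definition gcap (N N' : gfam V a r) : gfam V a r := Gfam (@gcapP N N').

Lemma gaddP (N N' : gfam V a r) l n x : (l < r)%N -> addS (N n) (N' n) x ->
  addS (N n.+1) (N' n.+1) (a l *: x).
Proof.
move=> lr [y [z [h h' ->]]]; rewrite scalerDr; apply: smodD.
  by apply: addSl; exact: gfP.
by apply: addSr; exact: gfP.
Qed.
Definition gadd (N N' : gfam V a r) : gfam V a r := Gfam (@gaddP N N').

Definition gconst K : gfam V a r := @Gfam _ V a r (fun=> K) (fun k n x _ => @smodZ _ _ K _ _).

Hypothesis V_fg : fin_gen (full_smod V).

(** The associated graded module is generated in degree 0 over the polynomial ring, because the
    elements [a k] generate [I]. *)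
Lemma adic_noeth K : noethg (gshift (adic K)) (adic K).
Proof.
apply: noethg_sub (hilbert_basis A_noeth V_fg (K0 := K) (B := gshift (adic K))) (@gle_refl _ _ _ _ _) _.
have K0 r' : K <=s polyfam a K (gshift (adic K)) r' 0.
  by elim: r' => [|r' IH] // x; exact: addSl.
elim=> [|n IH] x; first by move=> h; apply: (K0 r x); rewrite -(adic0 K).
pose P := polyfam a K (gshift (adic K)).
change (mul_smod (ideal_pow I n.+1) K x -> P r n.+1 x).
apply: mul_smod_ind x => c x Ic Kx.
suff H : smod_le (ideal_pow I n.+1) (colon_ideal K (P r n.+1)) by exact: H Ic _ Kx.
apply: mul_smod_ind => {}c b {}Ic Ib y Ky.
change (P r n.+1 ((c * b) *: y)); rewrite -scalerA.
have Py : P r n (b *: y) by apply: IH; exact: mul_smodP.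
have : I <=s colon_ideal (P r n) (P r n.+1).
  apply: Ia => k kr z Pz; apply: polyfam_op => // k' n' x' kr'.
  exact: gfP.
by move=> /(_ _ Ic _ Py).
Qed.

(** Send [N] to [B + N]; by the modular law [N] is recovered by intersecting with [C]. This makes
    the graded module of an induced filtration Noetherian, in the role of the Artin-Rees lemma. *)
Lemma noethg_cap (B Z C : gfam V a r) : gle B Z -> noethg B Z -> noethg (gcap B C) (gcap Z C).
Proof.
move=> BZ h N NB NZ NS.
have [j n x|j n|j n|j0 Hj] := h (fun j => gadd B (N j)).
- exact: addSl.
- apply: addS_le; first exact: BZ.
  by move=> x /NZ [].
- by apply: addS_mono => //; exact: NS.
exists j0 => j n x Nx.
have [|y [z [By Nz xE]]] := Hj j n x; first exact: addSr.
rewrite xE; apply: smodD => //; apply: NB; split => //.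
have -> : y = x - z by rewrite xE addrK.
by apply: smodB; [case: (NZ _ _ _ Nx)|case: (NZ _ _ _ Nz)].
Qed.

Lemma finlen_I (B Z : gfam V a r) : gle B Z ->
  (forall n (c : A) x, I c -> Z n x -> B n (c *: x)) -> finlen B Z.
Proof.
move=> BZ h n; apply: (fin_length A_noeth A_local I_primary) => //.
- exact: fin_gen_full_sub.
- by move=> c x; exact: h.
Qed.
End OneModule.

Section Syzygy.
Variables (F : lmodType A) (K : submodule F).
Hypothesis F_fg : fin_gen (full_smod F).
Let full : submodule F := full_smod F.
Let FF := adic full.
Let J := adic K.
Let Kn := gcap FF (gconst K).
Let SJ := gshift J.
Let SK := gshift Kn.

Let JK : gle J Kn.
Proof. by move=> n x Jx; split; [apply: mul_smod_mono Jx|exact: mul_smod_le Jx]. Qed.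
Let SJJ : gle SJ J. Proof. by move=> n; apply: adic_antimono. Qed.
Let SKK : gle SK Kn.
Proof. by move=> n x [h1 h2]; split => //; apply: adic_antimono h1. Qed.
Let SJSK : gle SJ SK. Proof. by move=> n; exact: JK. Qed.

(* (K :&: I^n F) / I^n K is Tor_1 (F / K, A / I^n) when F is free. *)
Definition tor_growth k := growth J Kn k.

(** With [W_n] for [Kn n / J n], the quotients [P/SJ] and [Kn/X] are the kernel and cokernel of
    [J/SJ -> Kn/SK], and also of [W_(n+1) -> W_n]. *)
Let P := gcap J SK.
Let X := gadd J SK.
Let SJP : gle SJ P. Proof. by move=> n x h; split; [exact: SJJ|exact: SJSK]. Qed.
Let PJ : gle P J. Proof. by move=> n x []. Qed.
Let XK : gle X Kn. Proof. by move=> n; apply: addS_le; [exact: JK|exact: SKK]. Qed.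
Let JX : gle J X. Proof. by move=> n x; exact: addSl. Qed.
Let SKX : gle SK X. Proof. by move=> n x; exact: addSr. Qed.
Let PSK : gle P SK. Proof. by move=> n x []. Qed.

Let noethJ : noethg SJ J. Proof. exact: adic_noeth. Qed.
Let noethK : noethg SK Kn.
Proof.
have SFF : gle (gshift FF) FF by move=> n; apply: adic_antimono.
have h := noethg_cap (C := gconst K) SFF (adic_noeth (K := full) F_fg).
by apply: (noethg_sub h) => n x. Qed.
Let finJ : finlen SJ J.
Proof. by apply: finlen_I => // n c x; exact: adic_step. Qed.
Let finK : finlen SK Kn.
Proof.
apply: finlen_I => // n c x Ic [h1 h2]; split; first exact: adic_step.
exact: (@smodZ _ _ K).
Qed.
Let noethP : noethg SJ P. Proof. exact: noethg_sub noethJ (@gle_refl _ _ _ _ SJ) PJ. Qed.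
Let noethQ : noethg X Kn. Proof. exact: noethg_sub noethK SKX (@gle_refl _ _ _ _ Kn). Qed.
Let finP : finlen SJ P. Proof. exact: finlen_sub SJJ (@gle_refl _ _ _ _ SJ) PJ finJ. Qed.
Let finQ : finlen X Kn. Proof. exact: finlen_sub SKK SKX (@gle_refl _ _ _ _ Kn) finK. Qed.

(** The exact sequence [0 -> P/SJ -> W_(n+1) -> W_n -> Kn/X -> 0] gives finite length by induction
    from [W_0 = 0], and shows that the differences of the lengths come from two Hilbert
    polynomials. *)
Lemma tor_hilbert : exists2 w, (forall n, haslen (J n) (Kn n) (w n)) & ev_poly w.
Proof.
have [p hp pp] := hilbert_poly SJP noethP finP.
have [q hq pq] := hilbert_poly XK noethQ finQ.
have [f fE] := @mk_linear A F F idfun (fun a x y => erefl).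
have step n x : haslen (J n) (X n) x -> haslen (SJ n) (SK n) (p n + x)%N.
  move=> hx; apply: haslen_add (hp n) _.
  have [u hu] : exists u, haslen (P n) (SK n) u.
    apply: haslen_ex; first exact: PSK.
    apply: (@lenle_inj _ _ _ f (P n) (SK n) (J n) (X n)) hx.2; last exact: JX.
      by move=> y Ky; rewrite fE; exact: SKX.
    by move=> y Ky; rewrite fE => Jy; split.
  suff <- : u = x by [].
  apply: haslen_uniq hx; apply: (haslen_iso (f := f)) hu.
  - exact: PSK.
  - exact: JX.
  - by move=> y Ky; rewrite fE; exact: SKX.
  - by move=> y Ky; rewrite fE; split=> [[]//|Jy]; split.
  - move=> _ [y [z [Jy Kz ->]]]; exists z; rewrite ?fE ?addrK //.
have /choice [w hw] n : exists w, haslen (J n) (Kn n) w.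
  elim: n => [|n [w hw]].
    exists 0%N; rewrite [Kn 0](_ : _ = J 0); first exact: haslen0.
    apply: smod_ext; last exact: JK.
    by move=> x [_ Kx]; change (mul_smod (ideal_pow I 0) K x); rewrite adic0.
  have [x hx] : exists x, haslen (J n) (X n) x.
    apply: haslen_ex; first exact: JX.
    exact: lenle_mono (@smod_refl _ _ (J n)) (@XK n) (@JK n) hw.2.
  by exists (p n + x)%N; exact: step.
exists w => //; apply: (ev_poly_diff pp pq) => n.
have [x hx] : exists x, haslen (J n) (X n) x.
  apply: haslen_ex; first exact: JX.
  exact: lenle_mono (@smod_refl _ _ (J n)) (@XK n) (@JK n) (hw n).2.
rewrite (haslen_uniq (hw n.+1) (step n x hx)).
rewrite (haslen_uniq (hw n) (haslen_add hx (hq n))); lia.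
Qed.

Variables (M : lmodType A) (v : {linear F -> M}).
Hypothesis v_surj : forall y, exists x, v x = y.
Hypothesis v_ker : forall x, v x = 0 <-> K x.

(** Vanishing passes from [J/SJ] to [J/P], which is [X/SK], then to [Kn/SK], which is [Y/SF], and
    finally to [FF/Y], which is [G(M)]. The growth bound disposes of [P/SJ] in cohomological degree
    [i + 2] and of [Kn/X] in degree [i + 1], both above [k]. *)
Lemma lvan_syzygy k i n : tor_growth k -> (k <= i)%N ->
  lvan FF (gshift FF) i n -> lvan J SJ i.+1 n ->
  lvan (adic (full_smod M)) (gshift (adic (full_smod M))) i n.
Proof.
move=> [q [n0 [sq hq]]] ki hF hJ.
have [f fE] := @mk_linear A F F idfun (fun a x y => erefl).
have grP : growth SJ P k.
  (* In degree [l], [P/SJ] lies in [W_(l+1)]; hence the shift of the polynomial. *)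
  exists (q \Po ('X + 1%:P)), n0; split; first by rewrite size_comp_poly2 // size_XaddC.
  move=> l nl; have [|c hc cq] := hq l.+1; first exact: ltnW.
  exists c; last by rewrite horner_comp hornerD hornerX hornerC natr1.
  exact: lenle_mono (@smod_refl _ _ _) (@PSK l) (@SJSK l) hc.
have grQ : growth X Kn k.
  exact: growth_sub JK JX (@gle_refl _ _ _ _ Kn) (ex_intro _ q (ex_intro _ n0 (conj sq hq))).
have h1 : lvan J P i.+1 n.
  apply: (lvan_quot SJP PJ hJ); apply: (lvan_growth (k := k)) => //.
  by rewrite ltnS ltnW.
have h2 : lvan X SK i.+1 n.
  apply: (lvan_map (f := f)) h1; first exact: PJ.
  - by move=> l x Jx; rewrite fE; exact: JX.
  - by move=> l x []; rewrite fE.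
  - by move=> l x Jx; rewrite fE => ?; split.
  - by move=> l _ [y [z [Jy Kz ->]]]; exists y => //; rewrite fE addrAC subrr add0r.
have h3 : lvan Kn SK i.+1 n.
  apply: (lvan_ext SKX XK h2); apply: (lvan_growth (k := k)) => //.
pose SF := gshift FF; pose Y := gadd SF Kn.
have SFF : gle SF FF by move=> l; apply: adic_antimono.
have SFY : gle SF Y by move=> l x; exact: addSl.
have YF : gle Y FF by move=> l; apply: addS_le; [exact: SFF|move=> x []].
have h4 : lvan Y SF i.+1 n.
  apply: (lvan_map (f := f)) h3; first exact: SKK.
  - by move=> l x Jx; rewrite fE; exact: addSr.
  - by move=> l x []; rewrite fE.
  - by move=> l x [_ Kx]; rewrite fE.
  - by move=> l _ [y [z [Jy Kz ->]]]; exists z => //; rewrite fE addrK.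
have h5 : lvan FF Y i n by exact: lvan_quot SFY YF hF h4.
have vpow l x : FF l x -> adic (full_smod M) l (v x).
  suff H : FF l <=s preim_smod v (mul_smod (ideal_pow I l) (full_smod M)) by exact: H.
  apply: mul_smod_ind.
  move=> c y Ic _; change (mul_smod (ideal_pow I l) (full_smod M) (v (c *: y))).
  by rewrite linearZ; exact: mul_smodP.
have vsur l y : adic (full_smod M) l y -> exists2 x, FF l x & v x = y.
  move=> h; suff [x] : imS v (FF l) y by exists x.
  move: y h; apply: mul_smod_ind => c y Ic _; have [x <-] := v_surj y.
  by exists (c *: x); rewrite ?linearZ //; exact: mul_smodP.
apply: (lvan_map (f := v)) h5; first exact: YF.
- exact: vpow.
- move=> l _ [y [z [Fy [_ /v_ker Kz] ->]]]; rewrite linearD Kz addr0; exact: vpow.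
- move=> l x Fx /vsur [y Fy yE]; exists y, (x - y); split => //.
    split; first by apply: smodB => //; exact: SFF.
    by apply/v_ker; rewrite linearB yE subrr.
  by rewrite addrC subrK.
- by move=> l y /vsur [x Fx <-]; exists x => //; rewrite subrr; exact: smod0.
Qed.
End Syzygy.

Let GA := adic (full_smod A^o).

Lemma adic_ideal n (x : A) : GA n x <-> ideal_pow I n x.
Proof.
split=> h.
  have : GA n <=s ideal_pow I n.
    by apply: mul_smod_ind => c y Ic _; rewrite -[c *: y]/(c * y) mulrC; exact: ideal_mul.
  by apply.
have -> : x = x *: (1 : A^o) by rewrite -[RHS]/(x * 1) mulr1.
exact: mul_smodP.
Qed.

Lemma mul_smod_row (L : ideal A) p (v : 'rV[A]_p) :
  mul_smod L (full_smod 'rV[A]_p) v <-> forall l, L (v 0 l).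
Proof.
split=> h.
  move=> l; pose N := fun v : 'rV[A]_p => L (v 0 l).
  have N0 : N 0 by rewrite /N mxE; exact: smod0.
  have NP c x y : N x -> N y -> N (c *: x + y).
    by rewrite /N => Nx Ny; rewrite !mxE; apply: smodD => //; exact: ideal_mul.
  have : mul_smod L (full_smod 'rV[A]_p) <=s Submodule N0 NP.
    by apply: mul_smod_ind => c x Lc _; change (N (c *: x)); rewrite /N mxE mulrC; exact: ideal_mul.
  by move=> /(_ _ h).
rewrite [v]row_sum_delta; apply: smod_sum => i; exact: mul_smodP.
Qed.

Lemma adic_row p n (v : 'rV[A]_p) :
  adic (full_smod 'rV[A]_p) n v <-> forall l, ideal_pow I n (v 0 l).
Proof. exact: mul_smod_row. Qed.

(** The families [T j], with [I^n] in the first [j] coordinates and [I^(n+1)] in the others, filter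
    the associated graded module of the free module by copies of [G(A)]. *)
Lemma lvan_free p i n : lvan GA (gshift GA) i n ->
  lvan (adic (full_smod 'rV[A]_p)) (gshift (adic (full_smod 'rV[A]_p))) i n.
Proof.
move=> hA.
pose N j n (v : 'rV[A]_p) := forall l : 'I_p, ideal_pow I (if (l < j)%N then n else n.+1) (v 0 l).
have N0 j n' : N j n' 0 by move=> l; rewrite mxE; exact: smod0.
have NP j n' c x y : N j n' x -> N j n' y -> N j n' (c *: x + y).
  by move=> Nx Ny l; rewrite !mxE; apply: smodD; [apply: ideal_mul; exact: Nx|exact: Ny].
have Nop j k n' x : (k < r)%N -> Submodule (N0 j n') (NP j n') x ->
    Submodule (N0 j n'.+1) (NP j n'.+1) (a k *: x).
  move=> kr Nx l; rewrite mxE; have := Nx l; case: ifP => _ h.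
    exact: (mul_smodP (M := A^o) (aI kr) h).
  exact: (mul_smodP (M := A^o) (aI kr) h).
pose T j : gfam 'rV[A]_p a r := Gfam (Nop j).
have TS j : gle (T j) (T j.+1).
  move=> n' x Nx l; have := Nx l; case: (ltnP l j) => lj; first by rewrite (ltn_trans lj).
  by case: ltnP => // _; exact: ideal_powS.
have T0 : gle (T 0%N) (gshift (adic (full_smod 'rV[A]_p))).
  by move=> n' x Nx; apply/adic_row => l; exact: Nx.
have main j : (j <= p)%N -> lvan (T j) (T 0%N) i n.
  elim: j => [_|j IH jp]; first by apply: van_triv.
  apply: lvan_ext (IH (ltnW jp)) _ => //.
    by apply: gle_mono (leq0n j) => k; exact: TS.
  have [f fE] : exists f : {linear A^o -> 'rV[A]_p}, forall x, f x = x *: delta_mx 0 (Ordinal jp).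
    by apply: mk_linear => c x y; rewrite scalerDl scalerA.
  have fij l (x : A) : f x 0 l = if l == Ordinal jp then x else 0.
    by rewrite fE !mxE eqxx /= eq_sym; case: eqP; rewrite ?mulr1 ?mulr0.
  apply: (lvan_map (f := f)) hA; first by move=> n'; apply: adic_antimono.
  - move=> n' x /adic_ideal Ix l; rewrite fij; case: eqP => [->|_]; last exact: smod0.
    by rewrite /= ltnSn.
  - move=> n' x /adic_ideal Ix l; rewrite fij; case: eqP => [->|_]; last exact: smod0.
    by rewrite /= ltnn.
  - move=> n' x _ /(_ (Ordinal jp)); rewrite fij eqxx /= ltnn => /adic_ideal h; exact: h.
  - move=> n' y Ny; exists (y 0 (Ordinal jp)).
      by apply/adic_ideal; have := Ny (Ordinal jp); rewrite /= ltnSn.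
    move=> l; have -> (u w : 'rV[A]_p) : (u - w) 0 l = u 0 l - w 0 l by rewrite !mxE.
    rewrite fij; case: eqP => [->|/eqP lj]; first by rewrite subrr; exact: smod0.
    rewrite subr0; have := Ny l; rewrite ltnS leq_eqVlt.
    by have /negPf -> : nat_of_ord l != j by apply: contra lj => /eqP lj; apply/eqP/val_inj.
have [f fE] := @mk_linear A _ _ idfun (fun a (x y : 'rV[A]_p) => erefl).
apply: (lvan_map (f := f)) (main p (leqnn p)).
- by apply: gle_mono (leq0n p) => k; exact: TS.
- by move=> n' x Nx; rewrite fE; apply/adic_row => l; have := Nx l; rewrite ltn_ord.
- by move=> n' x Nx; rewrite fE; exact: T0.
- by move=> n' x _; rewrite fE => /adic_row h l; exact: h.
- move=> n' y /adic_row h; exists y; last by rewrite fE subrr; exact: smod0.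
  by move=> l; rewrite ltn_ord.
Qed.

Lemma lvan_sub V (K : submodule V) i n :
  lvan (adic (full_smod (smod_type K))) (gshift (adic (full_smod (smod_type K)))) i n ->
  lvan (adic K) (gshift (adic K)) i n.
Proof.
have [f fE] := val_linear K.
have fadic n' x : adic (full_smod (smod_type K)) n' x -> adic K n' (f x).
  suff H : adic (full_smod (smod_type K)) n' <=s preim_smod f (adic K n') by exact: H.
  apply: mul_smod_ind => c z Ic _; change (adic K n' (f (c *: z))).
  by rewrite linearZ fE; apply: mul_smodP => //; exact: smod_valP.
have fsur n' y : adic K n' y -> exists2 x, adic (full_smod (smod_type K)) n' x & f x = y.
  suff H : adic K n' <=s imS f (adic (full_smod (smod_type K)) n') by move=> /H [x]; exists x.
  apply: mul_smod_ind => c _ Ic /ex_sub [z <-]; exists (c *: z); first exact: mul_smodP.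
  by rewrite linearZ fE.
apply: (lvan_map (f := f)).
- by move=> n'; apply: adic_antimono.
- exact: fadic.
- by move=> n' x; exact: fadic.
- move=> n' x _ /fsur [y hy]; rewrite !fE => /val_inj <-; exact: hy.
- by move=> n' y /fsur [x hx <-]; exists x; rewrite ?subrr //; exact: smod0.
Qed.

Theorem lvan_bound (C : lmodType A -> Prop) k eta :
  (forall M, C M -> exists p (v : {linear 'rV[A]_p -> M}),
     [/\ forall y, exists x, v x = y, tor_growth (ker_smod v) k
       & C (smod_type (ker_smod v))]) ->
  (forall n, (eta <= n)%N -> forall i, lvan GA (gshift GA) i n) ->
  forall M, C M -> forall i n, (k <= i)%N -> (eta <= n)%N ->
  lvan (adic (full_smod M)) (gshift (adic (full_smod M))) i n.
Proof.
move=> CH Heta M CM i n; move: {2}(r.+1)%N (leq_addl i r.+1) => j.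
elim: j i M CM => [|j IH] i M CM ri ki en; first by apply: van_big; rewrite addn0 in ri.
have [p [v [vs vg vC]]] := CH M CM.
apply: (lvan_syzygy (fin_gen_row A p) vs (K := ker_smod v) _ vg ki) => //.
  by apply: lvan_free; exact: Heta.
by apply: lvan_sub; apply: IH => //; [rewrite addSnnS|exact: leqW].
Qed.

Lemma lvan_ring : exists eta, forall n, (eta <= n)%N -> forall i, lvan GA (gshift GA) i n.
Proof.
apply: lvan_eventually; first by move=> n; apply: adic_antimono.
by apply: adic_noeth; exact: A_noeth.
Qed.
End Adic.

(** * Graded local cohomology *)

Section HomogeneousAction.
Variables (A : comNzRingType) (I : ideal A).
Let G := assoc_gr I.
Implicit Types X : grMod G.

Definition hcl i (b : A) : G i := cls (ideal_pow I i) (ideal_pow I i.+1) (b : A^o).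

Lemma hcl_surj i (g : G i) : exists2 b : A, ideal_pow I i b & g = hcl i b.
Proof. exact: (@clsP _ _ (ideal_pow I i) (ideal_pow I i.+1) g). Qed.

Lemma hclD i (b c : A) : ideal_pow I i b -> ideal_pow I i c -> hcl i (b + c) = hcl i b + hcl i c.
Proof. exact: clsD. Qed.

Lemma hcl0 i (b : A) : ideal_pow I i.+1 b -> hcl i b = 0.
Proof.
move=> Ib; apply: (@addrI _ (hcl i 0)); rewrite addr0 -hclD; [|exact: smod0|exact: ideal_powS].
rewrite add0r; apply: cls_eq; [exact: ideal_powS|exact: smod0|by rewrite subr0].
Qed.

Lemma hclM i j k (e : (i + j = k)%N) (b c : A) : ideal_pow I i b -> ideal_pow I j c ->
  gr_mul e (hcl i b) (hcl j c) = hcl k (b * c).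
Proof. exact: assoc_gr_mulE. Qed.

Definition hact X i j k (e : i%:Z + j = k) (b : A) (x : X j) : X k := gm_act e (hcl i b) x.

Lemma gm_act0r X i j k (e : i%:Z + j = k) (g : G i) : gm_act e g (0 : X j) = 0.
Proof. by apply: (@addrI _ (gm_act e g 0)); rewrite -gm_actDr !addr0. Qed.

Lemma gm_act0l X i j k (e : i%:Z + j = k) (x : X j) : gm_act e (0 : G i) x = 0.
Proof. by apply: (@addrI _ (gm_act e 0 x)); rewrite -gm_actDl !addr0. Qed.

Lemma hactDr X i j k (e : i%:Z + j = k) b (x y : X j) :
  hact e b (x + y) = hact e b x + hact e b y.
Proof. exact: gm_actDr. Qed.

Lemma hact0r X i j k (e : i%:Z + j = k) b : hact e b (0 : X j) = 0.
Proof. exact: gm_act0r. Qed.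

Lemma hactNr X i j k (e : i%:Z + j = k) b (x : X j) : hact e b (- x) = - hact e b x.
Proof. by apply: (@addrI _ (hact e b x)); rewrite -hactDr !subrr hact0r. Qed.

Lemma hactDl X i j k (e : i%:Z + j = k) (b c : A) (x : X j) :
  ideal_pow I i b -> ideal_pow I i c -> hact e (b + c) x = hact e b x + hact e c x.
Proof. by move=> Ib Ic; rewrite /hact hclD // gm_actDl. Qed.

Lemma hact0l X i j k (e : i%:Z + j = k) (b : A) (x : X j) :
  ideal_pow I i.+1 b -> hact e b x = 0.
Proof. by move=> Ib; rewrite /hact hcl0 // gm_act0l. Qed.

Lemma hactA X (i j ij : nat) (l jl k : int) (e1 : (i + j = ij)%N)
    (e2 : ij%:Z + l = k) (e3 : j%:Z + l = jl) (e4 : i%:Z + jl = k) (b c : A) (x : X l) :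
  ideal_pow I i b -> ideal_pow I j c -> hact e2 (b * c) x = hact e4 b (hact e3 c x).
Proof. by move=> Ib Ic; rewrite /hact -(hclM e1 Ib Ic); exact: gm_actA. Qed.

Lemma hact1 X j (e : 0%:Z + j = j) (x : X j) : hact e 1 x = x.
Proof. exact: gm_act1. Qed.

Lemma hactC X (b c : A) i i' j k1 k2 k (e1 : i%:Z + j = k1) (e2 : i'%:Z + k1 = k)
  (e3 : i'%:Z + j = k2) (e4 : i%:Z + k2 = k) (x : X j) :
  ideal_pow I i b -> ideal_pow I i' c -> hact e2 c (hact e1 b x) = hact e4 b (hact e3 c x).
Proof.
move=> Ib Ic; have e5 : (i + i')%N%:Z + j = k by rewrite PoszD -addrA e3.
by rewrite -(hactA erefl e5) // -(@hactA X _ _ _ _ _ _ (addnC i' i) e5) // mulrC.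
Qed.

Lemma gh_hact X Y (u : grHom X Y) i j k (e : i%:Z + j = k) b (x : X j) :
  u k (hact e b x) = hact e b (u j x).
Proof. exact: gh_act. Qed.

Lemma gh0 X Y (u : grHom X Y) n : u n 0 = 0.
Proof. by apply: (@addrI _ (u n 0)); rewrite -gh_add !addr0. Qed.

Lemma ghN X Y (u : grHom X Y) n x : u n (- x) = - u n x.
Proof. by apply: (@addrI _ (u n x)); rewrite -gh_add !subrr gh0. Qed.

Lemma ghB X Y (u : grHom X Y) n x y : u n (x - y) = u n x - u n y.
Proof. by rewrite gh_add ghN. Qed.

Section Total.
Variable X : grMod G.

(** Degrees below 0 are left out: a Koszul cochain of internal degree [n >= 0] has no coefficients
    there, and the bound [eta] is a natural number. *)
Record total := Total { tv : forall n : nat, X n%:Z }.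

HB.instance Definition _ := gen_eqMixin total.
HB.instance Definition _ := gen_choiceMixin total.

Lemma total_ext x y : (forall n, tv x n = tv y n) -> x = y.
Proof. by case: x y => x [y] /= xy; congr Total; exact: functional_extensionality_dep. Qed.

Fact total_addA : associative (fun x y => Total (fun n => tv x n + tv y n)).
Proof. by move=> x y z; apply: total_ext => n /=; rewrite addrA. Qed.
Fact total_addC : commutative (fun x y => Total (fun n => tv x n + tv y n)).
Proof. by move=> x y; apply: total_ext => n /=; rewrite addrC. Qed.
Fact total_add0 : left_id (Total (fun=> 0)) (fun x y => Total (fun n => tv x n + tv y n)).
Proof. by move=> x; apply: total_ext => n /=; rewrite add0r. Qed.
Fact total_addN : left_inverse (Total (fun=> 0)) (fun x => Total (fun n => - tv x n))
  (fun x y => Total (fun n => tv x n + tv y n)).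
Proof. by move=> x; apply: total_ext => n /=; rewrite addNr. Qed.
HB.instance Definition _ := GRing.isZmodule.Build total
  total_addA total_addC total_add0 total_addN.

Definition tdelta (n : nat) (y : X n%:Z) : total :=
  Total (fun n' => match @eqP _ n n' with
    | ReflectT e => eq_rect n (fun k => X k%:Z) y n' e
    | ReflectF _ => 0
    end).

Lemma tdelta_id n y : tv (@tdelta n y) n = y.
Proof.
rewrite /=; case: eqP => // e.
by rewrite (eq_irrelevance e erefl).
Qed.

Lemma tdelta_ne n y n' : n' != n -> tv (@tdelta n y) n' = 0.
Proof. by move=> nn /=; case: eqP => // e; case/eqP: nn; exact: esym. Qed.
End Total.

Variables (a : nat -> A) (r : nat).
Hypothesis aI : forall k, I (a k).
Hypothesis Ia : forall N : ideal A, (forall k, (k < r)%N -> N (a k)) -> I <=s N.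

Let aI1 k : ideal_pow I 1 (a k).
Proof. by rewrite -[a k]mulr1; apply: (mul_smodP (M := A^o) (aI k)). Qed.

Let aIn k n : ideal_pow I n (a k ^+ n).
Proof. by elim: n => [|n IH] //; rewrite exprS; apply: (mul_smodP (M := A^o) (aI k)). Qed.

Section TotalOps.
Variable X : grMod G.

Fact succ_eq (n : nat) : 1%:Z + n%:Z = n.+1%:Z.
Proof. by rewrite -PoszD. Qed.

Definition tstep k (x : total X) (n : nat) : X n%:Z :=
  match n with
  | 0%N => 0
  | n'.+1 => hact (succ_eq n') (a k) (tv x n')
  end.

Program Definition totops : opmod :=
  @Opmod (total X) (fun k x => Total (tstep k x)) _ _.
Next Obligation.
move=> k x y; apply: total_ext => -[|n] /=; first by rewrite subr0.
by rewrite hactDr hactNr.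
Qed.
Next Obligation.
move=> j k x; apply: total_ext => -[|[|n]] //=; first by rewrite !hact0r.
exact: hactC.
Qed.

Section Subset.
Variable S : forall n : nat, X n%:Z -> Prop.
Hypothesis S0 : forall n, S (0 : X n%:Z).
Hypothesis SB : forall n (x y : X n%:Z), S x -> S y -> S (x - y).
Hypothesis Sop : forall k n (x : X n%:Z), S x -> S (hact (succ_eq n) (a k) x).

Definition tpred n (x : totops) := (forall n', n' != n -> tv x n' = 0) /\ S (tv x n).

Program Definition tset : gset totops r := @Gset totops r tpred _ _ _.
Next Obligation. by move=> n; split. Qed.
Next Obligation.
move=> n x y [x0 Sx] [y0 Sy]; split; last exact: SB.
by move=> n' nn /=; rewrite x0 ?y0 ?subr0.
Qed.
Next Obligation.
move=> k n x _ [x0 Sx]; split; last exact: Sop.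
by move=> [|n'] //= nn; rewrite x0 ?hact0r.
Qed.

Lemma tset_delta n (y : X n%:Z) : S y -> tset n (tdelta y).
Proof. by move=> Sy; split; [exact: tdelta_ne|rewrite tdelta_id]. Qed.
End Subset.

Lemma tv_opn k s n p (e : s%:Z + n%:Z = p%:Z) (x : totops) :
  tv (opn k s x) p = hact e (a k ^+ s) (tv x n).
Proof.
elim: s p e => [|s IH] p e.
  have enp : n = p by move: e; rewrite add0r => -[].
  by subst p; rewrite expr0 hact1.
case: p e => [|p] e; first by [].
have e' : s%:Z + n%:Z = p%:Z by move: e; rewrite -!PoszD addSn => -[->].
rewrite /= (IH _ e') exprS; symmetry.
exact: (hactA (add1n s)).
Qed.

(** Torsion expressed by one multiplication from [I^i] instead of [t] successive ones; this form can
    be checked on generators of [I]. *)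
Definition htors n (y : X n) := exists N, forall i, (N <= i)%N ->
  forall k (e : i%:Z + n = k) (b : A), ideal_pow I i b -> hact e b y = 0.

Lemma htors_gamma n (y : X n) : htors y -> Gamma_plus y.
Proof.
move=> [N H]; exists N; elim: N n y H => [|N IH] n y H.
  by have := H 0%N (leqnn 0) n (add0r n) 1 Logic.I; rewrite hact1.
move=> i k e g i0; have [b Ib ->] := hcl_surj g.
apply: IH => i' Ni' k' e' c Ic.
have e2 : (i' + i)%N%:Z + n = k' by rewrite PoszD -addrA e.
have := hactA erefl e2 e e' y Ic Ib; rewrite /hact => <-.
apply: H; last exact: ideal_powM.
by rewrite -addn1; apply: leq_add.
Qed.

Lemma killed_opn n t (y : X n%:Z) : killed t y ->
  forall k p (e : t%:Z + n%:Z = p), hact e (a k ^+ t) y = 0.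
Proof.
elim: t n y => [|t IH] n y; first by move=> /= -> k p e; rewrite hact0r.
move=> H k p e.
have e' : t%:Z + n.+1%:Z = p by rewrite -e -!PoszD addnS addSn.
rewrite exprSr (hactA (addn1 t) e (succ_eq n) e') //; apply: IH.
exact: H.
Qed.

Lemma htors_gen n (y : X n) : 
  (forall k, (k < r)%N -> forall p (e : 1%:Z + n = p), htors (hact e (a k) y)) -> htors y.
Proof.
move=> H.
have /choice [N HN] k : exists N, (k < r)%N -> forall i, (N <= i)%N ->
    forall p (e : i%:Z + (1%:Z + n) = p) b, ideal_pow I i b -> hact e b (hact erefl (a k) y) = 0.
  case: (ltnP k r) => kr; last by exists 0%N.
  by have [N hN] := H k kr _ erefl; exists N.
exists (\max_(k < r) N k).+1 => -[|i] // Ni k e b Ib.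
have e' : i%:Z + (1%:Z + n) = k by rewrite -e addrA -PoszD addn1.
have comm (c b' : A) : I c -> ideal_pow I i b' -> hact e (c * b') y = hact e' b' (hact erefl c y).
  move=> Ic Ib'; rewrite mulrC; apply: (hactA (addn1 i)) => //.
  by rewrite -[c]mulr1; apply: (mul_smodP (M := A^o) Ic).
pose Q (c : A) := ideal_pow I i.+1 c /\ hact e c y = 0.
have Q0 : Q 0 by split; [exact: smod0|apply: hact0l; exact: smod0].
have QP u c c' : Q c -> Q c' -> Q (u * c + c').
  move=> [Ic hc] [Ic' hc']; split; first exact: (@smodP _ _ (ideal_pow I i.+1)).
  rewrite hactDl ?hc' ?addr0 //; last exact: ideal_mul.
  by rewrite (hactA (add0n i.+1) e e (add0r k)) ?hc ?hact0r.
suff : ideal_pow I i.+1 <=s (@Submodule A A^o Q Q0 QP) by move=> /(_ _ Ib) [].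
apply: mul_smod_ind => c {}b Ic {}Ib; split; first exact: (mul_smodP (M := A^o) Ic).
change (hact e (c * b) y = 0); rewrite comm //.
pose T (c : A) := I c /\ hact e' b (hact erefl c y) = 0.
have I1 (u : A) : I u -> ideal_pow I 1 u by move=> Iu; rewrite -[u]mulr1; apply: (mul_smodP (M := A^o) Iu).
have T0 : T 0.
  split; first exact: smod0.
  by rewrite [hact _ 0 y]hact0l ?hact0r //; exact: smod0.
have TP u c1 c2 : T c1 -> T c2 -> T (u * c1 + c2).
  move=> [Ic1 hc1] [Ic2 hc2]; split; first exact: (@smodP _ _ I).
  rewrite hactDl ?hactDr ?hc2 ?addr0; [|exact: I1 (ideal_mul _ _)|exact: I1].
  rewrite (hactA (add0n 1) erefl erefl (add0r _)) //; last exact: I1.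
  by rewrite (hactC _ e' e' (add0r k)) // hc1 hact0r.
suff : I <=s (@Submodule A A^o T T0 TP) by move=> /(_ _ Ic) [].
apply: Ia => l lr; split => //; apply: HN => //; rewrite -ltnS; apply: leq_trans Ni.
by rewrite ltnS; exact: (leq_bigmax (Ordinal lr)).
Qed.

Lemma htors_opn n (y : X n%:Z) s :
  (forall k, (k < r)%N -> forall p (e : s%:Z + n%:Z = p%:Z), hact e (a k ^+ s) y = 0) -> htors y.
Proof.
(* The exponents may now differ from one generator to the next; replacing [y] by its product with
   [a k] lowers the [k]-th, and the induction is on their sum. *)
move=> H; pose E := fun _ : nat => s.
have : forall k, (k < r)%N -> forall p (e : (E k)%:Z + n%:Z = p%:Z), hact e (a k ^+ E k) y = 0 by [].
move: {H s} E => E H.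
have zero k n' (y' : X n'%:Z) p (e : 1%:Z + n'%:Z = p) : y' = 0 -> htors (hact e (a k) y').
  by move=> ->; exists 0%N => *; rewrite !hact0r.
elim: {E}(\sum_(k < r) E k)%N {-2}E (leqnn (\sum_(k < r) E k)%N) n y H => [|S IH] E SE n y H.
  apply: htors_gen => k kr p e; apply: zero.
  have Ek : E k = 0%N.
    by apply/eqP; rewrite -leqn0; apply: leq_trans SE; rewrite (bigD1 (Ordinal kr)) //= leq_addr.
  have := H k kr n; rewrite Ek => /(_ (add0r _)); by rewrite expr0 hact1.
apply: htors_gen => k kr p e.
case Ek : (E k) => [|s].
  by apply: zero; have := H k kr n; rewrite Ek => /(_ (add0r _)); rewrite expr0 hact1.
have pE : n.+1%:Z = p by rewrite -e -PoszD.
move: e; case: p / pE => e; apply: (IH (fun l => if l == k then s else E l)).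
  rewrite -ltnS; apply: leq_trans SE.
  rewrite (bigD1 (Ordinal kr)) //= [X in (_ < X)%N](bigD1 (Ordinal kr)) //= eqxx Ek addSn ltnS.
  rewrite leq_add2l; apply: leq_sum => l lk.
  by case: eqP => // ->; rewrite Ek.
move=> l lr q; case: eqP => [->|_] e'.
  have e2 : s.+1%:Z + n%:Z = q%:Z by rewrite -e' -!PoszD addSnnS.
  by have := H k kr q; rewrite Ek => /(_ e2) <-; rewrite exprSr (hactA (addn1 s) e2 e e').
have e1 : (E l)%:Z + n%:Z = (E l + n)%N%:Z by [].
have e2 : 1%:Z + (E l + n)%N%:Z = q by rewrite -e' -!PoszD; congr Posz; lia.
by rewrite (hactC e e' e1 e2) // H // hact0r.
Qed.
End TotalOps.
End HomogeneousAction.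

Record subgrp (V : zmodType) := Subgrp {
  sg :> V -> Prop;
  sg0 : sg 0;
  sgB : forall x y, sg x -> sg y -> sg (x - y) }.

Section GroupQuotient.
Variables (V : zmodType) (N : subgrp V).

Definition sgmem : {pred V} := fun x => `[< N x >].

Lemma sgmem_closed : zmod_closed sgmem.
Proof.
by split=> [|x y /asboolP Nx /asboolP Ny]; apply/asboolP; [exact: sg0|exact: sgB].
Qed.
HB.instance Definition _ := GRing.isZmodClosed.Build V sgmem sgmem_closed.

Definition quotg := Quotient.quot sgmem.
HB.instance Definition _ := GRing.Zmodule.on quotg.
HB.instance Definition _ := EqQuotient.on quotg.

Definition gpi (x : V) : quotg := \pi_quotg x.

Lemma gpi_eq x y : gpi x = gpi y <-> N (x - y).
Proof.
split; first by move=> /eqP; rewrite -Quotient.idealrBE => /asboolP.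
by move=> h; apply/eqP; rewrite -Quotient.idealrBE; apply/asboolP.
Qed.

Lemma gpiD x y : gpi (x + y) = gpi x + gpi y.
Proof. exact: raddfD. Qed.

Lemma gpiK q : gpi (repr (q : quotg)) = q.
Proof. exact: reprK. Qed.
End GroupQuotient.

(** * Linear equations in graded-injective modules *)

Section Solve.
Variables (A : comNzRingType) (I : ideal A).
Let G := assoc_gr I.
Variables (J : grMod G) (n0 : int).
Let GA := assoc_gm I A^o.

Lemma shift_eq (i : nat) (j k : int) : i%:Z + j = k -> i%:Z + (j - n0) = k - n0.
Proof. by move=> <-; rewrite addrA. Qed.

Let Y0 (m : int) : zmodType := (J m * GA (m - n0))%type.
Variable N : forall m, subgrp (Y0 m).
Hypothesis N_act : forall i j k (e : i%:Z + j = k) (g : G i) (p : Y0 j),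
  N j p -> N k (gm_act e g p.1, gm_act (shift_eq e) g p.2).

Definition yact i j k (e : i%:Z + j = k) (g : G i) (q : quotg (N j)) : quotg (N k) :=
  gpi (N k) (gm_act e g (repr q).1, gm_act (shift_eq e) g (repr q).2).

Lemma gm_actBr (X : grMod G) i j k (e : i%:Z + j = k) (g : G i) (x y : X j) :
  gm_act e g (x - y) = gm_act e g x - gm_act e g y.
Proof. by apply: (@addIr _ (gm_act e g y)); rewrite -gm_actDr !subrK. Qed.

Lemma yact_pi i j k (e : i%:Z + j = k) (g : G i) (p : Y0 j) :
  yact e g (gpi (N j) p) = gpi (N k) (gm_act e g p.1, gm_act (shift_eq e) g p.2).
Proof.
apply/gpi_eq; set q := repr _; have : N j (q - p) by apply/gpi_eq; exact: gpiK.
move=> /(N_act e g) h.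
suff -> : forall x y : Y0 j, (gm_act e g x.1, gm_act (shift_eq e) g x.2) -
   (gm_act e g y.1, gm_act (shift_eq e) g y.2) =
   (gm_act e g (x - y).1, gm_act (shift_eq e) g (x - y).2) :> Y0 k by [].
by move=> x y; apply: pair_ext; symmetry; exact: gm_actBr.
Qed.

Program Definition solve_mod : grMod G :=
  @GrMod G (fun m => quotg (N m) : zmodType) yact _ _ _ _.
Next Obligation.
move=> i j k e g x y; rewrite -[x]gpiK -[y]gpiK -gpiD !yact_pi -gpiD.
by congr gpi; apply: pair_ext; exact: gm_actDr.
Qed.
Next Obligation.
move=> i j k e x g h; rewrite -[x]gpiK !yact_pi -gpiD.
by congr gpi; apply: pair_ext; exact: gm_actDl.
Qed.
Next Obligation.
move=> i j ij l jl k e1 e2 e3 e4 g h x; rewrite -[x]gpiK !yact_pi.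
by congr gpi; apply: pair_ext; exact: gm_actA.
Qed.
Next Obligation.
move=> j e x; rewrite -[x]gpiK !yact_pi.
by congr gpi; apply: pair_ext; exact: gm_act1.
Qed.

Program Definition solve_in : grHom J solve_mod :=
  @GrHom G J solve_mod (fun m y => gpi (N m) (y, 0)) _ _.
Next Obligation.
move=> m x y /=; rewrite -gpiD; congr gpi; apply: pair_ext => //=.
by rewrite addr0.
Qed.
Next Obligation.
move=> i j k e g x; rewrite /= yact_pi; congr gpi; apply: pair_ext => //.
by symmetry; exact: gm_act0r.
Qed.

(** [N] is a module of equations: a pair of [y] and the class of [c] demands [y = c z]. By
    consistency [J] embeds in the quotient by [N] of the sum of [J] and a shift of [G(A)], and
    injectivity of [J] provides a retraction [rho]. *)
Lemma solve : gr_injective J ->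
  (forall m y, N m (y, 0) -> y = 0) ->
  exists z : J n0, forall i m (e : i%:Z + n0 = m) (c : A) y, ideal_pow I i c ->
    N m (y, cls (powmod I A^o (m - n0)) (powmod I A^o (m - n0 + 1)) (c : A^o)) ->
    y = hact e c z.
Proof.
move=> Jinj cons.
pose idJ : grHom J J := @GrHom G J J (fun=> id) (fun _ _ _ => erefl) (fun _ _ _ _ _ _ => erefl).
have mono : gr_mono solve_in.
  move=> m x y /gpi_eq h; apply/eqP; rewrite -subr_eq0; apply/eqP; apply: cons.
  by move: h; congr (N m _); apply: pair_ext => //=; rewrite subr0.
have [rho rhoE] := Jinj _ _ solve_in idJ mono.
pose one : GA (n0 - n0) := cls _ _ (1 : A^o).
pose t : solve_mod n0 := gpi (N n0) (0, one).
(* In the quotient [y + c t = 0], where [t] is the class of [(0, 1)]; hence the sign. *)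
exists (- rho n0 t) => i m e c y Ic Nyc.
have p1 : powmod I A^o (n0 - n0) (1 : A^o).
  rewrite subrr -[1](mulr1 (1 : A)).
  exact: (@mul_smodP A A^o (ideal_pow I 0) (full_smod A^o) 1 1 Logic.I Logic.I).
have E : gm_act e (hcl I i c) t = gpi (N m) (0, cls (powmod I A^o (m - n0)) (powmod I A^o (m - n0 + 1)) (c : A^o)).
  rewrite [LHS]yact_pi; congr gpi; apply: pair_ext; first exact: gm_act0r.
  rewrite [LHS](assoc_gm_actE (shift_eq e) Ic p1).
  by congr cls; rewrite -[LHS]/(c * 1) mulr1.
have : gpi (N m) (y, cls (powmod I A^o (m - n0)) (powmod I A^o (m - n0 + 1)) (c : A^o)) = gpi (N m) 0.
  by apply/gpi_eq; rewrite subr0.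
rewrite hactNr -[hact e c _](gh_act rho e (hcl I i c) t) E => H.
have E0 : solve_in m y + gpi (N m) (0, cls (powmod I A^o (m - n0)) (powmod I A^o (m - n0 + 1)) (c : A^o)) = gpi (N m) 0.
  rewrite -H -gpiD; congr gpi; apply: pair_ext => /=; first exact: addr0.
  exact: add0r.
have gp0 : gpi (N m) 0 = 0 by exact: raddf0.
apply/eqP; rewrite -subr_eq0 opprK; apply/eqP.
have := congr1 (rho m) E0; rewrite gp0 gh0 => E1.
by rewrite -[RHS]E1 gh_add rhoE.
Qed.
End Solve.

Lemma cls0P (A : comNzRingType) (V : lmodType A) (Z B : submodule V) v :
  Z v -> cls Z B v = 0 -> B v.
Proof.
move=> Zv v0; have h0 := rep_cls B (smod0 Z); have hv := rep_cls B Zv.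
have c0 : cls Z B 0 = 0.
  by apply: (@addrI _ (cls Z B 0)); rewrite -clsD ?addr0 //; exact: smod0.
rewrite v0 in hv; rewrite c0 subr0 in h0.
by rewrite -[v](subKr (rep (0 : subquot Z B))); exact: smodB.
Qed.

Lemma clsB (A : comNzRingType) (V : lmodType A) (Z B : submodule V) v w :
  Z v -> Z w -> cls Z B (v - w) = cls Z B v - cls Z B w.
Proof.
move=> Zv Zw; apply: (@addIr _ (cls Z B w)); rewrite -clsD ?subrK //; exact: smodB.
Qed.

Lemma hactNl (A : comNzRingType) (I : ideal A) (X : grMod (assoc_gr I)) i j k
    (e : i%:Z + j = k) (b : A) (x : X j) : ideal_pow I i b -> hact e (- b) x = - hact e b x.
Proof.
move=> Ib; apply/eqP; rewrite -subr_eq0 opprK -hactDl ?addNr //; last exact: (smodN Ib).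
by rewrite hact0l //; exact: smod0.
Qed.

(** * Divisibility in graded-injective modules *)

Section Acyclic.
Variables (A : comNzRingType) (I : ideal A).
Hypothesis A_noeth : noetherian A.
Variables (a : nat -> A) (r : nat).
Hypothesis aI : forall k, I (a k).
Hypothesis Ia : forall N : ideal A, (forall k, (k < r)%N -> N (a k)) -> I <=s N.
Let G := assoc_gr I.

Let aIn k n : ideal_pow I n (a k ^+ n).
Proof. by elim: n => [|n IH] //; rewrite exprS; apply: (mul_smodP (M := A^o) (aI k)). Qed.

Section PowerIdeal.
Variables (k t : nat).

(** Representatives of the degree [e] part of [G(A)] shifted by [u]. The test is needed because for
    [e < u] truncated subtraction would give all of [A]. *)
Definition cideal (u e : nat) : ideal A := if (u <= e)%N then ideal_pow I (e - u) else botS A^o.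

Lemma cidealM u e i (c b : A) : ideal_pow I i c -> cideal u e b -> cideal u (i + e) (c * b).
Proof.
rewrite /cideal; case: leqP => ue Ic; last by move=> ->; rewrite mulr0; exact: smod0.
move=> Ib; rewrite (leq_trans ue) ?leq_addl // -addnBA //; exact: ideal_powM.
Qed.

Lemma cideal_pow u e (c b : A) : ideal_pow I u b -> cideal u e c -> ideal_pow I e (c * b).
Proof.
rewrite /cideal; case: leqP => ue Ib; last by move=> ->; rewrite mul0r; exact: smod0.
by move=> Ic; rewrite -(subnK ue); exact: ideal_powM.
Qed.

(* The degree e part of the ideal of G generated by the t-th powers of the
   classes of a 0, ..., a (k - 1). *)
Program Definition powideal (e : nat) : ideal A :=
  @Submodule A A^o (fun w => exists2 c : nat -> A, (forall j, cideal t e (c j)) &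
    ideal_pow I e.+1 (w - \sum_(j < k) c j * a j ^+ t)) _ _.
Next Obligation.
move=> e; exists (fun=> 0) => [j|]; first exact: smod0.
by rewrite big1 ?subr0 => [|j _]; [exact: smod0|rewrite mul0r].
Qed.
Next Obligation.
move=> e u x y [c hc Ix] [c' hc' Iy]; exists (fun j => u * c j + c' j).
  by move=> j; apply: (@smodP _ _ (cideal t e)).
have -> : u *: (x : A^o) + y - \sum_(j < k) (u * c j + c' j) * a j ^+ t =
    u *: (x - \sum_(j < k) c j * a j ^+ t : A^o) + (y - \sum_(j < k) c' j * a j ^+ t).
  rewrite -[_ *: _]/(u * x) -[u *: (_ - _)]/(u * (x - _)) mulrBr addrACA -opprD; congr (_ - _).
  by rewrite mulr_sumr -big_split; apply: eq_bigr => j _ /=; rewrite mulrDl mulrA.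
exact: smodP.
Qed.

Lemma powidealM i e (c w : A) : ideal_pow I i c -> powideal e w -> powideal (i + e) (c * w).
Proof.
move=> Ic [d hd Iw]; exists (fun j => c * d j); first by move=> j; exact: cidealM.
have -> : c * w - \sum_(j < k) c * d j * a j ^+ t = c * (w - \sum_(j < k) d j * a j ^+ t).
  by rewrite mulrBr mulr_sumr; congr (_ - _); apply: eq_bigr => j _; rewrite mulrA.
by rewrite -addnS; exact: ideal_powM.
Qed.

Lemma powideal_sub e (w : A) : powideal e w -> ideal_pow I e w.
Proof.
move=> [c hc Iw]; rewrite -(subrK (\sum_(j < k) c j * a j ^+ t) w).
apply: smodD; first exact: ideal_powS.
by apply: (@smod_sum _ A^o) => j; exact: (cideal_pow (aIn j t)).
Qed.

Lemma powideal_pow e (w : A) : ideal_pow I e.+1 w -> powideal e w.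
Proof.
move=> Iw; exists (fun=> 0) => [j|]; first exact: smod0.
by rewrite big1 ?subr0 => [|j _]; rewrite ?mul0r.
Qed.

Lemma powideal_gen j : (j < k)%N -> powideal t (a j ^+ t).
Proof.
move=> jk; exists (fun l => if l == j then 1 else 0) => [l|].
  by rewrite /cideal leqnn subnn.
have -> : \sum_(l < k) (if nat_of_ord l == j then 1 else 0) * a l ^+ t = a j ^+ t.
  rewrite (bigD1 (Ordinal jk)) //= eqxx mul1r big1 ?addr0 // => l.
  by rewrite -(inj_eq val_inj) /= => /negPf ->; exact: mul0r.
by rewrite subrr; exact: smod0.
Qed.

Lemma powideal_act (X : grMod G) (n : nat) (x : X n%:Z) e m (em : e%:Z + n%:Z = m) (w : A) :
  (forall j, (j < k)%N -> forall p (tp : t%:Z + n%:Z = p%:Z), hact tp (a j ^+ t) x = 0) ->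
  powideal e w -> hact em w x = 0.
Proof.
move=> hx [c hc Iw].
pose Q (b : A) := ideal_pow I e b /\ hact em b x = 0.
have Q0 : Q 0 by split; [exact: smod0|apply: hact0l; exact: smod0].
have QP u b b' : Q b -> Q b' -> Q (u * b + b').
  move=> [Ib hb] [Ib' hb']; split; first exact: (@smodP _ _ (ideal_pow I e)).
  rewrite hactDl ?hb' ?addr0 //; last exact: ideal_mul.
  by rewrite (hactA (add0n e) em em (add0r m)) ?hb ?hact0r.
suff : (@Submodule A A^o Q Q0 QP) w by case.
rewrite -(subrK (\sum_(j < k) c j * a j ^+ t) w); apply: smodD.
  by split; [exact: ideal_powS|exact: hact0l].
apply: smod_sum => j; split; first exact: (cideal_pow (aIn j t)).
have := hc j; rewrite /cideal; case: leqP => te.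
  move=> Ic; have e1 : (e - t)%N%:Z + (t + n)%N%:Z = m.
    by rewrite -em -!PoszD addnA subnK.
  by rewrite (hactA (subnK te) em (erefl : t%:Z + n%:Z = (t + n)%N%:Z) e1) // hx ?hact0r.
by move=> ->; rewrite mul0r; apply: hact0l; exact: smod0.
Qed.

(** In [G(A)], the ideals [L s] of elements that [X_k^s] multiplies into the power ideal increase
    with [s], hence are stationary. *)
Lemma powideal_colon : exists s, forall i (b : A), ideal_pow I i b ->
  powideal (i + (s + t)) (b * a k ^+ (s + t)) -> powideal (i + s) (b * a k ^+ s).
Proof.
pose L s i : ideal A := capS (ideal_pow I i) (colon_ideal (lineS (a k ^+ s : A^o)) (powideal (i + s))).
have LE s i (b : A) : L s i b <-> ideal_pow I i b /\ powideal (i + s) (b * a k ^+ s).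
  split=> -[Ib h]; split=> //; first by apply: h; exists 1; rewrite scale1r.
  move=> _ [c ->]; rewrite -[_ *: _]/(b * (c * _)) mulrCA; exact: ideal_mul.
have Lop s l n x : (l < r)%N -> L s n x -> L s n.+1 (a l *: x).
  move=> lr /LE [Ib h]; apply/LE; split; first exact: (mul_smodP (M := A^o) (aI l)).
  rewrite -[_ *: _]/(a l * x) -mulrA -add1n -addnA; apply: powidealM => //.
  by have := aIn l 1; rewrite expr1.
pose LG s : gfam A^o a r := Gfam (@Lop s).
have aIr l : (l < r)%N -> I (a l) by [].
have aE n x := adic_ideal aIr n x.
have [s n x|s n x|s n x|j0 Hj] := @adic_noeth A I A_noeth a r aIr Ia A^o (A_noeth _) (full_smod A^o) LG.
- move=> /aE Ix; apply/LE; split; first exact: ideal_powS.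
  by apply: powideal_pow; rewrite -addSn; exact: ideal_powM.
- by move=> /LE [Ix _]; apply/aE.
- move=> /LE [Ix h]; apply/LE; split => //.
  rewrite exprS mulrCA addnS -add1n; apply: powidealM => //.
  by have := aIn k 1; rewrite expr1.
exists j0 => i b Ib h; have H : L (j0 + t)%N i b -> L j0 i b by exact: (Hj (j0 + t)%N i b).
by have [_] := (LE j0 i b).1 (H ((LE (j0 + t)%N i b).2 (conj Ib h))).
Qed.
End PowerIdeal.

Section Injective.
Variable J : grMod G.
Hypothesis Jinj : gr_injective J.

(* Solve a_j^t z = 0 for j < k and a_k^(s+t) z = a_k^s x, for large s. *)
Lemma injective_divides k t n (x : J (n + t)%N%:Z) :
  (forall j, (j < k)%N -> forall p (e : t%:Z + (n + t)%N%:Z = p%:Z), hact e (a j ^+ t) x = 0) ->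
  exists s (z : J n%:Z),
   [/\ forall p (e1 : (s + t)%N%:Z + n%:Z = p%:Z) (e2 : s%:Z + (n + t)%N%:Z = p%:Z),
         hact e1 (a k ^+ (s + t)) z = hact e2 (a k ^+ s) x
     & forall j, (j < k)%N -> forall p (e : t%:Z + n%:Z = p%:Z), hact e (a j ^+ t) z = 0].
Proof.
move=> hx; have [s Hs] := powideal_colon k t.
have ex' : s%:Z + (n + t)%N%:Z = (s + (n + t))%N%:Z by [].
(* The degree of the equation [a_k^(s+t) z = a_k^s x], whose right side is [x']. *)
pose N0 : int := (s + (n + t))%N%:Z.
pose x' : J N0 := hact ex' (a k ^+ s) x.
(* This is [b x'] in degree [m]. The degree of [b] is determined by [m]; below [N0] there is none,
   and the default 0 is the intended value. *)
pose F m (b : A) : J m := xget 0 [set y | exists i (e1 : i%:Z + N0 = m), y = hact e1 b x'].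
have FE m b i (e1 : i%:Z + N0 = m) : F m b = hact e1 b x'.
  apply: xget_unique; first by exists i, e1.
  move=> y [i' [e' ->]]; have ii : i' = i by apply: (@addIr _ N0 (Posz i') (Posz i) _ : _ -> Posz i' = Posz i) || lia.
  by subst i'; rewrite (Prop_irrelevance e' e1).
have F0 m b : (forall i, i%:Z + N0 <> m) -> F m b = 0.
  by move=> h; apply: xgetPN => y [i [e1 _]]; exact: (h i e1).
pose Wm m : ideal A := if m - n%:Z is Posz e then powideal k t e else botS A^o.
pose Bm m : ideal A := if m - n%:Z is Posz e then cideal (s + t) e else botS A^o.
pose cl m (c : A) : assoc_gm I A^o (m - n%:Z) :=
  cls (powmod I A^o (m - n%:Z)) (powmod I A^o (m - n%:Z + 1)) (c : A^o).
pose ak := a k ^+ (s + t).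
have aE e c : mul_smod (ideal_pow I e) (full_smod A^o) c <-> ideal_pow I e c.
  exact: (adic_ideal (fun l (_ : (l < r)%N) => aI l) e c).
have pm m b w : Bm m b -> Wm m w -> powmod I A^o (m - n%:Z) (b * ak + w).
  rewrite /Bm /Wm; case: (m - n%:Z) => e //= Bb Ww; apply/aE.
  apply: smodD; first exact: (cideal_pow (aIn k (s + t))).
  exact: (powideal_sub Ww).
have Bi m b i : i%:Z + N0 = m -> Bm m b -> ideal_pow I i b.
  rewrite /Bm /N0 => em; have -> : m - n%:Z = (i + (s + t))%N%:Z by rewrite -em; lia.
  by rewrite /cideal leq_addl addnK.
have mulm i j m c w : i%:Z + j = m -> ideal_pow I i c ->
    (Wm j w -> Wm m (c * w)) /\ (Bm j w -> Bm m (c * w)).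
  move=> <- Ic; rewrite /Wm /Bm -addrA; case: (j - n%:Z) => e /=; split.
  - exact: powidealM.
  - exact: cidealM.
  - by move=> ->; rewrite mulr0; exact: smod0.
  - by move=> ->; rewrite mulr0; exact: smod0.
pose Y0 m : zmodType := (J m * assoc_gm I A^o (m - n%:Z))%type.
(* The relations are generated by the equation for [x'], with multiplier [b], and the equations
   [w z = 0] with [w] in the power ideal. *)
pose Np m (p : Y0 m) := exists b w, [/\ Bm m b, Wm m w & p = (F m b, cl m (b * ak + w))].
have FB m b b' : Bm m b -> Bm m b' -> F m (b - b') = F m b - F m b'.
  move=> hb hb'; case: (pselect (exists i, i%:Z + N0 = m)) => [[i e1]|ne].
    rewrite !(FE _ _ _ e1) hactDl; [|exact: Bi e1 _|exact: (Bi _ _ _ e1 (smodN hb'))].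
    by rewrite hactNl //; exact: Bi e1 _.
  by rewrite !F0 ?subr0 // => i e1; apply: ne; exists i.
have Np0 m : Np m 0.
  exists 0, 0; split; [exact: smod0|exact: smod0|].
  have F00 : F m 0 = 0.
    by have := FB m 0 0 (smod0 _) (smod0 _); rewrite !subrr.
  apply: pair_ext; rewrite /= ?F00 //.
  rewrite mul0r addr0; have := @clsB _ _ (powmod I A^o (m - n%:Z)) (powmod I A^o (m - n%:Z + 1)) 0 0 (smod0 _) (smod0 _).
  by rewrite !subrr => <-.
have NpB m p p' : Np m p -> Np m p' -> Np m (p - p').
  move=> [b [w [hb hw ->]]] [b' [w' [hb' hw' ->]]]; exists (b - b'), (w - w').
  split; [exact: smodB|exact: smodB|]; apply: pair_ext => /=; first by rewrite FB.
  rewrite -[LHS]clsB; [|exact: pm|exact: pm].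
  by congr cls; rewrite mulrBl addrACA -opprD.
pose N m := @Subgrp (Y0 m) (Np m) (Np0 m) (NpB m).
have Nact i j m (e : i%:Z + j = m) (g : G i) (p : Y0 j) :
    N j p -> N m (gm_act e g p.1, gm_act (shift_eq (n%:Z) e) g p.2).
  move=> [b [w [hb hw ->]]]; have [c Ic ->] := hcl_surj g.
  have [mW _] := mulm _ _ _ _ w e Ic; have [_ mB] := mulm _ _ _ _ b e Ic.
  exists (c * b), (c * w); split; [exact: mB|exact: mW|].
  apply: pair_ext => /=; last first.
    rewrite [LHS](assoc_gm_actE _ Ic (pm _ _ _ hb hw)).
    by congr cls; rewrite -[LHS]/(c * (b * ak + w)) mulrDr mulrA.
  case: (pselect (exists i', i'%:Z + N0 = j)) => [[i' e1]|ne].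
    have e2 : (i + i')%N%:Z + N0 = m by rewrite PoszD -addrA e1.
    by rewrite (FE _ _ _ e1) (FE _ _ _ e2) (hactA erefl e2 e1 e) //; exact: Bi e1 hb.
  rewrite F0; last by move=> i' e1; apply: ne; exists i'.
  rewrite gm_act0r; case: (pselect (exists i', i'%:Z + N0 = m)) => [[i' e1]|ne']; last first.
    by rewrite F0 // => i' e1; apply: ne'; exists i'.
  suff b0 : b = 0 by rewrite (FE _ _ _ e1) b0 mulr0 hact0l //; exact: smod0.
  move: hb; rewrite /Bm; case E : (j - n%:Z) => [u|u] //=.
  rewrite /cideal; case: leqP => // su _; exfalso; apply: ne.
  by exists (u - (s + t))%N; rewrite /N0; lia.
(* If [b a_k^(s+t)] lies in the power ideal, so does [b a_k^s] by the choice of [s], and the power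
   ideal kills [x]; so [b x' = 0]. *)
have cons m y : N m (y, 0) -> y = 0.
  move=> [b [w [hb hw [-> /esym cl0]]]].
  case: (pselect (exists i, i%:Z + N0 = m)) => [[i e1]|ne]; last first.
    by rewrite F0 // => i e1; apply: ne; exists i.
  have Ib := Bi _ _ _ e1 hb.
  rewrite (FE _ _ _ e1).
  have Em : m - n%:Z = (i + (s + t))%N%:Z by rewrite -e1 /N0; lia.
  have := cls0P (pm _ _ _ hb hw) cl0; move: hw; rewrite /Wm Em => hw.
  rewrite -PoszD addn1 => /aE /(powideal_pow k t) hbw.
  have /Hs h : powideal k t (i + (s + t)) (b * ak).
    by rewrite -(addrK w (b * ak)); exact: smodB.
  have e3 : (i + s)%N%:Z + (n + t)%N%:Z = m by rewrite -e1 /N0; lia.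
  by rewrite /x' -(hactA erefl e3 ex' e1) //; apply: (powideal_act _ hx) (h Ib).
have [z Hz] := solve Nact Jinj cons.
exists s, z; split.
  move=> p e1 e2; have pE : (s + (n + t))%N = p by move: e2; lia.
  subst p; rewrite -(Hz _ _ e1 _ (F N0 1) (aIn k (s + t))).
    by rewrite (FE _ _ _ (add0r N0)) hact1 /x' (Prop_irrelevance ex' e2).
  exists 1, 0; split; [|exact: smod0|by rewrite mul1r addr0].
  rewrite /Bm; have -> : N0 - n%:Z = (s + t)%N%:Z by rewrite /N0; lia.
  by rewrite /cideal leqnn subnn.
move=> j jk p e; rewrite -(Hz _ _ e _ (F p%:Z 0) (aIn j t)).
  case: (pselect (exists i, i%:Z + N0 = p%:Z)) => [[i e1]|ne].
    by rewrite (FE _ _ _ e1) hact0l //; exact: smod0.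
  by rewrite F0 // => i e1; apply: ne; exists i.
exists 0, (a j ^+ t); split; [exact: smod0| |by rewrite mul0r add0r].
rewrite /Wm; have -> : p%:Z - n%:Z = t%:Z by lia.
exact: powideal_gen.
Qed.
End Injective.
End Acyclic.

(** * Koszul colimits and derived functors of torsion *)

Section Comparison.
Variables (A : comNzRingType) (I : ideal A).
Hypothesis A_noeth : noetherian A.
Variables (a : nat -> A) (r : nat).
Hypothesis aI : forall k, I (a k).
Hypothesis Ia : forall N : ideal A, (forall k, (k < r)%N -> N (a k)) -> I <=s N.
Let G := assoc_gr I.

Section GradedSets.
Variable X : grMod G.

Program Definition tfull : gset (totops aI X) r := @tset _ _ a r aI X (fun _ _ => True) _ _ _.
Next Obligation. by []. Qed.
Next Obligation. by []. Qed.
Next Obligation. by []. Qed.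

Program Definition tzero : gset (totops aI X) r := @tset _ _ a r aI X (fun _ x => x = 0) _ _ _.
Next Obligation. by []. Qed.
Next Obligation. by move=> n x y -> ->; rewrite subrr. Qed.
Next Obligation. by move=> k n x ->; rewrite hact0r. Qed.

Lemma tzeroE n x : tzero n x -> x = 0.
Proof.
move=> [x0 xn]; apply: total_ext => n'.
by case: (eqVneq n' n) => [-> //|/x0].
Qed.

Lemma tzero_full : gsle tzero tfull.
Proof. by move=> n x [x0 _]. Qed.

Lemma tfull_zero n (x : totops aI X) : tfull n x -> tv x n = 0 -> tzero n x.
Proof. by move=> [x0 _] xn. Qed.

Lemma tfull_opn k s n (x : totops aI X) p : tfull n x -> p = (n + s)%N ->
  (forall e : s%:Z + n%:Z = p%:Z, hact e (a k ^+ s) (tv x n) = 0) -> (k < r)%N ->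
  tzero p (opn k s x).
Proof.
move=> hx -> h kr; apply: tfull_zero; first exact: gsopn.
have e : s%:Z + n%:Z = (n + s)%N%:Z by rewrite -PoszD addnC.
by rewrite (tv_opn k e).
Qed.

Lemma tzero_opn k s n (x : totops aI X) p (e : s%:Z + n%:Z = p%:Z) :
  tzero p (opn k s x) -> hact e (a k ^+ s) (tv x n) = 0.
Proof. by move=> /tzeroE h; rewrite -(tv_opn k e) h. Qed.

Lemma van_injective i n : gr_injective X -> van tfull tzero r i.+1 n.
Proof.
move=> Xinj; apply: van_acyclic => //; first exact: tzero_full.
move=> k t {}n x kr hx hj.
have [|s [z [hz1 hz2]]] := injective_divides A_noeth aI Ia Xinj (k := k) (t := t) (x := tv x (n + t)).
  move=> j jk p e; have pE : p = (n + t + t)%N by lia.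
  by subst p; apply: tzero_opn; exact: hj.
have zf : tfull n (tdelta z) by exact: tset_delta.
exists s, (tdelta z); split => //.
  have ET : (n + t + s = n + (s + t))%N by lia.
  apply: tfull_zero.
    apply: gsB; last exact: gsopn.
    by rewrite ET; exact: gsopn.
  have e1 : (s + t)%N%:Z + n%:Z = (n + t + s)%N%:Z by lia.
  have e2 : s%:Z + (n + t)%N%:Z = (n + t + s)%N%:Z by lia.
  have -> : forall u v : totops aI X, tv (u - v) (n + t + s) = tv u (n + t + s) - tv v (n + t + s) by [].
  by rewrite (tv_opn k e1) (tv_opn k e2) tdelta_id (hz1 _ e1 e2) subrr.
move=> j jk; apply: (tfull_opn zf) => //; last exact: ltn_trans kr.
by move=> e; rewrite tdelta_id; exact: hz2.
Qed.
End GradedSets.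

Section Resolution.
Variables (X : grMod G) (R : gr_inj_res X).

Program Definition tcoc j : gset (totops aI (gir_ob R j)) r :=
  @tset _ _ a r aI (gir_ob R j) (fun n x => gir_d R j n x = 0) _ _ _.
Next Obligation. by move=> j n; exact: gh0. Qed.
Next Obligation. by move=> j n x y /= hx hy; rewrite ghB hx hy subrr. Qed.
Next Obligation. by move=> j k n x /= hx; rewrite gh_hact hx hact0r. Qed.

Lemma tzero_coc j : gsle (tzero (gir_ob R j)) (tcoc j).
Proof. by move=> n x [x0 xn]; split=> //; rewrite xn gh0. Qed.
Lemma tcoc_full j : gsle (tcoc j) (tfull (gir_ob R j)).
Proof. by move=> n x [x0 _]. Qed.

Definition tdiff j (x : totops aI (gir_ob R j)) : totops aI (gir_ob R j.+1) :=
  Total (fun n => gir_d R j n%:Z (tv x n)).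

(** Dimension shifting: by exactness the cocycles in the term [j + 1] of the resolution are the
    quotient of the acyclic term [j] by its cocycles. *)
Lemma van_coc_step j p n : van (tcoc j) (tzero _) r p.+2 n ->
  van (tcoc j.+1) (tzero _) r p.+1 n.
Proof.
move=> H.
have h1 : van (tfull (gir_ob R j)) (tcoc j) r p.+1 n.
  exact: van_quot (leqnn r) (@tzero_coc j) (@tcoc_full j) (van_injective (@gir_inj _ _ R j)) H.
apply: (@van_transport _ _ r (tcoc j) (tfull _) (tzero _) (tcoc j.+1) (fun=> @tdiff j)) h1 => //.
- by move=> n' x y _ _; apply: total_ext => l /=; rewrite ghB.
- by move=> k n' x _ _; apply: total_ext => -[|l] /=; rewrite ?gh0 ?gh_hact.
- move=> n' x [x0 _]; split=> [l ln /=|/=]; first by rewrite x0 ?gh0.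
  by apply/gir_exact; exists (tv x n').
- by move=> n' x [x0 dx]; split=> [l ln /=|//]; rewrite x0 ?gh0.
- by move=> n' x [x0 _] /tzeroE h; split => //; exact: (congr1 (fun y => tv y n') h).
- move=> n' y [y0 /gir_exact [x xy]]; exists (tdelta x); first exact: tset_delta.
  have -> : y - tdiff (tdelta x) = 0; last exact: gs0.
  apply: total_ext => l; change (tv y l - gir_d R j l (tv (tdelta x) l) = 0).
  case: (eqVneq l n') => [->|ln]; first by rewrite tdelta_id xy subrr.
  by rewrite y0 // tdelta_ne // gh0 subrr.
Qed.

Lemma van_coc j p n : van (tcoc 0) (tzero _) r (p + j).+1 n -> van (tcoc j) (tzero _) r p.+1 n.
Proof.
elim: j p => [|j IH] p; first by rewrite addn0.
by rewrite addnS -addSn => /IH /van_coc_step.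
Qed.
End Resolution.

Section AssociatedGraded.
Variable M : lmodType A.
Let X := assoc_gm I M.
Variable R : gr_inj_res X.
Let aIr k : (k < r)%N -> I (a k) := fun _ => aI k.

Definition taug (n : nat) (v : mulops M a) : totops aI (gir_ob R 0) :=
  tdelta (gir_aug R n%:Z (cls (powmod I M n%:Z) (powmod I M (n%:Z + 1)) v)).

Lemma van_coc0 i n : lvan (adic aIr (full_smod M)) (gshift (adic aIr (full_smod M))) i n ->
  van (tcoc R 0) (tzero _) r i n.
Proof.
have SE k : powmod I M (k%:Z + 1) = gshift (adic aIr (full_smod M)) k.
  by have -> : k%:Z + 1 = k.+1%:Z by rewrite -addn1 PoszD.
have tB (Y : grMod G) k (x y : Y k%:Z) : @tdelta _ _ Y k (x - y) = tdelta x - tdelta y.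
  apply: total_ext => l; change (tv (tdelta (x - y)) l = tv (tdelta x) l - tv (tdelta y) l).
  by case: (eqVneq l k) => [->|lk]; rewrite ?tdelta_id // !tdelta_ne // subrr.
have cls0 k v : gshift (adic aIr (full_smod M)) k v -> cls (powmod I M k%:Z) (powmod I M (k%:Z + 1)) v = 0.
  move=> hv; have hv' : powmod I M k%:Z v by apply: adic_antimono hv.
  have <- : cls (powmod I M k%:Z) (powmod I M (k%:Z + 1)) 0 = 0.
    have := @clsB _ _ (powmod I M k%:Z) (powmod I M (k%:Z + 1)) 0 0 (smod0 _) (smod0 _).
    by rewrite !subrr.
  by apply: cls_eq => //; [exact: smod0|rewrite subr0 SE].
move=> h.
apply: (@van_transport (mulops M a) _ r (gsof (gshift (adic aIr (full_smod M))))
  (gsof (adic aIr (full_smod M))) (tzero _) (tcoc R 0) taug) h => //.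
- by move=> k x y hx hy; rewrite /taug clsB // ghB tB.
- move=> k n' x kr hx; apply: total_ext => -[|l].
    by rewrite tdelta_ne.
  change (tv (taug n'.+1 (op k x)) l.+1 = hact (succ_eq l) (a k) (tv (taug n' x) l)).
  case: (eqVneq l n') => [->|ln]; last by rewrite !tdelta_ne // hact0r.
  rewrite !tdelta_id -gh_hact; congr (gir_aug R _ _).
  symmetry; apply: assoc_gm_actE => //.
  by rewrite -[a k]mulr1; exact: (mul_smodP (M := A^o) (aI k)).
- move=> n' x hx; split; first exact: tdelta_ne.
  by rewrite tdelta_id; apply/gir_exact0; exists (cls (powmod I M n'%:Z) (powmod I M (n'%:Z + 1)) x).
- move=> n' x /cls0 hx; split; first exact: tdelta_ne.
  by rewrite tdelta_id hx gh0.
- move=> n' x hx /tzeroE /(congr1 (fun y => tv y n')); rewrite tdelta_id => h.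
  have : cls (powmod I M n'%:Z) (powmod I M (n'%:Z + 1)) x = 0.
    by apply: (@gir_mono _ _ R); rewrite gh0; exact: h.
  by move=> /(cls0P hx); rewrite SE.
- move=> n' y [y0 /gir_exact0 [x xy]].
  have [v hv xE] := @clsP _ _ (powmod I M n'%:Z) (powmod I M (n'%:Z + 1)) x.
  exists v => //; have -> : y - taug n' v = 0; last exact: gs0.
  apply: total_ext => l; change (tv y l - tv (taug n' v) l = 0).
  case: (eqVneq l n') => [->|ln]; first by rewrite tdelta_id -xy xE subrr.
  by rewrite y0 // tdelta_ne // subrr.
Qed.
End AssociatedGraded.

(** A torsion cocycle [x] of positive degree equals [d y] in the resolution. The cocycles one step
    earlier have vanishing [H^1], by dimension shifting from the hypothesis, so [y] can be corrected
    by a cocycle [u] to a torsion element. *)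
Theorem lvan_loc_coh (M : lmodType A) i n :
  lvan (adic (fun k (_ : (k < r)%N) => aI k) (full_smod M))
       (gshift (adic (fun k (_ : (k < r)%N) => aI k) (full_smod M))) i n ->
  ~ loc_coh_neq0 (assoc_gm I M) i n%:Z.
Proof.
move=> H [R [x [[t xt] dx nx]]]; apply: nx.
have {H} H := van_coc0 (R := R) H.
case: i x xt dx H => [|i] x xt dx H.
  have xf : tcoc R 0 n (tdelta x) by apply: tset_delta.
  have : tzero _ n (tdelta x).
    apply: ((van0 _ _ _ _).1 H (tdelta x) t xf) => k kr.
    apply: (tfull_opn (tcoc_full xf)) => // e; rewrite tdelta_id; exact: killed_opn.
  by move=> [_]; rewrite tdelta_id.
have H1 : van (tcoc R i) (tzero _) r 1 n by apply: van_coc.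
have [y yx] := (gir_exact _).1 dx.
have yf : tfull _ n (tdelta y) by apply: tset_delta.
have [|s [u [[u0 du] hu]]] := torsion_lift (leqnn r) H1 yf (t := t).
  move=> k kr; split; first by case: (gsopn t kr yf).
  have e : t%:Z + n%:Z = (n + t)%N%:Z by rewrite -PoszD addnC.
  by rewrite (tv_opn k e) gh_hact tdelta_id yx; exact: killed_opn.
exists (y - tv u n); last by rewrite ghB yx du subr0.
apply: htors_gamma; apply: (htors_opn aI Ia (s := s)) => k kr p e.
have pE : p = (n + s)%N by lia.
subst p; have := tzero_opn e (hu k kr).
by have -> : tv (tdelta y - u) n = y - tv u n by rewrite -[y in RHS]tdelta_id.
Qed.
End Comparison.

(** * Ext and maximal Cohen-Macaulay modules *)

Section LinearMaps.
Variable A : comNzRingType.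
Implicit Types X Y Z W : lmodType A.

Lemma lin_comp X Y Z (g : {linear Y -> Z}) (f : {linear X -> Y}) :
  exists h : {linear X -> Z}, forall x, h x = g (f x).
Proof. by apply: mk_linear => c x y; rewrite !linearP. Qed.

Lemma lin_comb X Y (f g : {linear X -> Y}) (c : A) :
  exists h : {linear X -> Y}, forall x, h x = f x - c *: g x.
Proof.
apply: mk_linear => u x y; by rewrite !linearP /= addrACA -scalerDr.
Qed.

Lemma lin_sub X Y (f g : {linear X -> Y}) : exists h : {linear X -> Y}, forall x, h x = f x - g x.
Proof. by have [h hE] := lin_comb f g 1; exists h => x; rewrite hE scale1r. Qed.

Lemma lin_add X Y (f g : {linear X -> Y}) : exists h : {linear X -> Y}, forall x, h x = f x + g x.
Proof.
have [h hE] := lin_comb f g (-1); exists h => x; rewrite hE scaleN1r opprK //.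
Qed.

Lemma lin_zero X Y : exists h : {linear X -> Y}, forall x, h x = 0.
Proof. by apply: mk_linear => c x y; rewrite scaler0 addr0. Qed.

Lemma lin_row Y p (y : 'I_p -> Y) : exists h : {linear 'rV[A]_p -> Y},
  (forall v, h v = \sum_i v 0 i *: y i) /\ forall i, h (delta_mx 0 i) = y i.
Proof.
have [h hE] : exists h : {linear 'rV[A]_p -> Y}, forall v, h v = \sum_i v 0 i *: y i.
  apply: mk_linear => c u v; rewrite scaler_sumr -big_split; apply: eq_bigr => i _ /=.
  by rewrite !mxE scalerDl scalerA.
exists h; split => // i; rewrite hE (bigD1 i) //= mxE !eqxx scale1r big1 ?addr0 // => j ji.
by rewrite mxE eqxx /= (negPf ji) scale0r.
Qed.

Lemma linear_row_eq X p (f g : {linear 'rV[A]_p -> X}) :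
  (forall i, f (delta_mx 0 i) = g (delta_mx 0 i)) -> forall v, f v = g v.
Proof.
move=> h v; rewrite [v]row_sum_delta !linear_sum; apply: eq_bigr => i _.
by rewrite !linearZ h.
Qed.

Lemma row_lift X Y p (v : {linear Y -> X}) (f : {linear 'rV[A]_p -> X}) :
  (forall x, exists y, v y = x) -> exists g : {linear 'rV[A]_p -> Y}, forall z, v (g z) = f z.
Proof.
move=> /choice [s sE]; have [g [_ gE]] := lin_row (fun i => s (f (delta_mx 0 i))).
exists g; have [h hE] := lin_comp v g => z; rewrite -hE; apply: linear_row_eq => i.
by rewrite hE gE sE.
Qed.

Lemma fg_cover X : fin_gen (full_smod X) ->
  exists p (v : {linear 'rV[A]_p -> X}), forall x, exists y, v y = x.
Proof.
move=> /fin_genP [s sE]; have [h [hE _]] := lin_row (fun i : 'I_(size s) => s`_i).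
exists (size s), h => x.
have /spanE [c ->] : span [set` s] x by rewrite -sE.
by exists c; rewrite hE.
Qed.

Record ses X Y Z (u : {linear X -> Y}) (v : {linear Y -> Z}) : Prop := Ses {
  ses_inj : injective u;
  ses_surj : forall z, exists y, v y = z;
  ses_ker : forall y, v y = 0 <-> exists x, u x = y }.

Lemma lin_inj X Y (u : {linear X -> Y}) : (forall x, u x = 0 -> x = 0) -> injective u.
Proof.
move=> h x y uxy; apply/eqP; rewrite -subr_eq0; apply/eqP/h.
by rewrite linearB uxy subrr.
Qed.

Lemma lin_inj0 X Y (u : {linear X -> Y}) x : injective u -> u x = 0 -> x = 0.
Proof. by move=> ui ux; apply: ui; rewrite ux linear0. Qed.

Lemma ses_0 X Y Z (u : {linear X -> Y}) (v : {linear Y -> Z}) x : ses u v -> v (u x) = 0.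
Proof. by move=> H; apply/(ses_ker H); exists x. Qed.

Lemma ses_of_surj Y Z (v : {linear Y -> Z}) : (forall z, exists y, v y = z) ->
  exists u : {linear smod_type (ker_smod v) -> Y}, ses u v.
Proof.
move=> vs; have [u uE] := val_linear (ker_smod v); exists u; split => //.
  by move=> x y; rewrite !uE; exact: val_inj.
move=> y; split; first by move=> /(ex_sub (N := ker_smod v)) [x xE]; exists x; rewrite uE.
by move=> [x <-]; rewrite uE; exact: (smod_valP x).
Qed.

Lemma ses_quot Y (N : submodule Y) : exists u : {linear smod_type N -> Y},
  ses u (qpi N : {linear Y -> quot_mod N}).
Proof.
have [u uE] := val_linear N; exists u; split.
- by move=> x y; rewrite !uE; exact: val_inj.
- exact: qpi_surj.
- move=> y; split; first by move=> /qpi0P /ex_sub [x xE]; exists x; rewrite uE.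
  by move=> [x <-]; rewrite uE; apply/qpi0P; exact: smod_valP.
Qed.

Lemma ses_factor X Y Z W (u : {linear X -> Y}) (v : {linear Y -> Z}) (f : {linear Y -> W}) :
  ses u v -> (forall x, f (u x) = 0) -> exists g : {linear Z -> W}, forall y, g (v y) = f y.
Proof.
move=> H fu; apply: factor_surj; first exact: (ses_surj H).
by move=> y /(ses_ker H) [x <-].
Qed.

Lemma fin_gen_inj X Y (u : {linear X -> Y}) : noetherian A -> injective u ->
  fin_gen (full_smod Y) -> fin_gen (full_smod X).
Proof.
move=> An ui fY.
have fI : fin_gen (imS u (full_smod X)) by exact: fin_gen_full_sub.
have [v vE] := val_linear (imS u (full_smod X)).
have [|w wE] := @factor_inj _ _ _ _ u v ui; first by move=> y; rewrite vE; have [x _ <-] := smod_valP y; exists x.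
apply: (fin_gen_surj (f := w)); last exact: ((fin_gen_smod_type _).1 fI).
move=> x; have [|y yE] := @ex_sub _ _ (imS u (full_smod X)) (u x); first by exists x.
by exists y; apply: ui; rewrite wE vE.
Qed.

Lemma dualP X (f : dual X) : exists g : {linear X -> A^o}, forall x, g x = smod_val f x.
Proof.
apply: mk_linear => c x y; exact: (smod_valP f c x y).
Qed.

Lemma mk_dual X (f : {linear X -> A^o}) : exists g : dual X, forall x, smod_val g x = f x.
Proof.
have [|g gE] := @ex_sub _ _ (linear_smod X) (fun x => f x : A^o).
  by move=> c x y; rewrite linearP.
by exists g => x; rewrite -[RHS]/((fun x => f x : A^o) x) -gE.
Qed.

Lemma dual_ext X (f g : dual X) : (forall x, smod_val f x = smod_val g x) -> f = g.
Proof. by move=> h; apply: val_inj; apply/funext => x; exact: h. Qed.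

Lemma dualZ X (f : dual X) c x : smod_val (c *: f) x = c * smod_val f x.
Proof. by []. Qed.
Lemma dualD X (f g : dual X) x : smod_val (f + g) x = smod_val f x + smod_val g x.
Proof. by []. Qed.

Lemma dual_map X Y (f : {linear X -> Y}) : exists h : {linear dual Y -> dual X},
  forall phi x, smod_val (h phi) x = smod_val phi (f x).
Proof.
have /choice [h hE] (phi : dual Y) : exists psi : dual X, forall x, smod_val psi x = smod_val phi (f x).
  have [g gE] := dualP phi; have [k kE] := lin_comp g f; have [psi psiE] := mk_dual k.
  by exists psi => x; rewrite psiE kE gE.
have [|k kE] := @mk_linear A _ _ h; last by exists k => phi x; rewrite kE hE.
by move=> c phi psi; apply: dual_ext => x; rewrite hE !dualD !dualZ !hE.
Qed.

Lemma dual_row p : exists (f : {linear 'rV[A]_p -> dual 'rV[A]_p}) (g : {linear dual 'rV[A]_p -> 'rV[A]_p}),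
  cancel f g /\ cancel g f /\ forall (phi : dual 'rV[A]_p) (v : 'rV[A]_p), smod_val phi v = \sum_i v 0 i * g phi 0 i.
Proof.
have [g gE] : exists g : {linear dual 'rV[A]_p -> 'rV[A]_p},
    forall phi, g phi = \row_i smod_val phi (delta_mx 0 i).
  by apply: mk_linear => c x y; apply/rowP => i; rewrite !mxE.
have gP (phi : dual 'rV[A]_p) v : smod_val phi v = \sum_i v 0 i * g phi 0 i.
  have [h hE] := dualP phi; rewrite -hE [v]row_sum_delta linear_sum; apply: eq_bigr => i _.
  by rewrite -row_sum_delta linearZ /= gE mxE hE.
have gi : injective g.
  by apply: lin_inj => phi h; apply: dual_ext => v; rewrite gP h big1 // => i _; rewrite mxE mulr0.
have [|f fE] := @factor_inj A _ _ _ g (idfun : {linear 'rV[A]_p -> 'rV[A]_p}) gi.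
  move=> w; have [h [_ hE]] := lin_row (fun i => w 0 i : A^o); have [phi phiE] := mk_dual h.
  by exists phi; rewrite gE; apply/rowP => i; rewrite mxE phiE hE.
exists f, g; split; last split => //; first by move=> w; rewrite fE.
by move=> phi; apply: gi; rewrite fE.
Qed.

End LinearMaps.

(** * Vanishing of Ext into A through a finite injective resolution *)

Section Ext.
Variables (A : comNzRingType) (m : ideal A).
Hypotheses (A_noeth : noetherian A) (A_local : local_ring m).
Variables (J : nat -> lmodType A) (e : {linear A^o -> J 0})
  (dJ : forall i, {linear J i -> J i.+1}) (n0 : nat).
Hypotheses (J_inj : forall i, injective_module (J i))
  (J_zero : forall i, (n0 < i)%N -> is_zero (J i)) (e_inj : injective e)
  (J_exact0 : smod_eq (ker_smod (dJ 0)) (im_smod e))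
  (J_exact : forall i, smod_eq (ker_smod (dJ i.+1)) (im_smod (dJ i))).
Implicit Types X Y Z : lmodType A.

Let d0e x : dJ 0 (e x) = 0.
Proof. by apply/J_exact0; exists x. Qed.
Let dd i x : dJ i.+1 (dJ i x) = 0.
Proof. by apply/J_exact; exists x. Qed.

(* Ext^(j+1)(X, A) = 0 *)
Definition noext j X := forall f : {linear X -> J j.+1}, (forall x, dJ j.+1 (f x) = 0) ->
  exists g : {linear X -> J j}, forall x, dJ j (g x) = f x.

Lemma noext_big j X : (n0 <= j)%N -> noext j X.
Proof.
move=> nj f _; have [g gE] := lin_zero X (J j); exists g => x.
by rewrite gE linear0; symmetry; exact: J_zero.
Qed.

Section Sequence.
Variables (X Y Z : lmodType A) (u : {linear X -> Y}) (v : {linear Y -> Z}).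
Hypothesis uv : ses u v.
Let ui := ses_inj uv.

Lemma noext_mid j : noext j X -> noext j Z -> noext j Y.
Proof.
move=> hX hZ f df; have [fu fuE] := lin_comp f u.
have [|g1 g1E] := hX fu; first by move=> x; rewrite fuE.
have [g gE] := J_inj g1 ui.
have [dg dgE] := lin_comp (dJ j) g; have [h hE] := lin_sub f dg.
have [|k kE] := ses_factor uv (f := h).
  by move=> x; rewrite hE dgE gE g1E fuE subrr.
have [|l lE] := hZ k.
  by move=> z; have [y <-] := ses_surj uv z; rewrite kE hE linearB df dgE dd subrr.
have [lv lvE] := lin_comp l v; have [w wE] := lin_add g lv; exists w => y.
by rewrite wE lvE linearD lE kE hE dgE addrC subrK.
Qed.

Lemma noext_sub j : noext j Y -> noext j.+1 Z -> noext j X.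
Proof.
move=> hY hZ f df; have [g gE] := J_inj f ui.
have [dg dgE] := lin_comp (dJ j.+1) g.
have [|h hE] := ses_factor uv (f := dg); first by move=> x; rewrite dgE gE df.
have [|k kE] := hZ h.
  by move=> z; have [y <-] := ses_surj uv z; rewrite hE dgE dd.
have [kv kvE] := lin_comp k v; have [w wE] := lin_sub g kv.
have [|l lE] := hY w; first by move=> y; rewrite wE linearB kvE kE hE dgE subrr.
have [lu luE] := lin_comp l u; exists lu => x.
by rewrite luE lE wE kvE (ses_0 _ uv) linear0 subr0 gE.
Qed.

Lemma noext_quot j : noext j X -> noext j.+1 Y -> noext j.+1 Z.
Proof.
move=> hX hY f df; have [fv fvE] := lin_comp f v.
have [|g gE] := hY fv; first by move=> y; rewrite fvE.
have [gu guE] := lin_comp g u.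
have [|k kE] := hX gu; first by move=> x; rewrite guE gE fvE (ses_0 _ uv) linear0.
have [l lE] := J_inj k ui; have [dl dlE] := lin_comp (dJ j) l; have [w wE] := lin_sub g dl.
have [|h hE] := ses_factor uv (f := w); first by move=> x; rewrite wE dlE lE kE guE subrr.
exists h => z; have [y <-] := ses_surj uv z.
by rewrite hE wE linearB dlE dd subr0 gE fvE.
Qed.

Lemma hom_extend (phi : {linear X -> A^o}) : noext 0 Z ->
  exists psi : {linear Y -> A^o}, forall x, psi (u x) = phi x.
Proof.
move=> hZ; have [ephi ephiE] := lin_comp e phi; have [g gE] := J_inj ephi ui.
have [dg dgE] := lin_comp (dJ 0) g.
have [|h hE] := ses_factor uv (f := dg); first by move=> x; rewrite dgE gE ephiE d0e.
have [|k kE] := hZ h.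
  by move=> z; have [y <-] := ses_surj uv z; rewrite hE dgE dd.
have [kv kvE] := lin_comp k v; have [w wE] := lin_sub g kv.
have [|psi psiE] := factor_inj (f := w) e_inj.
  by move=> y; apply/J_exact0 => /=; rewrite wE linearB kvE kE hE dgE subrr.
exists psi => x; apply: e_inj; rewrite psiE wE gE ephiE kvE (ses_0 _ uv) linear0 subr0 //.
Qed.

Lemma noext0_quot : noext 0 Y ->
  (forall phi : {linear X -> A^o}, exists psi : {linear Y -> A^o}, forall x, psi (u x) = phi x) ->
  noext 0 Z.
Proof.
move=> hY hX f df; have [fv fvE] := lin_comp f v.
have [|g gE] := hY fv; first by move=> y; rewrite fvE.
have [gu guE] := lin_comp g u.
have [|phi phiE] := factor_inj (f := gu) e_inj.
  by move=> x; apply/J_exact0 => /=; rewrite guE gE fvE (ses_0 _ uv) linear0.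
have [psi psiE] := hX phi; have [epsi epsiE] := lin_comp e psi; have [w wE] := lin_sub g epsi.
have [|h hE] := ses_factor uv (f := w).
  by move=> x; rewrite wE epsiE psiE phiE guE subrr.
exists h => z; have [y <-] := ses_surj uv z.
by rewrite hE wE linearB epsiE d0e subr0 gE fvE.
Qed.
End Sequence.

Lemma noext_iso j X Y (f : {linear X -> Y}) (g : {linear Y -> X}) : cancel g f ->
  noext j X -> noext j Y.
Proof.
move=> gf hX h dh; have [hf hfE] := lin_comp h f.
have [|k kE] := hX hf; first by move=> x; rewrite hfE.
by have [kg kgE] := lin_comp k g; exists kg => y; rewrite kgE kE hfE gf.
Qed.

Lemma noext_row j p : noext j 'rV[A]_p.
Proof.
move=> f df.
have /choice [y yE] (i : 'I_p) : exists y, dJ j y = f (delta_mx 0 i).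
  by have /J_exact [y yE] : ker_smod (dJ j.+1) (f (delta_mx 0 i)); [exact: df|exists y].
have [g [_ gE]] := lin_row y; exists g => v.
have [h hE] := lin_comp (dJ j) g; rewrite -hE; apply: (linear_row_eq (f := h) (g := f)) => i.
by rewrite hE gE yE.
Qed.

Lemma noext_zero j X : is_zero X -> noext j X.
Proof.
move=> X0 f _; have [g gE] := lin_zero X (J j); exists g => x.
by rewrite (X0 x) !linear0.
Qed.

Lemma fin_gen_dual X : fin_gen (full_smod X) -> fin_gen (full_smod (dual X)).
Proof.
move=> /fg_cover [p [v vs]]; have [w wE] := dual_map v.
have [f [g [fg [gf _]]]] := dual_row A p; have [h hE] := lin_comp g w.
apply: (fin_gen_inj A_noeth (u := h)); last first.
  exists p, (fun i => delta_mx 0 i : 'rV[A]_p) => x; split=> // _.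
  by rewrite [x]row_sum_delta; apply: smod_sum => i; apply: smodZ; apply: span_mem; exists i.
move=> phi psi; rewrite !hE => /(can_inj gf) E; apply: dual_ext => x.
by have [y <-] := vs x; rewrite -!wE E.
Qed.

(** Nakayama's lemma for the cokernel of the restriction [Y^* -> X^*], a quotient of the finitely
    generated module [X^*]. *)
Lemma hom_nakayama X Y (u : {linear X -> Y}) (x0 : A) : m x0 -> fin_gen (full_smod X) ->
  (forall phi : {linear X -> A^o}, exists (phi' : {linear X -> A^o}) (psi : {linear Y -> A^o}),
     forall x, phi x = x0 * phi' x + psi (u x)) ->
  forall phi : {linear X -> A^o}, exists psi : {linear Y -> A^o}, forall x, psi (u x) = phi x.
Proof.
move=> mx0 fgX H phi; have [w wE] := dual_map u.
have [phid phidE] := mk_dual phi.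
have : full_smod (dual X) <=s imS w (full_smod (dual Y)).
  apply: (nakayama A_noeth A_local); first exact: fin_gen_dual.
  move=> ph _; have [f fE] := dualP ph; have [f' [g E]] := H f.
  have [f'd f'dE] := mk_dual f'; have [gd gdE] := mk_dual g.
  exists (w gd), (x0 *: f'd); split; [by exists gd|exact: mul_smodP|].
  apply: dual_ext => x; rewrite -fE E dualD dualZ f'dE wE gdE addrC //.
move=> /(_ phid Logic.I) [psid _ psidE]; have [psi psiE] := dualP psid.
by exists psi => x; rewrite psiE -wE psidE phidE.
Qed.

(** Ext vanishes when multiplication by [x0] is onto on it. Instead of forming Ext as a finitely
    generated module, one passes to syzygies until the claim concerns restriction of linear
    forms. *)
Lemma ext_nakayama (x0 : A) j X : m x0 -> fin_gen (full_smod X) ->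
  (forall f : {linear X -> J j.+1}, (forall x, dJ j.+1 (f x) = 0) ->
    exists (f' : {linear X -> J j.+1}) (g : {linear X -> J j}),
    (forall x, dJ j.+1 (f' x) = 0) /\ forall x, f x = x0 *: f' x + dJ j (g x)) ->
  noext j X.
Proof.
move=> mx0; elim: j X => [|j IH] X fgX H.
  have [p [v vs]] := fg_cover fgX; have [u uv] := ses_of_surj vs; have ui := ses_inj uv.
  have fgK : fin_gen (full_smod (smod_type (ker_smod v))).
    by apply: fin_gen_inj ui _ => //; apply: (fin_gen_row A p).
  apply: (noext0_quot uv (@noext_row _ _)); apply: (hom_nakayama mx0) => // phi.
  have [ephi ephiE] := lin_comp e phi; have [g gE] := J_inj ephi ui.
  have [dg dgE] := lin_comp (dJ 0) g.
  have [|f fE] := ses_factor uv (f := dg); first by move=> x; rewrite dgE gE ephiE d0e.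
  have [|f' [g1 [df' E]]] := H f.
    by move=> z; have [y <-] := vs z; rewrite fE dgE dd.
  have [fv fvE] := lin_comp f' v.
  have [|g2 g2E] := @noext_row 0%N p fv; first by move=> y; rewrite fvE.
  have [g2u g2uE] := lin_comp g2 u.
  have [|phi' phi'E] := factor_inj (f := g2u) e_inj.
    by move=> x; apply/J_exact0 => /=; rewrite g2uE g2E fvE (ses_0 _ uv) linear0.
  have [g1v g1vE] := lin_comp g1 v; have [w1 w1E] := lin_comb g g2 x0; have [w wE] := lin_sub w1 g1v.
  have [|psi psiE] := factor_inj (f := w) e_inj.
    move=> y; apply/J_exact0 => /=; rewrite wE w1E !linearB linearZ g2E g1vE fvE.
    by rewrite -addrA -opprD -E fE dgE subrr.
  exists phi', psi => x; apply: e_inj.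
  rewrite linearD -[x0 * _]/(x0 *: (_ : A^o)) linearZ phi'E psiE g2uE wE w1E g1vE (ses_0 _ uv).
  by rewrite linear0 subr0 gE ephiE addrC subrK.
have [p [v vs]] := fg_cover fgX; have [u uv] := ses_of_surj vs; have ui := ses_inj uv.
have fgK : fin_gen (full_smod (smod_type (ker_smod v))).
  by apply: fin_gen_inj ui _ => //; apply: (fin_gen_row A p).
apply: (noext_quot uv _ (@noext_row _ _)); apply: IH => // h dh.
have [g gE] := J_inj h ui.
have [dg dgE] := lin_comp (dJ j.+1) g.
have [|f fE] := ses_factor uv (f := dg); first by move=> x; rewrite dgE gE dh.
have [|f' [g1 [df' E]]] := H f.
  by move=> z; have [y <-] := vs z; rewrite fE dgE dd.
have [fv fvE] := lin_comp f' v.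
have [|g2 g2E] := @noext_row j.+1 p fv; first by move=> y; rewrite fvE.
have [g2u g2uE] := lin_comp g2 u.
have [g1v g1vE] := lin_comp g1 v; have [w1 w1E] := lin_comb g g2 x0; have [w wE] := lin_sub w1 g1v.
have [|g3 g3E] := @noext_row j p w.
  move=> y; rewrite wE w1E !linearB linearZ g2E g1vE fvE.
  by rewrite -addrA -opprD -E fE dgE subrr.
have [g3u g3uE] := lin_comp g3 u; exists g2u, g3u; split.
  by move=> x; rewrite g2uE g2E fvE (ses_0 _ uv) linear0.
move=> x; rewrite g2uE g3uE g3E wE w1E g1vE (ses_0 _ uv) linear0 subr0 gE.
by rewrite addrC subrK.
Qed.

Section Regular.
Variables (x0 : A) (Y Y' : lmodType A) (w : {linear Y -> Y'}).
Hypotheses (mx0 : m x0) (fgY : fin_gen (full_smod Y)).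
Hypothesis x0_reg : forall y : Y, x0 *: y = 0 -> y = 0.
Hypothesis w_surj : forall z, exists y, w y = z.
Hypothesis w_ker : forall y, w y = 0 <-> exists x, y = x0 *: x.

Let mul_ses : exists u : {linear Y -> Y}, (forall y, u y = x0 *: y) /\ ses u w.
Proof.
have [u uE] := ex_mulmap Y x0; exists u; split => //; split => //.
- by apply: lin_inj => x; rewrite uE; exact: x0_reg.
- by move=> y; rewrite w_ker; split=> -[x xE]; exists x; rewrite uE in xE *.
Qed.

(** The sequence [0 -> Y -> Y -> Y' -> 0] given by [x0] makes [x0] act surjectively on
    [Ext^(j+1)(Y, A)] as soon as [Ext^(j+2)(Y', A)] vanishes. *)
Lemma noext_regular j : noext j.+1 Y' -> noext j Y.
Proof.
move=> hY'; have [u [uE uv]] := mul_ses; apply: (ext_nakayama mx0) => // f df.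
have [g gE] := J_inj f (ses_inj uv).
have [dg dgE] := lin_comp (dJ j.+1) g.
have [|h hE] := ses_factor uv (f := dg); first by move=> x; rewrite dgE gE df.
have [|k kE] := hY' h.
  by move=> z; have [y <-] := w_surj z; rewrite hE dgE dd.
have [kw kwE] := lin_comp k w; have [f' f'E] := lin_sub g kw.
have [z zE] := lin_zero Y (J j); exists f', z; split.
  by move=> y; rewrite f'E linearB kwE kE hE dgE subrr.
move=> x; rewrite zE linear0 addr0 -linearZ -uE f'E gE kwE (ses_0 _ uv) linear0 subr0 //.
Qed.

(** Every linear form on [Y] is divisible by [x0]; [hom_nakayama] is applied to a zero map, so that
    the forms obtained by restriction are 0. *)
Lemma noext_hom_regular : noext 0 Y' -> forall (phi : {linear Y -> A^o}) y, phi y = 0.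
Proof.
move=> hY' phi y; have [u [uE uv]] := mul_ses.
have [u0 u0E] := lin_zero Y A^o.
have [|psi psiE] := hom_nakayama (u := u0) mx0 fgY _ phi.
  move=> f; have [psi psiE] := hom_extend uv f hY'.
  have [z zE] := lin_zero A^o A^o; exists psi, z => x.
  by rewrite zE addr0 -psiE uE linearZ.
by rewrite -psiE u0E linear0.
Qed.
End Regular.

(* These are the maximal Cohen-Macaulay modules (MCM_totrefl). *)
Definition totrefl X := fin_gen (full_smod X) /\ forall j, noext j X.

Lemma totrefl_ker X Y Z (u : {linear X -> Y}) (v : {linear Y -> Z}) : ses u v ->
  fin_gen (full_smod Y) -> (forall j, noext j Y) -> totrefl Z -> totrefl X.
Proof.
move=> uv fgY hY [_ hZ]; split; first exact: fin_gen_inj (ses_inj uv) fgY.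
by move=> j; apply: (noext_sub uv).
Qed.

Lemma dual_ses X Y Z (u : {linear X -> Y}) (v : {linear Y -> Z}) : ses u v -> noext 0 Z ->
  exists (v' : {linear dual Z -> dual Y}) (u' : {linear dual Y -> dual X}),
  [/\ ses v' u', forall phi y, smod_val (v' phi) y = smod_val phi (v y)
    & forall phi x, smod_val (u' phi) x = smod_val phi (u x)].
Proof.
move=> uv hZ; have [v' v'E] := dual_map v; have [u' u'E] := dual_map u.
exists v', u'; split => //; split.
- move=> phi psi E; apply: dual_ext => z; have [y <-] := ses_surj uv z.
  by rewrite -!v'E E.
- move=> phi; have [f fE] := dualP phi; have [psi psiE] := hom_extend uv f hZ.
  have [psid psidE] := mk_dual psi; exists psid; apply: dual_ext => x.
  by rewrite u'E psidE psiE fE.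
- move=> phi; split=> [h|[psi <-]]; last first.
    apply: dual_ext => x; rewrite u'E v'E (ses_0 _ uv).
    by have [f fE] := dualP psi; rewrite -fE linear0.
  have [f fE] := dualP phi; have [|g gE] := ses_factor uv (f := f).
    by move=> x; rewrite fE -u'E h.
  have [gd gdE] := mk_dual g; exists gd; apply: dual_ext => y.
  by rewrite v'E gdE gE fE.
Qed.

Lemma noext_dual_row j p : noext j (dual 'rV[A]_p).
Proof.
by have [f [g [fg [gf _]]]] := dual_row A p; apply: noext_iso gf (@noext_row _ _).
Qed.

(** Dualizing a presentation embeds [X^*] in a free module with cokernel the dual of the syzygy. So
    [Ext^(j+1)] reduces to [Ext^(j+2)] of another dual, and in the end to [noext_big]. *)
Lemma totrefl_dual X : totrefl X -> totrefl (dual X).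
Proof.
move=> tX; split; first exact: (fin_gen_dual tX.1).
suff H N j Y : (n0 <= j + N)%N -> totrefl Y -> noext j (dual Y) by move=> j; apply: (H n0 j) => //; exact: leq_addl.
elim: N j Y => [|N IH] j Y nj tY; first by rewrite addn0 in nj; exact: noext_big.
have [p [v vs]] := fg_cover tY.1; have [u uv] := ses_of_surj vs.
have tK : totrefl (smod_type (ker_smod v)).
  by apply: totrefl_ker uv _ _ tY; [exact: (fin_gen_row A p)|move=> i; exact: noext_row].
have [v' [u' [uv' _ _]]] := dual_ses uv (tY.2 0%N).
by apply: (noext_sub uv'); [exact: noext_dual_row|apply: IH => //; rewrite addSnnS].
Qed.

(** [X^*] embeds in the dual of a free module with cokernel [K^*], whose first Ext vanishes. So
    [theta] extends to a functional there, and that is evaluation at a vector. *)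
Lemma dual_eval X (theta : {linear dual X -> A^o}) : totrefl X ->
  exists x, forall phi, theta phi = smod_val phi x.
Proof.
move=> tX.
have [p [v vs]] := fg_cover tX.1; have [u uv] := ses_of_surj vs.
have tK : totrefl (smod_type (ker_smod v)).
  by apply: totrefl_ker uv _ _ tX; [exact: (fin_gen_row A p)|move=> i; exact: noext_row].
have [v' [u' [uv' v'E _]]] := dual_ses uv (tX.2 0%N).
have [theta' E] := hom_extend uv' theta ((totrefl_dual tK).2 0%N).
have [f [g [fg [gf gE]]]] := dual_row A p; have [h hE] := lin_comp theta' f.
exists (v (\row_i h (delta_mx 0 i))) => phi.
rewrite -E -[v' phi]gf -hE -v'E [in RHS]gE.
rewrite [in LHS](row_sum_delta (g (v' phi))) linear_sum; apply: eq_bigr => i _.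
by rewrite linearZ mxE mulrC.
Qed.

(** Evaluation at a lift [w] of [x] vanishes on [X^*], so it comes from a functional on [K^*]. By
    [dual_eval] this is evaluation at a point of the syzygy [K], which forces [w] into [K]. *)
Lemma torsionless X (x : X) : totrefl X -> (forall phi : dual X, smod_val phi x = 0) -> x = 0.
Proof.
move=> tX hx.
have [p [v vs]] := fg_cover tX.1; have [u uv] := ses_of_surj vs.
have tK : totrefl (smod_type (ker_smod v)).
  by apply: totrefl_ker uv _ _ tX; [exact: (fin_gen_row A p)|move=> i; exact: noext_row].
have [v' [u' [uv' v'E u'E]]] := dual_ses uv (tX.2 0%N).
have [w wx] := vs x.
have [evw evwE] : exists f : {linear dual 'rV[A]_p -> A^o}, forall phi, f phi = smod_val phi w.
  by apply: mk_linear.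
have [|theta thetaE] := ses_factor uv' (f := evw); first by move=> phi; rewrite evwE v'E wx.
have [y yE] := dual_eval theta tK.
suff wy : w = u y by rewrite -wx wy (ses_0 _ uv).
have [f [g [fg [gf gE]]]] := dual_row A p; apply/rowP => i.
have := yE (u' (f (delta_mx 0 i))); rewrite thetaE evwE u'E !gE fg => E.
have S (z : 'rV[A]_p) : \sum_l z 0 l * (delta_mx 0 i : 'rV[A]_p) 0 l = z 0 i.
  rewrite (bigD1 i) //= mxE !eqxx mulr1 big1 ?addr0 // => l li.
  by rewrite mxE (negPf li) andbF mulr0.
by rewrite -S E S.
Qed.
End Ext.

(** * Maximal annihilators and zero divisors *)

Section Annihilators.
Variables (A : comNzRingType) (V : lmodType A).
Hypothesis A_noeth : noetherian A.

Program Definition annS (N : submodule V) (y : V) : ideal A :=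
  @Submodule A A^o (fun a => N ((a : A) *: y)) _ _.
Next Obligation. by move=> N y /=; rewrite scale0r; exact: smod0. Qed.
Next Obligation.
move=> N y c a b /= Na Nb; rewrite scalerDl -[c *: a]/(c * a) -scalerA; exact: smodP.
Qed.

Definition max_ann (N : submodule V) y := ~ N y /\
  forall y', ~ N y' -> annS N y <=s annS N y' -> annS N y' <=s annS N y.

Lemma ex_max_ann (N : submodule V) z : ~ N z -> exists2 y, max_ann N y & annS N z <=s annS N y.
Proof.
move=> Nz.
have Pz : exists2 y, ~ N y & annS N z = annS N y by exists z.
have fgA : fin_gen (full_smod A^o) by exact: A_noeth.
have [P [zP _ [y Ny PE] Pmax]] := max_submodule A_noeth (T := full_smod A^o)
  (P := fun P => exists2 y, ~ N y & P = annS N y) fgA Pz (fun _ _ => Logic.I).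
exists y; last by rewrite -PE.
by split=> // y' Ny' h; rewrite -PE; apply: Pmax => //; [rewrite PE|exists y'].
Qed.

Lemma max_ann_prime (N : submodule V) y : max_ann N y -> prime_ideal (annS N y).
Proof.
move=> [Ny ymax]; split; first by rewrite /proper_smod /= scale1r.
move=> a b /= Nab; case: (pselect (N (b *: y))) => Nb; [by right|left].
apply: (ymax (b *: y)) => //; last by rewrite /= scalerA.
by move=> c /= Nc; rewrite scalerA mulrC -scalerA; exact: smodZ.
Qed.

(** Prime avoidance for maximal annihilators, which are comparable only when equal; this provides a
    multiplier [z] in all the others but outside the new prime. *)
Lemma prime_avoid (J : ideal A) (N : submodule V) (s : seq V) :
  (forall y, y \in s -> max_ann N y /\ exists2 j, J j & ~ annS N y j) ->
  exists2 x, J x & forall y, y \in s -> ~ annS N y x.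
Proof.
elim: s => [|y s IH] H; first by exists 0; [exact: smod0|].
have [y' ys|x Jx xs] := IH; first by apply: H; rewrite inE ys orbT.
have [[Ny ymax] [j Jj jy]] := H y (mem_head _ _).
case: (pselect (annS N y x)) => [yx|nyx]; last first.
  by exists x => // y'; rewrite inE => /orP [/eqP ->|/xs].
have [_ yprime] := max_ann_prime (conj Ny ymax).
have [z [zy zs]] : exists z, ~ annS N y z /\ forall y', y' \in s -> annS N y' z.
  have : forall y', y' \in s -> exists2 z, annS N y' z & ~ annS N y z.
    move=> y' ys; apply: contrapT => h.
    have sub : annS N y' <=s annS N y by move=> c hc; apply: contrapT => nc; apply: h; exists c.
    have [[_ ymax'] _] := H y' (mem_behead (s := y :: s) ys).
    by apply: (xs _ ys); exact: (ymax' y Ny sub _ yx).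
  elim: (s) => [|y1 s1 IHs] hs.
    by exists 1; split => //=; rewrite scale1r.
  have [z1 hz1 nz1] := hs y1 (mem_head _ _).
  have [y' ys|z [nz hz]] := IHs; first by apply: hs; rewrite inE ys orbT.
  exists (z1 * z); split; first by case/yprime.
  move=> y'; rewrite inE => /orP [/eqP ->|/hz]; last exact: ideal_mul.
  by rewrite mulrC; exact: ideal_mul.
exists (x + j * z); first by apply: smodD => //; rewrite mulrC; exact: ideal_mul.
move=> y'; rewrite inE => /orP [/eqP ->|ys] h.
  have : annS N y (j * z) by rewrite -(addKr x (j * z)) addrC; apply: smodB.
  by case/yprime.
apply: (xs _ ys); rewrite -(addrK (j * z) x); apply: smodB => //.
by apply: ideal_mul; exact: zs.
Qed.

Lemma zero_divisors (J : ideal A) (N : submodule V) : fin_gen (full_smod V) ->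
  (exists y, ~ N y) ->
  (forall x : A, J x -> exists2 y, ~ N y & N (x *: y)) ->
  exists2 y, ~ N y & forall x : A, J x -> N (x *: y).
Proof.
move=> fgV [y0 Ny0] H.
pose P (T : submodule V) := exists2 s : seq V, (forall y, y \in s -> max_ann N y) & T = span [set` s].
have P0 : P (botS V).
  by exists [::] => //; apply: smod_ext => x; [move=> ->; exact: smod0|move=> /span_nilP].
(* Some finite list [s] spans all [y] with maximal annihilator. Such an annihilator contains the
   intersection of those of [s]; being prime it contains one, and then equals it. So avoiding those
   of [s] avoids all. *)
have [T [_ _ [s hs TE] Tmax]] := max_submodule A_noeth (T := full_smod V) (P := P) fgV P0 (fun _ _ => Logic.I).
have gen y : max_ann N y -> span [set` s] y.
  move=> hy; rewrite -TE; apply: (Tmax (span [set` y :: s])) => //.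
  - by rewrite TE; apply: span_monos => z zs; rewrite inE zs orbT.
  - exists (y :: s) => // z; rewrite inE => /orP [/eqP ->|/hs] //.
  - by apply: span_mems; rewrite mem_head.
apply: contrapT => no.
have [|x Jx xs] := @prime_avoid J N s.
  move=> y /hs hy; split => //; apply: contrapT => h; apply: no; exists y; first by case: hy.
  by move=> x Jx; apply: contrapT => nx; apply: h; exists x.
have [z Nz xz] := H x Jx; have [y hy zy] := ex_max_ann Nz.
have xy : annS N y x by exact: zy.
have [Ny ymax] := hy; have [y1prop yprime] := max_ann_prime hy.
have : forall s' : seq V, {subset s' <= s} -> span [set` s'] y ->
    exists2 y', y' \in s' & annS N y' <=s annS N y.
  move=> s' ss /spanE [c yE]; apply: contrapT => h.
  have [b [nb hb]] : exists b, ~ annS N y b /\ forall y', y' \in s' -> annS N y' b.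
    have : forall y', y' \in s' -> exists2 b, annS N y' b & ~ annS N y b.
      move=> y' ys; apply: contrapT => h'; apply: h; exists y' => // b hb.
      by apply: contrapT => nb; apply: h'; exists b.
    elim: (s') => [|y1 s1 IHs] hs1; first by exists 1; split => //=; rewrite scale1r.
    have [z1 hz1 nz1] := hs1 y1 (mem_head _ _).
    have [y' ys|b [nb hb]] := IHs; first by apply: hs1; rewrite inE ys orbT.
    exists (z1 * b); split; first by case/yprime.
    move=> y'; rewrite inE => /orP [/eqP ->|/hb]; last exact: ideal_mul.
    by rewrite mulrC; exact: ideal_mul.
  apply: nb; rewrite /= yE scaler_sumr; apply: smod_sum => i.
  rewrite scalerA mulrC -scalerA; apply: smodZ; apply: hb; exact: mem_nth.
move=> /(_ s (fun _ h => h) (gen _ hy)) [y' ys sub].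
by apply: (xs _ ys); have [_ ymax'] := hs _ ys; apply: ymax' sub _ xy.
Qed.
End Annihilators.

(** * Regular sequences and chains of primes *)

Section RegularSequences.
Variables (A : comNzRingType) (m : ideal A).
Hypotheses (A_noeth : noetherian A) (A_local : local_ring m).
Implicit Types V X Y : lmodType A.

Definition seqM V (x : nat -> A) i : submodule V :=
  mul_smod (span [set a : A^o | exists2 j, (j < i)%N & a = x j]) (full_smod V).

Lemma seqM0 V x : seqM V x 0 = botS V.
Proof.
apply: smod_ext; last by move=> y ->; exact: smod0.
apply: mul_smod_ind => a y ha _.
have : span [set a : A^o | exists2 j, (j < 0)%N & a = x j] <=s botS A^o by apply: span_le => b [].
by move=> /(_ _ ha) ->; exact: scale0r.
Qed.

Lemma seqMS V x i : seqM V x i.+1 = addS (seqM V x i) (scaleS (x i) (full_smod V)).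
Proof.
apply: smod_ext.
  apply: mul_smod_ind => a y ha _.
  have : span [set a : A^o | exists2 j, (j < i.+1)%N & a = x j] <=s
      colon_ideal (lineS y) (addS (seqM V x i) (scaleS (x i) (full_smod V))).
    apply: span_le => _ [j + ->] _ [c ->]; rewrite ltnS leq_eqVlt => /orP [/eqP ->|ji].
      by apply: addSr; exists (c *: y) => //; rewrite scalerA.
    apply: addSl; apply: mul_smodP => //; apply: span_mem; by exists j.
  by move=> /(_ _ ha y); apply; exists 1; rewrite scale1r.
apply: addS_le.
  by apply: mul_smod_mono => //; apply: span_mono => _ [j ji ->]; exists j => //; exact: ltnW.
by move=> _ [y _ ->]; apply: mul_smodP => //; apply: span_mem; exists i.
Qed.

Lemma seqM_m V x i : (forall j, (j < i)%N -> m (x j)) -> seqM V x i <=s mul_smod m (full_smod V).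
Proof.
by move=> mx; apply: mul_smod_mono => //; apply: span_le => _ [j ji ->]; exact: mx.
Qed.

Lemma seqM_proper V x i : (forall j, (j < i)%N -> m (x j)) -> fin_gen (full_smod V) ->
  ~ is_zero V -> exists y, ~ seqM V x i y.
Proof.
move=> mx fgV nz; apply: contrapT => h; apply: nz; apply: (nakayama0 A_noeth A_local fgV) => y.
by apply: (seqM_m mx); apply: contrapT => ny; apply: h; exists y.
Qed.

(** Given a prime [p] annihilating some [y] modulo the first [i] elements, consider all elements
    killed by [p]. By Nakayama one of them survives modulo [x i] as well. Its annihilator contains
    [p] and [x i], while regularity keeps [x i] out of [p]. *)
Lemma regular_chain V (x : nat -> A) n : fin_gen (full_smod V) ->
  (forall i, (i < n)%N -> m (x i)) ->
  (forall i, (i < n)%N -> forall y : V, seqM V x i (x i *: y) -> seqM V x i y) ->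
  ~ is_zero V -> has_chain (@prime_ideal A) n.
Proof.
move=> fgV mx reg nz.
suff main k i y : (i + k = n)%N -> ~ seqM V x i y -> prime_ideal (annS (seqM V x i) y) ->
    exists N : nat -> ideal A, [/\ N 0 = annS (seqM V x i) y,
      forall j, (j <= k)%N -> prime_ideal (N j) & forall j, (j < k)%N -> smod_lt (N j) (N j.+1)].
  have [y ny] := @seqM_proper V x 0 (fun j => ltac:(by [])) fgV nz.
  have [z zmax _] := ex_max_ann A_noeth ny.
  have [N [_ h1 h2]] := main n 0%N z (add0n n) zmax.1 (max_ann_prime zmax).
  by exists N.
elim: k i y => [|k IH] i y ik ny yp; first by exists (fun=> annS (seqM V x i) y).
have lt_in : (i < n)%N by rewrite -ik addnS ltnS leq_addr.
pose p := annS (seqM V x i) y.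
pose S0 (z : V) := forall a : A, p a -> seqM V x i (a *: z).
have S00 : S0 0 by move=> a _; rewrite scaler0; exact: smod0.
have S0P c z w : S0 z -> S0 w -> S0 (c *: z + w).
  move=> hz hw a pa; rewrite scalerDr scalerA mulrC -scalerA; apply: smodP; [exact: hz|exact: hw].
pose S := Submodule S00 S0P.
have [z Sz nz1] : exists2 z, S z & ~ seqM V x i.+1 z.
  apply: contrapT => h; apply: ny.
  have : S <=s seqM V x i.
    apply: (nakayama A_noeth A_local); first exact: fin_gen_full_sub.
    move=> z Sz; have : seqM V x i.+1 z by apply: contrapT => nz1; apply: h; exists z.
    rewrite seqMS => -[u [_ [hu [w _ ->] zE]]]; rewrite zE.
    apply: smodD; first exact: addSl.
    apply: addSr; apply: mul_smodP; first exact: mx.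
    move=> a pa; apply: (reg i lt_in); rewrite scalerA mulrC -scalerA.
    have -> : x i *: w = z - u by rewrite zE addrC addKr.
    by rewrite scalerBr; apply: smodB; [exact: Sz|exact: smodZ].
  by apply=> a pa.
have [y' y'max zy'] := ex_max_ann A_noeth nz1.
have [|N [N0 h1 h2]] := IH i.+1 y' _ y'max.1 (max_ann_prime y'max); first by rewrite addSnnS.
exists (fun j => if j is j'.+1 then N j' else p); split => //; first by case=> [|j] //; exact: h1.
case=> [_|j]; last exact: h2.
rewrite N0; split.
    by move=> a pa; apply: zy'; rewrite /annS seqMS; apply: addSl; exact: Sz.
  move=> /(_ (x i)) h; apply: ny; apply: (reg i lt_in); apply: h.
  change (seqM V x i.+1 (x i *: y')); rewrite seqMS; apply: addSr; by exists y'.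
Qed.

Lemma depth_bound V n x d : krull_dim A d -> fin_gen (full_smod V) -> regular_seq m V n x -> (n <= d)%N.
Proof.
move=> [_ dmax] fgV [mx reg [y ny]]; apply: dmax; apply: (regular_chain fgV mx reg).
by move=> z; apply: ny; rewrite (z y); exact: smod0.
Qed.
End RegularSequences.

Section QuotientSteps.
Variables (A : comNzRingType) (V : lmodType A) (x : nat -> A).
Notation Q l := (quot_mod (seqM V x l)).

Lemma seqM_ext (x' : nat -> A) i : (forall j, (j < i)%N -> x j = x' j) -> seqM V x i = seqM V x' i.
Proof.
elim: i => [|i IH] h; first by rewrite !seqM0.
by rewrite !seqMS IH ?h // => j ji; apply: h; exact: ltnW.
Qed.

Lemma quot_step l : (forall y : V, seqM V x l (x l *: y) -> seqM V x l y) ->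
  (forall q : Q l, x l *: q = 0 -> q = 0) /\
  exists w : {linear Q l -> Q l.+1}, (forall z, exists q, w q = z) /\
     forall q, w q = 0 <-> exists q', q = x l *: q'.
Proof.
move=> reg; split.
  move=> q; have [y <-] := qpi_surj q; rewrite -linearZ => /qpi0P /reg h; exact/qpi0P.
have [|w wE] := @ex_qlift _ _ (seqM V x l) _ (qpi (seqM V x l.+1) : {linear V -> Q l.+1}).
  by move=> y hy; apply/qpi0P; rewrite seqMS; exact: addSl.
exists w; split.
  by move=> z; have [y <-] := qpi_surj z; exists (qpi _ y); rewrite wE.
move=> q; have [y <-] := qpi_surj q; rewrite wE; split.
  move=> /qpi0P; rewrite seqMS => -[u [_ [hu [v _ ->] ->]]]; exists (qpi _ v).
  have u0 : qpi (seqM V x l) u = 0 by apply/qpi0P.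
  by rewrite linearD /= u0 add0r linearZ.
move=> [q' E]; have [v vE] := qpi_surj q'; apply/qpi0P; rewrite seqMS.
have : qpi (seqM V x l) (y - x l *: v) = 0 by rewrite linearB /= E linearZ /= vE subrr.
by move=> /qpi0P h; exists (y - x l *: v), (x l *: v); split; rewrite ?subrK //; exists v.
Qed.

Lemma quot_zero : exists (f : {linear V -> Q 0}) (g : {linear Q 0 -> V}), cancel f g /\ cancel g f.
Proof.
have [|g gE] := @ex_qlift _ _ (seqM V x 0) _ (idfun : {linear V -> V}).
  by move=> y; rewrite seqM0.
exists (qpi _ : {linear V -> Q 0}), g; split; first exact: gE.
by move=> q; have [y <-] := qpi_surj q; rewrite gE.
Qed.
End QuotientSteps.

Lemma is_max_uniq (P : nat -> Prop) a b : is_max P a -> is_max P b -> a = b.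
Proof. by move=> [Pa ha] [Pb hb]; apply/eqP; rewrite eqn_leq ha ?hb. Qed.

(** * Depth and Ext over a Gorenstein local ring *)

Section CohenMacaulay.
Variables (A : comNzRingType) (m : ideal A) (d : nat).
Hypotheses (A_noeth : noetherian A) (A_local : local_ring m) (dim_A : krull_dim A d).
Variables (J : nat -> lmodType A) (e : {linear A^o -> J 0})
  (dJ : forall i, {linear J i -> J i.+1}) (n0 : nat).
Hypotheses (J_inj : forall i, injective_module (J i))
  (J_zero : forall i, (n0 < i)%N -> is_zero (J i)) (e_inj : injective e)
  (J_exact0 : smod_eq (ker_smod (dJ 0)) (im_smod e))
  (J_exact : forall i, smod_eq (ker_smod (dJ i.+1)) (im_smod (dJ i))).
Implicit Types X Y Z : lmodType A.
Notation noext := (noext dJ).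
Notation totrefl := (totrefl dJ).

Let fgA : fin_gen (full_smod A^o) := A_noeth (full_smod A^o).

Lemma line_iso X (q : X) : q <> 0 -> (forall a : A, m a -> a *: q = 0) ->
  exists (f : {linear quot_mod m -> smod_type (lineS q)}) (g : {linear smod_type (lineS q) -> quot_mod m}),
    cancel f g /\ cancel g f.
Proof.
move=> q0 mq.
have qP a : lineS q (a *: q) by exists a.
have [s0 s0E] : exists s0 : smod_type (lineS q), val s0 = q.
  by apply: ex_sub; exists 1; rewrite scale1r.
have [h hE] : exists h : {linear A^o -> smod_type (lineS q)}, forall a, h a = (a : A) *: s0.
  by apply: mk_linear => c a b; rewrite scalerDl scalerA.
have [val' valE] := val_linear (lineS q).
have hv a : val' (h a) = a *: q by rewrite hE linearZ valE s0E.
have vinj : injective val' by move=> a b; rewrite !valE; exact: val_inj.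
have [|f fE] := @ex_qlift _ _ m _ h.
  by move=> a ma; apply: vinj; rewrite hv linear0; exact: mq.
have fi : injective f.
  apply: lin_inj => z; have [a <-] := qpi_surj z; rewrite fE => ha.
  apply/qpi0P; apply: contrapT => nma; have [b bE] := local_unit A_noeth A_local nma.
  by apply: q0; rewrite -[q]scale1r -bE -scalerA -hv ha linear0 scaler0.
have [|g gE] := @factor_inj _ _ _ _ f (idfun : {linear smod_type (lineS q) -> smod_type (lineS q)}) fi.
  move=> z; have [a aE] := smod_valP z; exists (qpi m a); rewrite fE; apply: vinj.
  by rewrite hv /= valE.
exists f, g; split; last exact: gE.
by move=> z; apply: fi; rewrite gE.
Qed.

Let depthA := exists t x, regular_seq m A^o t x /\ forall x', ~ regular_seq m A^o t.+1 x'.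

Lemma ex_depth : depthA.
Proof.
have ex : exists n, `[< exists x, regular_seq m A^o n x >].
  exists 0%N; apply/asboolP; exists (fun=> 0); split=> //; exists 1.
  by rewrite -/(seqM A^o (fun=> 0) 0) seqM0 => /eqP; rewrite oner_eq0.
have bd n : `[< exists x, regular_seq m A^o n x >] -> (n <= d)%N.
  by move=> /asboolP [x]; exact: (depth_bound A_noeth A_local dim_A fgA).
case: (ex_maxnP ex bd) => t /asboolP [x hx] tmax; exists t, x; split => // x' hx'.
by have := tmax t.+1; rewrite ltnn => H; apply: notF; apply: H; apply/asboolP; exists x'.
Qed.

Section MaximalSequence.
Variables (t : nat) (x : nat -> A).
Hypotheses (x_reg : regular_seq m A^o t x) (x_max : forall x', ~ regular_seq m A^o t.+1 x').

Let xm : forall i, (i < t)%N -> m (x i). Proof. by case: x_reg. Qed.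
Let xr : forall i, (i < t)%N -> forall y : A^o, seqM A^o x i (x i *: y) -> seqM A^o x i y.
Proof. by case: x_reg. Qed.

(** Each regular element raises the projective dimension by one, so only the first [l] Ext modules
    can be nonzero. *)
Lemma noext_koszul l j : (l <= t)%N -> (l <= j)%N -> noext j (quot_mod (seqM A^o x l)).
Proof.
elim: l j => [|l IH] j lt lj.
  have [f [g [fg gf]]] := quot_zero A^o x; apply: (noext_iso gf).
  have [f1 [_ f1E]] := lin_row (fun _ : 'I_1 => (1 : A^o)).
  have [g1 g1E] : exists g1 : {linear A^o -> 'rV[A]_1}, forall a, g1 a = (a : A) *: delta_mx 0 0.
    by apply: mk_linear => c u v; rewrite scalerDl scalerA.
  apply: (noext_iso (f := f1) (g := g1)); last exact: noext_row.
  by move=> a; rewrite g1E linearZ f1E -[RHS]mulr1.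
have [reg [w [ws wk]]] := quot_step (xr lt).
case: j lj => [|j] // lj.
have [u uE] := ex_mulmap (quot_mod (seqM A^o x l)) (x l).
have uw : ses u w.
  split => //; first by apply: lin_inj => q; rewrite uE; exact: reg.
  by move=> q; rewrite wk; split=> -[q' E]; exists q'; rewrite uE in E *.
by apply: (noext_quot J_inj J_exact uw); apply: IH; rewrite ?ltnS // ltnW // ltnW.
Qed.

Lemma ex_socle : exists2 q : quot_mod (seqM A^o x t), q <> 0 & forall a : A, m a -> a *: q = 0.
Proof.
have [y ny my] : exists2 y, ~ seqM A^o x t y & forall a : A, m a -> seqM A^o x t (a *: y).
  apply: (zero_divisors A_noeth fgA); first by case: x_reg.
  move=> a ma; apply: contrapT => h.
  (* If [a] in [m] were regular modulo the sequence, appending it would give a longer one, against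
     [x_max]. *)
  pose x' j := if (j < t)%N then x j else a.
  have xx' i : (i <= t)%N -> seqM A^o x i = seqM A^o x' i.
    by move=> it; apply: seqM_ext => j ji; rewrite /x' (leq_trans ji it).
  suff : regular_seq m A^o t.+1 x' by exact: x_max.
  split.
  - by move=> i; rewrite ltnS /x' leq_eqVlt => /orP [/eqP ->|it]; [rewrite ltnn|rewrite it; exact: xm].
  - move=> i; rewrite ltnS => it y; change (seqM A^o x' i (x' i *: y) -> seqM A^o x' i y).
    rewrite -xx' // /x'; move: it; rewrite leq_eqVlt => /orP [/eqP ->|it]; last by rewrite it; exact: xr.
    by rewrite ltnn => hy; apply: contrapT => ny; apply: h; exists y.
  - apply: (seqM_proper A_noeth A_local) => //.
      by move=> i; rewrite ltnS /x' leq_eqVlt => /orP [/eqP ->|it]; [rewrite ltnn|rewrite it; exact: xm].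
    by move=> z; have /eqP := z 1; rewrite oner_eq0.
exists (qpi _ y); first by move=> /qpi0P.
by move=> a ma; rewrite -linearZ; apply/qpi0P; exact: my.
Qed.

(** The residue field embeds in the quotient of [A] by the maximal sequence, where [noext_koszul]
    applies, so vanishing descends to it from one degree higher. A general [X] is built up by
    submodules [B] on which either [m] acts as zero or some generator of [m] acts injectively; the
    latter are handled by [noext_regular]. *)
Lemma noext_descent b : (t <= b)%N -> (forall X, fin_gen (full_smod X) -> noext b.+1 X) ->
  forall X, fin_gen (full_smod X) -> noext b X.
Proof.
move=> tb H.
have fgQ (V : lmodType A) (N : submodule V) : fin_gen (full_smod V) -> fin_gen (full_smod (quot_mod N)).
  by apply: (fin_gen_surj (f := qpi N : {linear V -> quot_mod N})); exact: qpi_surj.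
have fgS (V : lmodType A) (N : submodule V) : fin_gen (full_smod V) -> fin_gen (full_smod (smod_type N)).
  by by move=> h; apply: ((fin_gen_smod_type N).1 _); exact: fin_gen_full_sub.
have simple X (z : X) : z <> 0 -> (forall a : A, m a -> a *: z = 0) -> noext b (smod_type (lineS z)).
  move=> z0 mz; have [f [g [_ gf]]] := line_iso z0 mz; apply: (noext_iso gf).
  have [q q0 mq] := ex_socle; have [f' [g' [fg' _]]] := line_iso q0 mq; apply: (noext_iso fg').
  have [u us] := ses_quot (lineS q); apply: (noext_sub J_inj J_exact us); first exact: noext_koszul.
  by apply: H; apply: (fgQ); apply: (fgQ).
have bot X : noext b (smod_type (botS X)).
  by apply: noext_zero => z; apply: val_inj; exact: (smod_valP z).
have some X : fin_gen (full_smod X) -> ~ is_zero X ->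
    exists B : submodule X, (exists2 z, B z & z <> 0) /\ noext b (smod_type B).
  move=> fgX nz; have /fin_genP [s mE] := A_noeth m.
  have sm (a : A) : a \in s -> m a by move=> ?; rewrite mE; exact: span_mems.
  have [B [[z Bz z0] HB]] : exists B : submodule X, (exists2 z, B z & z <> 0) /\
      forall a : A, a \in s -> (forall z, B z -> a *: z = 0) \/ (forall z, B z -> a *: z = 0 -> z = 0).
    elim: (s) => [|a s' [B [[z Bz z0] HB]]].
      exists (full_smod X); split=> //; apply: contrapT => h; apply: nz => z.
      by apply: contrapT => z0; apply: h; exists z.
    case: (pselect (forall z, B z -> a *: z = 0 -> z = 0)) => [inj|ninj].
      exists B; split; first by exists z.
      by move=> a'; rewrite inE => /orP [/eqP ->|/HB //]; right.
    exists (capS B (colon_smod (a : A) (botS X))); split.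
      apply: contrapT => h; apply: ninj => w Bw aw; apply: contrapT => w0.
      by apply: h; exists w => //; split.
    move=> a'; rewrite inE => /orP [/eqP ->|/HB [h|h]]; first by left => w [].
      by left => w [/h].
    by right => w [/h].
  case: (pselect (exists2 a, a \in s & forall z, B z -> a *: z = 0 -> z = 0)) => [[a as_ inj]|no].
    exists B; split; first by exists z.
    have ainj (y : smod_type B) : (a : A) *: y = 0 -> y = 0.
      move=> ay; apply: val_inj; apply: inj; first exact: smod_valP.
      by rewrite -[LHS]/(val ((a : A) *: y)) ay.
    pose N := scaleS (a : A) (full_smod (smod_type B)).
    apply: (@noext_regular A m A_noeth A_local J e dJ J_inj e_inj J_exact0 J_exact (a : A) _ (quot_mod N) (qpi N)) => //.
    - exact: sm.
    - exact: fgS.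
    - exact: qpi_surj.
    - move=> y; split; first by move=> /qpi0P [w _ ->]; exists w.
      by move=> [w ->]; apply/qpi0P; exists w.
    - by apply: H; apply: fgQ; exact: fgS.
  have mB (a : A) : m a -> a *: z = 0.
    rewrite mE => sa; have : span [set` s] <=s annS (botS X) z.
      apply: span_les => c cs; have [h|h] := HB c cs; first exact: h.
      by case: no; exists c.
    by move=> /(_ _ sa).
  exists (lineS z); split; first by exists z => //; exists 1; rewrite scale1r.
  exact: simple.
move=> X fgX.
have [N [_ _ hN Nmax]] := max_submodule A_noeth (T := full_smod X)
  (P := fun N => noext b (smod_type N)) fgX (bot X) (fun _ _ => Logic.I).
have full : full_smod X <=s N.
  apply: contrapT => nfull.
  have [|B [[z Bz z0] hB]] := some (quot_mod N) (fgQ _ _ fgX).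
    move=> z; apply: nfull => y _; exact/qpi0P.
  pose N' := preim_smod (qpi N : {linear X -> quot_mod N}) B.
  have NN' : N <=s N' by move=> y Ny; rewrite /N' /= (qpi0P _ _).2 //; exact: smod0.
  have [y yz] := qpi_surj z.
  have Ny : N y.
    apply: (Nmax N') => //; last by rewrite /N' /= yz.
    have [i iE] := val_linear N; have [i' i'E] := val_linear N'; have [iB iBE] := val_linear B.
    have i'i : injective i' by move=> u v; rewrite !i'E; exact: val_inj.
    have iBi : injective iB by move=> u v; rewrite !iBE; exact: val_inj.
    have [|u uE] := @factor_inj _ _ _ _ i' i i'i.
      move=> w; rewrite iE; have [w' w'E] := ex_sub (NN' _ (smod_valP w)).
      by exists w'; rewrite i'E.
    have [p pE] := lin_comp (qpi N) i'.
    have [|v vE] := @factor_inj _ _ _ _ iB p iBi.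
      move=> w; rewrite pE i'E; have [w' w'E] := ex_sub (smod_valP w : B _).
      by exists w'; rewrite iBE.
    apply: (noext_mid J_inj J_exact (u := u) (v := v)) => //; split.
    - by move=> w1 w2 E; have := congr1 i' E; rewrite !uE !iE; exact: val_inj.
    - move=> w; have [y1 y1E] := qpi_surj (val w).
      have [|w' w'E] := @ex_sub _ _ N' y1; first by rewrite /N' /= y1E; exact: smod_valP.
      by exists w'; apply: iBi; rewrite vE pE i'E iBE w'E.
    - move=> w; split.
        move=> /(congr1 iB); rewrite vE pE linear0 i'E => /qpi0P /ex_sub [w' w'E].
        by exists w'; apply: i'i; rewrite uE iE i'E.
      move=> [w' <-]; apply: iBi; rewrite vE pE linear0 uE iE; apply/qpi0P; exact: smod_valP.
  by apply: z0; rewrite -yz; apply/qpi0P.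
have [i iE] := val_linear N.
have [| |g gE] := @factor_inj _ _ _ _ i (idfun : {linear X -> X}).
- by move=> u v; rewrite !iE; exact: val_inj.
- by move=> w; have [w' w'E] := ex_sub (full w Logic.I); exists w'; rewrite iE.
by apply: (noext_iso (f := i) (g := g)) => // w; rewrite gE.
Qed.

Lemma noext_depth X j : fin_gen (full_smod X) -> (t <= j)%N -> noext j X.
Proof.
suff H k b : (n0 <= b + k)%N -> (t <= b)%N -> forall X, fin_gen (full_smod X) -> noext b X.
  by move=> fgX tj; apply: (H n0 j) => //; exact: leq_addl.
elim: k b => [|k IH] b nb tb Y fgY; first by rewrite addn0 in nb; exact: (noext_big J_zero).
by apply: noext_descent => //; apply: IH; rewrite ?addSnnS // leqW.
Qed.

Lemma noext_of_regular V (y : nat -> A) n : fin_gen (full_smod V) -> regular_seq m V n y ->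
  forall l j, (l <= n)%N -> (t <= j + (n - l))%N -> noext j (quot_mod (seqM V y l)).
Proof.
move=> fgV [ym yr _].
have fgQ l : fin_gen (full_smod (quot_mod (seqM V y l))).
  by apply: (fin_gen_surj (f := qpi (seqM V y l) : {linear V -> _})) fgV; exact: qpi_surj.
move=> l j ln; move E : (n - l)%N => k; elim: k l j ln E => [|k IH] l j ln E tj.
  by rewrite addn0 in tj; exact: noext_depth.
have ln' : (l < n)%N by rewrite -subn_gt0 E.
have [reg [w [ws wk]]] := quot_step (yr l ln').
apply: (@noext_regular A m A_noeth A_local J e dJ J_inj e_inj J_exact0 J_exact (y l) _ _ w) => //.
- exact: ym.
- exact: fgQ.
- by apply: IH => //; [rewrite subnS E|rewrite addSnnS].
Qed.

Lemma totrefl_of_regular V (y : nat -> A) n : fin_gen (full_smod V) -> regular_seq m V n y ->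
  (t <= n)%N -> totrefl V.
Proof.
move=> fgV hy tn; split => // j; have [f [g [fg gf]]] := quot_zero V y.
apply: (noext_iso fg); apply: (noext_of_regular fgV hy) => //.
by rewrite subn0 (leq_trans tn) // leq_addl.
Qed.

(** If [n > t], the Ext modules of [V] and of its quotient by the first element of the sequence
    vanish. Then [V] is torsionless and yet has no nonzero linear form. *)
Lemma depth_max V (y : nat -> A) n : fin_gen (full_smod V) -> regular_seq m V n y -> (n <= t)%N.
Proof.
move=> fgV hy; rewrite leqNgt; apply/negP => tn.
have tV := totrefl_of_regular fgV hy (ltnW tn).
have n_gt0 : (0 < n)%N by apply: leq_ltn_trans tn.
have [ym yr [z nz]] := hy.
have [reg [w [ws wk]]] := quot_step (yr 0%N n_gt0).
have hom0 (phi : {linear quot_mod (seqM V y 0) -> A^o}) q : phi q = 0.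
  apply: (noext_hom_regular A_noeth A_local J_inj e_inj J_exact0 J_exact (ym 0%N n_gt0) _ reg ws wk).
    by apply: (fin_gen_surj (f := qpi (seqM V y 0) : {linear V -> _})) fgV; exact: qpi_surj.
  apply: (noext_of_regular fgV hy) => //.
  by rewrite add0n subn1 -ltnS prednK.
apply: nz; have -> : z = 0; last exact: smod0.
apply: (torsionless A_noeth J_inj J_zero e_inj J_exact0 J_exact tV) => phi.
have [p pE] := dualP phi; have [f [g [fg gf]]] := quot_zero V y.
by have [h hE] := lin_comp p g; rewrite -pE -[z]fg -hE hom0.
Qed.

Lemma seqM_map X Y (f : {linear X -> Y}) (y : nat -> A) i z :
  seqM X y i z -> seqM Y y i (f z).
Proof.
suff H : seqM X y i <=s preim_smod f (seqM Y y i) by exact: H.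
apply: mul_smod_ind => a w ha _; change (seqM Y y i (f (a *: w))).
by rewrite linearZ; exact: mul_smodP.
Qed.

Lemma seqM_surj X Y (f : {linear X -> Y}) (y : nat -> A) i z : (forall z, exists w, f w = z) ->
  seqM Y y i z -> exists2 w, seqM X y i w & f w = z.
Proof.
move=> fs; suff H : seqM Y y i <=s imS f (seqM X y i) by exact: H.
apply: mul_smod_ind => a z' ha _; have [w <-] := fs z'.
by exists (a *: w); rewrite ?linearZ //; exact: mul_smodP.
Qed.

Lemma regular_row p l (v : 'rV[A]_p) : (l < t)%N ->
  seqM 'rV[A]_p x l (x l *: v) -> seqM 'rV[A]_p x l v.
Proof.
move=> lt h; rewrite [v]row_sum_delta; apply: smod_sum => i.
have [c cE] : exists c : {linear 'rV[A]_p -> A^o}, forall w, c w = w 0 i.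
  by apply: mk_linear => u w z; rewrite !mxE.
have [f fE] : exists f : {linear A^o -> 'rV[A]_p}, forall a, f a = (a : A) *: delta_mx 0 i.
  by apply: mk_linear => u w z; rewrite scalerDl scalerA.
rewrite -fE; apply: seqM_map; apply: (xr lt).
by have := seqM_map c h; rewrite cE mxE.
Qed.

(** Regularity on the quotient [Y] keeps [X -> F] injective modulo the sequence; it plays the part
    of vanishing of [Tor_1]. *)
Lemma seqM_cap (X F Y : lmodType A) (u : {linear X -> F}) (v : {linear F -> Y}) j (z : X) : ses u v ->
  (forall l, (l < j)%N -> forall y : Y, seqM Y x l (x l *: y) -> seqM Y x l y) ->
  seqM F x j (u z) -> seqM X x j z.
Proof.
move=> uv; elim: j z => [|j IH] z reg.
  by rewrite !seqM0 => /(lin_inj0 (ses_inj uv)) ->.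
rewrite seqMS => -[n [_ [hn [f _ ->] zE]]].
have h1 : seqM Y x j (v f).
  apply: (reg j (ltnSn j)); have -> : x j *: v f = - v n.
    apply/eqP; rewrite -subr_eq0 opprK -linearZ -linearD [_ + n]addrC -zE.
    by rewrite (ses_0 _ uv).
  by apply: smodN; exact: seqM_map.
have [g hg gE] := seqM_surj (ses_surj uv) h1.
have [h hE] : exists h, u h = f - g by apply/(ses_ker uv); rewrite linearB gE subrr.
rewrite seqMS -(subrK (x j *: h) z); apply: smodD; last by apply: addSr; exists h.
apply: addSl; apply: IH; first by move=> l lj; apply: reg; exact: ltnW.
have -> : u (z - x j *: h) = n + x j *: g.
  by rewrite linearB linearZ_LR hE zE scalerBr opprB [_ *: g - _]addrC addrA addrK.
by apply: smodD => //; exact: smodZ.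
Qed.
End MaximalSequence.

Lemma cosyzygy_ses (X K : lmodType A) p (w : {linear 'rV[A]_p -> dual X}) (kk : {linear K -> 'rV[A]_p}) :
  totrefl X -> ses kk w ->
  exists (u : {linear X -> 'rV[A]_p}) (v : {linear 'rV[A]_p -> dual K}),
  [/\ ses u v, totrefl (dual K), forall x, u x = \row_i smod_val (w (delta_mx 0 i)) x
    & forall r k, smod_val (v r) k = \sum_i r 0 i * kk k 0 i].
Proof.
move=> tX kw.
have tdX : totrefl (dual X) by exact: (totrefl_dual A_noeth J_inj J_zero e_inj J_exact0 J_exact tX).
have tK : totrefl K.
  apply: (totrefl_ker A_noeth J_inj J_exact kw _ _ tdX); first exact: (fin_gen_row A p).
  by move=> j; exact: noext_row.
have [u uE] : exists u : {linear X -> 'rV[A]_p}, forall x, u x = \row_i smod_val (w (delta_mx 0 i)) x.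
  apply: mk_linear => c x y; apply/rowP => i; rewrite !mxE.
  exact: (smod_valP (w (delta_mx 0 i)) c x y).
have /choice [v0 v0E] (r : 'rV[A]_p) : exists phi : dual K, forall k, smod_val phi k = \sum_i r 0 i * kk k 0 i.
  have [f fE] : exists f : {linear K -> A^o}, forall k, f k = \sum_i r 0 i * kk k 0 i.
    apply: mk_linear => c k k'; rewrite scaler_sumr -big_split; apply: eq_bigr => i _ /=.
    by rewrite linearP !mxE mulrDr mulrCA.
  by have [phi phiE] := mk_dual f; exists phi => k; rewrite phiE fE.
have [v vE0] : exists v : {linear 'rV[A]_p -> dual K}, forall r, v r = v0 r.
  apply: mk_linear => c r r'; apply: dual_ext => k; rewrite dualD dualZ !v0E.
  rewrite mulr_sumr -big_split; apply: eq_bigr => i _ /=.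
  by rewrite !mxE mulrDl mulrA.
have vE r k : smod_val (v r) k = \sum_i r 0 i * kk k 0 i by rewrite vE0.
have wE r x : smod_val (w r) x = \sum_i r 0 i * u x 0 i.
  have [ev evE] : exists f : {linear dual X -> A^o}, forall phi, f phi = smod_val phi x by apply: mk_linear.
  rewrite -evE [in LHS](row_sum_delta r) !linear_sum; apply: eq_bigr => i _.
  by rewrite !linearZ evE uE mxE.
exists u, v; split => //; last exact: (totrefl_dual A_noeth J_inj J_zero e_inj J_exact0 J_exact tK).
split.
- apply: lin_inj => x ux; apply: (torsionless A_noeth J_inj J_zero e_inj J_exact0 J_exact tX) => phi.
  have [r <-] := ses_surj kw phi; rewrite wE ux big1 // => i _; by rewrite mxE mulr0.
- move=> psi; have [g gE] := dualP psi; have [f fE] := hom_extend J_inj e_inj J_exact0 J_exact kw g (tdX.2 0%N).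
  exists (\row_i f (delta_mx 0 i)); apply: dual_ext => k; rewrite vE -gE -fE.
  rewrite [in RHS](row_sum_delta (kk k)) linear_sum; apply: eq_bigr => i _.
  by rewrite linearZ mxE mulrC.
- move=> r; split=> [vr|[x <-]]; last first.
    apply: dual_ext => k; rewrite vE; have := wE (kk k) x; rewrite (ses_0 _ kw) => E.
    by rewrite -[RHS]/(smod_val (0 : dual X) x) E; apply: eq_bigr => i _; rewrite mulrC.
  have [f [_ fE]] := lin_row (fun i => r 0 i : A^o).
  have fE' k : f (kk k) = smod_val (v r) k.
    rewrite vE [in LHS](row_sum_delta (kk k)) linear_sum; apply: eq_bigr => i _.
    by rewrite linearZ fE mulrC.
  have [|th thE] := ses_factor kw (f := f); first by move=> k; rewrite fE' vr.
  have [x xE] := dual_eval A_noeth J_inj J_zero e_inj J_exact0 J_exact th tX.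
  by exists x; apply/rowP => i; rewrite uE mxE -xE thE fE.
Qed.

Lemma ex_cosyzygy X : totrefl X -> exists p (Y : lmodType A) (u : {linear X -> 'rV[A]_p}) (v : {linear 'rV[A]_p -> Y}),
  ses u v /\ totrefl Y.
Proof.
move=> tX; have [p [w ws]] := fg_cover (fin_gen_dual A_noeth tX.1).
have [kk kw] := ses_of_surj ws; have [u [v [uv tY _ _]]] := cosyzygy_ses tX kw.
by exists p, (dual (smod_type (ker_smod w))), u, v.
Qed.

(** The nonzero module [X0] of depth [d] forces [t = d] by [depth_max]; the other inequality is
    depth at most dimension. *)
Theorem MCM_totrefl X0 : MCM m X0 -> ~ is_zero X0 -> forall X, MCM m X <-> totrefl X.
Proof.
move=> [fg0 [//|[d0 dim0 dep0]]] nz0.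
have d0E : d0 = d by exact: is_max_uniq dim0 dim_A.
have [t [x [x_reg x_max]]] := ex_depth.
have td : t = d.
  apply/eqP; rewrite eqn_leq (depth_bound A_noeth A_local dim_A fgA x_reg) /= -d0E.
  by case: dep0 => -[y hy] _; exact: (depth_max x_reg x_max fg0 hy).
move=> X; split.
  move=> [fgX [X0z|[d1 dim1 [[y hy] _]]]]; first by split => // j; exact: noext_zero.
  apply: (totrefl_of_regular x_reg x_max fgX hy).
  by rewrite td (is_max_uniq dim_A dim1).
move=> tX; split; first exact: tX.1.
case: (pselect (is_zero X)) => [|nz]; [by left|right]; exists d => //; split; last first.
  by move=> k [y]; exact: (depth_bound A_noeth A_local dim_A tX.1).
have xm : forall i, (i < t)%N -> m (x i) by case: x_reg.
(* Embed [Y] in a free module with totally reflexive cokernel. The earlier elements are regular on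
   the cokernel by induction, so [seqM_cap] transfers regularity of [x j] from the free module to
   [Y]. *)
have main j : (j <= t)%N -> forall Y, totrefl Y -> forall l, (l < j)%N ->
    forall y : Y, seqM Y x l (x l *: y) -> seqM Y x l y.
  elim: j => [|j IH] jt Y tY l //; rewrite ltnS leq_eqVlt => /orP [/eqP ->|lj]; last first.
    by apply: IH => //; exact: ltnW.
  move=> y hy; have [p [Y' [u [v [uv tY']]]]] := ex_cosyzygy tY.
  apply: (seqM_cap uv); first by apply: IH => //; exact: ltnW.
  by apply: (regular_row x_reg) => //; rewrite -linearZ; exact: seqM_map.
exists x; rewrite -td; split => //.
  by move=> i it y; exact: (main t (leqnn t) X tX i it).
exact: (@seqM_proper A m A_noeth A_local X x t xm tX.1 nz).
Qed.
End CohenMacaulay.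

(** * Lengths of Tor *)

Section TorLength.
Variable A : comNzRingType.

Lemma haslen_iso_inv (V W : lmodType A) (f : {linear V -> W}) (B Z : submodule V)
    (B' Z' : submodule W) l :
  B <=s Z -> B' <=s Z' ->
  (forall x, Z x -> Z' (f x)) -> (forall x, Z x -> (B x <-> B' (f x))) ->
  (forall y, Z' y -> exists2 x, Z x & B' (y - f x)) ->
  haslen B' Z' l -> haslen B Z l.
Proof.
move=> BZ BZ' fZ fB fs hl.
have h : lenle B Z l by apply: lenle_inj fZ _ BZ' hl.2 => x Zx; case: (fB x Zx).
have [l' hl'] := haslen_ex BZ h.
by rewrite (haslen_uniq hl (haslen_iso BZ BZ' fZ fB fs hl')).
Qed.

Lemma subquot_length (V : lmodType A) (B Z : submodule V) l : B <=s Z ->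
  haslen B Z l -> has_length (subquot Z B) l.
Proof.
move=> BZ hl; apply/has_chain_haslen; rewrite /subquot; set N := preim_smod _ B.
have [i iE] := val_linear Z.
apply: (haslen_iso (f := qpi N) (B := N) (Z := full_smod (smod_type Z))) => //.
- by move=> x _; split => /qpi0P.
- by move=> y _; have [x <-] := qpi_surj y; exists x => //; rewrite subrr.
apply: (haslen_iso_inv (f := i)) hl => //.
- by move=> x _; rewrite iE; exact: smod_valP.
- by move=> x _; rewrite iE.
- by move=> y /ex_sub [x xE]; exists x => //; rewrite iE xE subrr; exact: smod0.
Qed.

(** The differential [f] onto [K] pulls the quotient back to [Z1 / B1] in the next free module, and
    reduction [g] modulo [L] carries [Z1 / B1] to cycles modulo boundaries. *)
Lemma Tor1_haslen (M : lmodType A) (F : free_res M) (L : ideal A) l :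
  let K := ker_smod (res_aug F) in
  haslen (mul_smod L K) (capS (mul_smod L (full_smod _)) K) l ->
  has_length (Tor1 F (quot_mod L)) l.
Proof.
case: F => r D v vs vk Dk /= hl.
set K := ker_smod v in hl.
have [f fE] : exists f : {linear 'rV[A]_(r 1%N) -> 'rV[A]_(r 0%N)}, forall x, f x = x *m D 0%N.
  by apply: mk_linear => c x y; rewrite mulmxDl scalemxAl.
have [e eE] : exists e : {linear 'rV[A]_(r 2%N) -> 'rV[A]_(r 1%N)}, forall x, e x = x *m D 1%N.
  by apply: mk_linear => c x y; rewrite mulmxDl scalemxAl.
have [g gE] : exists g : {linear 'rV[A]_(r 1%N) -> ('I_(r 1%N) -> quot_mod L)},
    forall x, g x = (fun i => qpi L (x 0 i : A^o)).
  apply: mk_linear => c x y; apply/funext => i; rewrite !mxE; exact: linearP.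
have LK : mul_smod L K <=s capS (mul_smod L (full_smod _)) K.
  by move=> x Lx; split; [apply: mul_smod_mono Lx|exact: mul_smod_le Lx].
have fK x : K (f x) by apply/vk; exists x; rewrite fE.
have fs y : K y -> exists x, f x = y by move=> /vk [x xE]; exists x; rewrite fE.
have fe x : f x = 0 <-> exists w, e w = x.
  by rewrite fE Dk; split=> -[w wE]; exists w; rewrite ?eE // -eE.
have fLs y : mul_smod L K y -> exists2 x, mul_smod L (full_smod _) x & f x = y.
  suff H : mul_smod L K <=s imS f (mul_smod L (full_smod _)) by move=> /H [x]; exists x.
  apply: mul_smod_ind => c _ Lc /fs [x <-]; exists (c *: x); first exact: mul_smodP.
  by rewrite linearZ.
have fL x : mul_smod L (full_smod _) x -> mul_smod L K (f x).
  suff H : mul_smod L (full_smod _) <=s preim_smod f (mul_smod L K) by exact: H.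
  apply: mul_smod_ind => c y Lc _; change (mul_smod L K (f (c *: y))).
  by rewrite linearZ; exact: mul_smodP.
pose Z1 := preim_smod f (mul_smod L (full_smod _)).
pose B1 := addS (im_smod e) (mul_smod L (full_smod _)).
have BZ1 : B1 <=s Z1.
  apply: addS_le; last by move=> x /fL /LK [].
  by move=> x /fe fx; change (mul_smod L (full_smod 'rV[A]_(r 0%N)) (f x)); rewrite fx; exact: smod0.
have h1 : haslen B1 Z1 l.
  apply: (haslen_iso_inv (f := f)) hl => //.
  - move=> x Zx; split.
      by move=> [y [z [/fe fy /fL Lz ->]]]; rewrite linearD fy add0r.
    move=> /fLs [y Ly yE]; exists (x - y), y; rewrite subrK; split => //.
    by apply/fe; rewrite linearB yE subrr.
  - move=> y [Ly /fs [x xE]]; exists x; last by rewrite xE subrr; exact: smod0.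
    by rewrite /Z1 /= xE.
have gL x : g x = 0 <-> mul_smod L (full_smod _) x.
  rewrite gE; split.
    by move=> h; apply/mul_smod_row => i; apply/qpi0P; have := congr1 (fun z => z i) h.
  by move=> /mul_smod_row h; apply/funext => i; apply/qpi0P; exact: h.
have gs y : exists x, g x = y.
  have /choice [x xE] i := qpi_surj (y i); exists (\row_i x i).
  by rewrite gE; apply/funext => i; rewrite mxE.
have tg p q (E : 'M[A]_(p, q)) (x : 'rV[A]_p) :
    mx_tensor (N := quot_mod L) E (fun i => qpi L (x 0 i : A^o)) =
    (fun j => qpi L ((x *m E) 0 j : A^o)).
  apply/funext => j; rewrite mxE /mx_tensor linear_sum; apply: eq_bigr => i _ /=.
  by rewrite -linearZ /= mulrC.
have E0 x : ker_smod (mx_tensor (N := quot_mod L) (D 0%N)) (g x) <-> Z1 x.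
  change (mx_tensor (N := quot_mod L) (D 0%N) (g x) = 0 <-> mul_smod L (full_smod 'rV[A]_(r 0%N)) (f x)).
  have -> : mx_tensor (N := quot_mod L) (D 0%N) (g x) = (fun j => qpi L (f x 0 j : A^o)).
    by rewrite gE fE; exact: tg.
  split.
    by move=> h; apply/mul_smod_row => i; apply/qpi0P; have := congr1 (fun z => z i) h.
  by move=> /mul_smod_row h; apply/funext => i; apply/qpi0P; exact: h.
have E1 x : im_smod (mx_tensor (N := quot_mod L) (D 1%N)) (g x) <-> B1 x.
  split.
    move=> [w]; have /choice [u uE] i := qpi_surj (w i).
    have -> : w = (fun i => qpi L ((\row_i u i) 0 i : A^o)) by apply/funext => i; rewrite mxE.
    have := tg _ _ (D 1%N) (\row_i u i); move=> /= -> ug; exists (e (\row_i u i)), (x - e (\row_i u i)); split; last by rewrite addrC subrK.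
      by exists (\row_i u i).
    by apply/gL; rewrite linearB -ug [g (e _)]gE eE subrr.
  move=> [_ [z [[w <-] /gL gz ->]]]; exists (fun i => qpi L (w 0 i : A^o)).
  by rewrite linearD gz addr0 gE eE; exact: tg.
apply: subquot_length.
  by move=> y; have [x <-] := gs y; move=> /E1 /BZ1 /E0.
apply: (haslen_iso (f := g)) h1 => //.
- by move=> y; have [x <-] := gs y; move=> /E1 /BZ1 /E0.
- by move=> x /E0.
- by move=> x _; rewrite E1.
- by move=> y; have [x <-] := gs y; move=> /E0 h; exists x => //; rewrite subrr; exact: smod0.
Qed.

Hypothesis A_noeth : noetherian A.

Lemma ex_free_res (M : lmodType A) : fin_gen (full_smod M) -> exists F : free_res M, True.
Proof.
move=> /fg_cover [p [v vs]].
have cov (s : {q : nat & submodule 'rV[A]_q}) :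
    exists t : {p : nat & 'M[A]_(p, projT1 s)},
    forall x, projT2 s x <-> exists w, w *m projT2 t = x.
  case: s => q K /=.
  have fgK : fin_gen (full_smod (smod_type K)).
    by apply: (proj1 (fin_gen_smod_type K)); exact: (fin_gen_full_sub A_noeth _ (fin_gen_row A q)).
  have [n [f fs]] := fg_cover fgK; have [i iE] := val_linear K.
  exists (existT _ n (\matrix_(k < n) val (f (delta_mx 0 k)))) => x /=.
  have fE w : w *m (\matrix_(k < n) val (f (delta_mx 0 k))) = val (f w).
    rewrite -iE [in RHS](row_sum_delta w) !linear_sum mulmx_sum_row; apply: eq_bigr => k _.
    by rewrite rowK !linearZ /= iE.
  split; last by move=> [w <-]; rewrite fE; exact: smod_valP.
  by move=> /ex_sub [y <-]; have [w <-] := fs y; exists w; rewrite fE.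
have [c cE] : exists c : forall s : {q : nat & submodule 'rV[A]_q}, {p : nat & 'M[A]_(p, projT1 s)},
    forall (s : {q : nat & submodule 'rV[A]_q}) x, projT2 s x <-> exists w, w *m projT2 (c s) = x.
  by exists (fun s => projT1 (cid (cov s))) => s; exact: (projT2 (cid (cov s))).
pose kerm p' q (E : 'M[A]_(p', q)) : submodule 'rV[A]_p' := ker_smod (mulmxr E : {linear 'rV[A]_p' -> 'rV[A]_q}).
(* Each stage stores a rank together with the submodule that the next matrix has to cover. *)
pose st := fix st n := if n is n'.+1 then existT (fun q => submodule 'rV[A]_q) _ (kerm _ _ (projT2 (c (st n'))))
  else existT _ p (ker_smod v).
unshelve eexists; last by [].
unshelve refine (@FreeRes A M (fun i => projT1 (st i)) (fun i => projT2 (c (st i))) v vs _ _).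
- by move=> x; rewrite -(cE (st 0%N)).
- by move=> i x; rewrite -(cE (st i.+1)).
Qed.
End TorLength.

Section Growth.
Variables (A : comNzRingType) (m I : ideal A).
Hypotheses (A_noeth : noetherian A) (A_local : local_ring m) (I_primary : primary_to m I).
Variables (a : nat -> A) (r : nat).
Hypothesis aI : forall k, (k < r)%N -> I (a k).
Hypothesis Ia : forall N : ideal A, (forall k, (k < r)%N -> N (a k)) -> I <=s N.

(** [hr] constrains only values that occur; [tor_hilbert] makes the Tor lengths eventually
    polynomial, so [size p - 1] is one of them. *)
Lemma r1_growth M k : fin_gen (full_smod M) -> (forall x, is_r1 I M x -> x <= k%:Z - 1) ->
  exists p (v : {linear 'rV[A]_p -> M}),
    (forall y, exists x, v x = y) /\ tor_growth aI (ker_smod v) k.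
Proof.
move=> fgM hr; have [F _] := ex_free_res A_noeth fgM.
have vs : forall y, exists x, res_aug F x = y by case: F.
exists (res_rank F 0), (res_aug F); split => //.
have [w hw [p [n0 hp]]] := tor_hilbert A_noeth A_local I_primary aI Ia
  (ker_smod (res_aug F)) (fin_gen_row A (res_rank F 0)).
exists p, n0; split; last first.
  by move=> n hn; exists (w n); [exact: (hw n).2|rewrite hp].
have := hr ((size p)%:Z - 1); rewrite lerD2r lez_nat; apply.
exists p, n0; split => // n /hp pn; exists (w n) => //.
by exists F; apply: Tor1_haslen; exact: hw.
Qed.
End Growth.

(** * Stable retracts and thick subcategories *)

Section Retracts.
Variable A : comNzRingType.
Implicit Types X Y Z : lmodType A.

(* Y is a direct summand of X in the stable category. *)
Definition retract Y X := exists (a : {linear Y -> X}) (b : {linear X -> Y}),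
  stable_eq (b \o a) idfun.

Lemma retract_of_split Y X (a : {linear Y -> X}) (b : {linear X -> Y}) :
  (forall y, b (a y) = y) -> retract Y X.
Proof.
move=> ba; have [h hE] := lin_zero Y 'rV[A]_0; have [k kE] := lin_zero 'rV[A]_0 Y.
by exists a, b, 0%N, h, k => y /=; rewrite ba subrr kE.
Qed.

Lemma retract_refl X : retract X X.
Proof. exact: (@retract_of_split _ _ idfun idfun). Qed.

Lemma retract_prod X Y : retract X (X * Y)%type.
Proof.
have [i iE] : exists i : {linear X -> (X * Y)%type}, forall x, i x = (x, 0).
  by apply: mk_linear => c x x'; apply: pair_ext => //=; rewrite scaler0 addr0.
have [f fE] : exists f : {linear (X * Y)%type -> X}, forall w, f w = w.1 by apply: mk_linear.
by apply: (@retract_of_split _ _ i f) => x; rewrite fE iE.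
Qed.

Lemma retract_prod_row X n : retract (X * 'rV[A]_n)%type X.
Proof.
have [i iE] : exists i : {linear X -> (X * 'rV[A]_n)%type}, forall x, i x = (x, 0).
  by apply: mk_linear => c x x'; apply: pair_ext => //=; rewrite scaler0 addr0.
have [f fE] : exists f : {linear (X * 'rV[A]_n)%type -> X}, forall w, f w = w.1 by apply: mk_linear.
have [h hE] : exists h : {linear (X * 'rV[A]_n)%type -> 'rV[A]_n}, forall w, h w = w.2 by apply: mk_linear.
have [k kE] : exists k : {linear 'rV[A]_n -> (X * 'rV[A]_n)%type}, forall r, k r = (0, - r).
  by apply: mk_linear => c x x'; apply: pair_ext; rewrite /= ?scaler0 ?addr0 // scalerN opprD.
exists f, i, n, h, k => -[x r] /=; rewrite iE fE kE hE /=.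
by apply: pair_ext; rewrite /= ?subrr ?sub0r.
Qed.

(* Y is a syzygy of X up to a free summand. *)
Definition freeses Y X := exists p (u : {linear Y -> 'rV[A]_p}) (v : {linear 'rV[A]_p -> X}), ses u v.

Lemma freeses_exists X : fin_gen (full_smod X) -> exists Y : lmodType A, freeses Y X.
Proof.
move=> /fg_cover [p [v /ses_of_surj [u uv]]].
by exists (smod_type (ker_smod v)), p, u, v.
Qed.

Lemma retract_freeses_l Y X Y1 X1 : retract Y X -> freeses Y1 Y -> freeses X1 X -> retract Y1 X1.
Proof.
move=> [a [b [n [h [k hk]]]]] [p [uY [vY sY]]] [q [uX [vX sX]]].
have [avY avYE] := lin_comp a vY; have [bvX bvXE] := lin_comp b vX.
have [al alE] := row_lift avY (ses_surj sX); have [be beE] := row_lift bvX (ses_surj sY).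
have [ka kaE] := row_lift k (ses_surj sY).
have [al1 al1E] : exists f : {linear Y1 -> X1}, forall y, uX (f y) = al (uY y).
  have [f fE] := lin_comp al uY.
  have [|g gE] := @factor_inj _ _ _ _ uX f (ses_inj sX).
    by move=> y; have /(ses_ker sX) [x xE] : vX (f y) = 0; [rewrite fE alE avYE (ses_0 _ sY) linear0|exists x].
  by exists g => y; rewrite gE fE.
have [be1 be1E] : exists f : {linear X1 -> Y1}, forall y, uY (f y) = be (uX y).
  have [f fE] := lin_comp be uX.
  have [|g gE] := @factor_inj _ _ _ _ uY f (ses_inj sY).
    by move=> y; have /(ses_ker sY) [x xE] : vY (f y) = 0; [rewrite fE beE bvXE (ses_0 _ sX) linear0|exists x].
  by exists g => y; rewrite gE fE.
(* The map through which [b a - id] factors is lifted too. The corrected difference lands in [Y1],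
   so [be1 al1 - id] factors through the free module. *)
have [th0 th0E] : exists f : {linear 'rV[A]_p -> 'rV[A]_p}, forall x, f x = be (al x) - x - ka (h (vY x)).
  have [f1 f1E] := lin_comp be al; have [f2 f2E] := lin_sub f1 idfun.
  have [f3 f3E] := lin_comp h vY; have [f4 f4E] := lin_comp ka f3.
  by have [f5 f5E] := lin_sub f2 f4; exists f5 => x; rewrite f5E f4E f3E f2E f1E.
have [th thE] : exists f : {linear 'rV[A]_p -> Y1}, forall y, uY (f y) = th0 y.
  have [|g gE] := @factor_inj _ _ _ _ uY th0 (ses_inj sY); last by exists g.
  move=> x; have /(ses_ker sY) [y yE] : vY (th0 x) = 0; last by exists y.
  by rewrite th0E !linearB beE bvXE alE avYE kaE -hk /= subrr.
exists al1, be1, p, uY, th => y /=; apply: (ses_inj sY).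
by rewrite linearB thE th0E be1E al1E (ses_0 _ sY) !linear0 addr0.
Qed.
End Retracts.

(** * Growth of Tor along retracts and extensions *)

Section PresentationGrowth.
Variables (A : comNzRingType) (I : ideal A) (a : nat -> A) (r : nat).
Hypothesis aI : forall k, (k < r)%N -> I (a k).
Variable k : nat.
Implicit Types (X Y Z : lmodType A) (L : ideal A).

Definition pres_growth X := exists p (v : {linear 'rV[A]_p -> X}),
  (forall x, exists y, v y = x) /\ tor_growth aI (ker_smod v) k.

Lemma mul_smod_map L X Y (f : {linear X -> Y}) (N : submodule X) (N' : submodule Y) x :
  (forall x, N x -> N' (f x)) -> mul_smod L N x -> mul_smod L N' (f x).
Proof.
move=> fN; suff H : mul_smod L N <=s preim_smod f (mul_smod L N') by exact: H.
apply: mul_smod_ind => c y Lc Ny; change (mul_smod L N' (f (c *: y))).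
by rewrite linearZ; apply: mul_smodP => //; exact: fN.
Qed.

Lemma mul_smod_lift L X Y (f : {linear X -> Y}) (N : submodule X) (N' : submodule Y) y :
  (forall y, N' y -> exists2 x, N x & f x = y) -> mul_smod L N' y ->
  exists2 x, mul_smod L N x & f x = y.
Proof.
move=> fN; suff H : mul_smod L N' <=s imS f (mul_smod L N) by exact: H.
apply: mul_smod_ind => c _ Lc /fN [x Nx <-]; exists (c *: x); first exact: mul_smodP.
by rewrite linearZ.
Qed.

Lemma mul_smod_cap L X (N : submodule X) : mul_smod L N <=s capS (mul_smod L (full_smod X)) N.
Proof. by move=> x Lx; split; [apply: mul_smod_mono Lx|exact: mul_smod_le Lx]. Qed.

(** On the kernel of [vY] the lifts satisfy [x = be (al x) - th x] with [th] mapping into that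
    kernel, so [al] is injective on Tor quotients. For [X = Y] this compares two presentations. *)
Lemma growth_retract X Y p q (vX : {linear 'rV[A]_q -> X}) (vY : {linear 'rV[A]_p -> Y}) :
  (forall x, exists y, vX y = x) -> (forall x, exists y, vY y = x) -> retract Y X ->
  tor_growth aI (ker_smod vX) k -> tor_growth aI (ker_smod vY) k.
Proof.
move=> sX sY [f [b [n [h [l hl]]]]] [w [n0 [sw hw]]].
have [avY avYE] := lin_comp f vY; have [bvX bvXE] := lin_comp b vX.
have [al alE] := row_lift avY sX; have [be beE] := row_lift bvX sY.
have [ka kaE] := row_lift l sY.
have [th thE] : exists th : {linear 'rV[A]_p -> 'rV[A]_p}, forall x, th x = be (al x) - x - ka (h (vY x)).
  have [f1 f1E] := lin_comp be al; have [f2 f2E] := lin_sub f1 idfun.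
  have [f3 f3E] := lin_comp h vY; have [f4 f4E] := lin_comp ka f3.
  by have [f5 f5E] := lin_sub f2 f4; exists f5 => x; rewrite f5E f4E f3E f2E f1E.
have thK x : ker_smod vY (th x).
  by change (vY (th x) = 0); rewrite thE !linearB beE bvXE alE avYE kaE -hl /= subrr.
have alK x : ker_smod vY x -> ker_smod vX (al x).
  by move=> xK; change (vX (al x) = 0); rewrite alE avYE xK linear0.
have beK x : ker_smod vX x -> ker_smod vY (be x).
  by move=> xK; change (vY (be x) = 0); rewrite beE bvXE xK linear0.
exists w, n0; split => // j /hw [c hc cw]; exists c => //.
apply: (lenle_inj (f := al)) hc; last exact: mul_smod_cap.
  by move=> x [xF xK]; split; [exact: mul_smod_map xF|exact: alK].
move=> x [xF xK] /(mul_smod_map beK) h1.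
have -> : x = be (al x) - th x by rewrite thE xK !linear0 addr0 opprB addrC subrK.
by apply: smodB => //; apply: mul_smod_map xF.
Qed.

Lemma pres_growth_retract X Y : fin_gen (full_smod Y) -> retract Y X ->
  pres_growth X -> pres_growth Y.
Proof.
move=> /fg_cover [p [vY sY]] YX [q [vX [sX h]]]; exists p, vY; split => //.
exact: growth_retract sX sY YX h.
Qed.

Lemma pres_growth0 : pres_growth 'rV[A]_0.
Proof.
exists 0%N, idfun; split; first by move=> x; exists x.
exists 0, 0%N; rewrite size_poly0; split => // n _; exists 0%N; last by rewrite horner0.
apply: lenle0 => x _; rewrite [x](_ : x = 0); first exact: smod0.
by apply/rowP => -[].
Qed.
End PresentationGrowth.

Section Horseshoe.
Variables (A : comNzRingType) (X Y Z : lmodType A) (u : {linear X -> Y}) (v : {linear Y -> Z}).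
Variables (p q : nat) (vX : {linear 'rV[A]_p -> X}) (vZ : {linear 'rV[A]_q -> Z}).
Hypotheses (uv : ses u v) (sX : forall x, exists y, vX y = x) (sZ : forall x, exists y, vZ y = x).

Lemma horseshoe_cover : exists w : {linear 'rV[A]_(p + q) -> Y},
  [/\ forall x, exists y, w y = x, forall y, w (row_mx y 0) = u (vX y)
    & forall y, v (w y) = vZ (rsubmx y)].
Proof.
have [la laE] := row_lift vZ (ses_surj uv).
have [w wE] : exists w : {linear 'rV[A]_(p + q) -> Y}, forall y, w y = u (vX (lsubmx y)) + la (rsubmx y).
  have [lf lfE] : exists f : {linear 'rV[A]_(p + q) -> 'rV[A]_p}, forall x, f x = lsubmx x.
    by apply: mk_linear => c x y; exact: linearP.
  have [rf rfE] : exists f : {linear 'rV[A]_(p + q) -> 'rV[A]_q}, forall x, f x = rsubmx x.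
    by apply: mk_linear => c x y; exact: linearP.
  have [f1 f1E] := lin_comp vX lf; have [f2 f2E] := lin_comp u f1; have [f3 f3E] := lin_comp la rf.
  by have [f fE] := lin_add f2 f3; exists f => y; rewrite fE f2E f1E f3E lfE rfE.
exists w; split.
- move=> y; have [z zE] := sZ (v y).
  have [x xE] : exists x, u x = y - la z.
    by apply/(ses_ker uv); rewrite linearB laE zE subrr.
  have [x' x'E] := sX x; exists (row_mx x' z).
  by rewrite wE row_mxKl row_mxKr x'E xE subrK.
- by move=> y; rewrite wE row_mxKl row_mxKr linear0 addr0.
- by move=> y; rewrite wE linearD (ses_0 _ uv) add0r laE.
Qed.
End Horseshoe.

Section HorseshoeGrowth.
Variables (A : comNzRingType) (I : ideal A) (a : nat -> A) (r : nat).
Hypothesis aI : forall k, (k < r)%N -> I (a k).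
Variable k : nat.

(** [Tor_1] is exact in the middle: [T] is the part that vanishes in the Tor quotient of [Z], and
    the Tor quotient of [X] covers it. *)
Lemma pres_growth_mid (X Y Z : lmodType A) (u : {linear X -> Y}) (v : {linear Y -> Z}) :
  ses u v -> pres_growth aI k X -> pres_growth aI k Z -> pres_growth aI k Y.
Proof.
move=> uv [p [vX [sX [f [nf [sf hf]]]]]] [q [vZ [sZ [g [ng [sg hg]]]]]].
have [w [sw wX wZ]] := horseshoe_cover uv sX sZ.
exists (p + q)%N, w; split => //.
have [l lE] : exists l : {linear 'rV[A]_p -> 'rV[A]_(p + q)}, forall x, l x = row_mx x 0.
  by apply: mk_linear => c x y; rewrite scale_row_mx add_row_mx scaler0 addr0.
have [s sE] : exists s : {linear 'rV[A]_(p + q) -> 'rV[A]_q}, forall x, s x = rsubmx x.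
  by apply: mk_linear => c x y; exact: linearP.
have lK x : ker_smod vX x -> ker_smod w (l x).
  by move=> xK; change (w (l x) = 0); rewrite lE wX xK linear0.
have sK x : ker_smod w x -> ker_smod vZ (s x).
  by move=> xK; change (vZ (s x) = 0); rewrite sE -wZ xK linear0.
have sKs y : ker_smod vZ y -> exists2 x, ker_smod w x & s x = y.
  move=> yK; have [x xE] : exists x, u x = w (row_mx 0 y).
    by apply/(ses_ker uv); rewrite wZ row_mxKr.
  have [x' x'E] := sX x; exists (row_mx (- x') y); last by rewrite sE row_mxKr.
  change (w (row_mx (- x') y) = 0).
  have -> : row_mx (- x') y = row_mx 0 y - row_mx x' 0 by rewrite opp_row_mx add_row_mx oppr0 addr0 add0r.
  by rewrite linearB wX x'E xE subrr.
exists (f + g), (maxn nf ng); split.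
  by rewrite (leq_trans (size_polyD _ _)) // geq_max sf sg.
move=> n; rewrite geq_max => /andP [/hf [c hc cf] /hg [c' hc' cg]].
exists (c + c')%N; last by rewrite hornerD natrD lerD.
set L := ideal_pow I n in hc hc' *.
pose T := capS (capS (mul_smod L (full_smod _)) (ker_smod w)) (preim_smod s (mul_smod L (ker_smod vZ))).
have KT : mul_smod L (ker_smod w) <=s T.
  by move=> x Lx; split; [exact: mul_smod_cap|exact: mul_smod_map Lx].
apply: (@lenle_add _ _ _ T) => //; last by move=> x [].
- apply: (lenle_surj (f := l)) hc; last exact: mul_smod_cap.
    by move=> x; exact: mul_smod_map.
  move=> y [[yF yK] sy].
  have [z zK zE] := mul_smod_lift sKs sy.
  have zF : mul_smod L (full_smod _) z by case: (mul_smod_cap zK).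
  have rz : rsubmx (y - z) = 0 by rewrite linearB /= -!sE zE subrr.
  have yzE : y - z = l (lsubmx (y - z)) by rewrite lE -{1}[y - z]hsubmxK rz.
  exists (lsubmx (y - z)).
    split.
      apply/mul_smod_row => i; rewrite mxE.
      by have /mul_smod_row : mul_smod L (full_smod _) (y - z) by apply: smodB.
    apply: (lin_inj0 (ses_inj uv)); rewrite -wX -lE -yzE linearB yK.
    by have [_ ->] := mul_smod_cap zK; rewrite subrr.
  by rewrite -yzE opprB addrC subrK.
- apply: (lenle_inj (f := s)) hc'; last exact: mul_smod_cap.
    by move=> x [xF xK]; split; [exact: mul_smod_map xF|exact: sK].
  by move=> x hx sx; split.
Qed.
End HorseshoeGrowth.

(** * Closure under retracts, extensions and shifts *)

Section StableClosure.
Variables (A : comNzRingType) (C G : lmodType A -> Prop).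
Implicit Types X Y Z K W : lmodType A.
Hypotheses (C_fg : forall X, C X -> fin_gen (full_smod X))
  (C_extend : forall X Y Z (u : {linear X -> Y}) (v : {linear Y -> Z}), ses u v -> C Z ->
     forall p (f : {linear X -> 'rV[A]_p}), exists g : {linear Y -> 'rV[A]_p}, forall x, g (u x) = f x)
  (C_sub : forall X Y Z (u : {linear X -> Y}) (v : {linear Y -> Z}), ses u v -> C Y -> C Z -> C X)
  (C_mid : forall X Y Z (u : {linear X -> Y}) (v : {linear Y -> Z}), ses u v -> C X -> C Z -> C Y)
  (C_row : forall p, C 'rV[A]_p)
  (C_cosyzygy : forall X, C X -> exists Y, freeses X Y /\ C Y)
  (G_retract : forall X Y, C Y -> retract Y X -> G X -> G Y)
  (G_mid : forall X Y Z (u : {linear X -> Y}) (v : {linear Y -> Z}), ses u v -> G X -> G Z -> G Y).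

(** Maps into free modules extend along sequences with cokernel in [C]; this makes cosyzygies
    functorial up to free modules. *)
Lemma retract_freeses_r Y X Y1 X1 : C Y1 -> C X1 -> retract Y X ->
  freeses Y Y1 -> freeses X X1 -> retract Y1 X1.
Proof.
move=> CY1 CX1 [a [b [n [h [k hk]]]]] [p [uY [vY sY]]] [q [uX [vX sX]]].
have [uXa uXaE] := lin_comp uX a; have [uYb uYbE] := lin_comp uY b.
have [al alE] := C_extend sY CY1 uXa; have [be beE] := C_extend sX CX1 uYb.
have [eh ehE] := C_extend sY CY1 h.
have [vXal vXalE] := lin_comp vX al; have [vYbe vYbeE] := lin_comp vY be.
have [|al1 al1E] := ses_factor sY (f := vXal).
  by move=> y; rewrite vXalE alE uXaE (ses_0 _ sX).
have [|be1 be1E] := ses_factor sX (f := vYbe).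
  by move=> x; rewrite vYbeE beE uYbE (ses_0 _ sY).
have [th0 th0E] : exists f : {linear 'rV[A]_p -> 'rV[A]_p}, forall x, f x = be (al x) - x - uY (k (eh x)).
  have [f1 f1E] := lin_comp be al; have [f2 f2E] := lin_sub f1 idfun.
  have [f3 f3E] := lin_comp k eh; have [f4 f4E] := lin_comp uY f3.
  by have [f5 f5E] := lin_sub f2 f4; exists f5 => x; rewrite f5E f4E f3E f2E f1E.
have [|th thE] := ses_factor sY (f := th0).
  move=> y; rewrite th0E alE uXaE beE uYbE ehE -linearB -linearB /= -hk /=.
  by rewrite subrr linear0.
exists al1, be1, p, th, vY => z /=; have [y <-] := ses_surj sY z.
by rewrite thE th0E !linearB (ses_0 _ sY) subr0 al1E vXalE be1E vYbeE.
Qed.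

Lemma horseshoe X Y Z (u : {linear X -> Y}) (v : {linear Y -> Z}) X1 Z1 :
  ses u v -> freeses X1 X -> freeses Z1 Z ->
  exists Y1 (u1 : {linear X1 -> Y1}) (v1 : {linear Y1 -> Z1}), ses u1 v1 /\ freeses Y1 Y.
Proof.
move=> uv [p [kX [vX sX]]] [q [kZ [vZ sZ]]].
have [w [sw wX wZ]] := horseshoe_cover uv (ses_surj sX) (ses_surj sZ).
have [kY sY] := ses_of_surj sw.
have [l lE] : exists l : {linear 'rV[A]_p -> 'rV[A]_(p + q)}, forall x, l x = row_mx x 0.
  by apply: mk_linear => c x y; rewrite scale_row_mx add_row_mx scaler0 addr0.
have [s sE] : exists s : {linear 'rV[A]_(p + q) -> 'rV[A]_q}, forall x, s x = rsubmx x.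
  by apply: mk_linear => c x y; exact: linearP.
have [lX lXE] := lin_comp l kX; have [sY1 sY1E] := lin_comp s kY.
have [|u1 u1E] := @factor_inj _ _ _ _ kY lX (ses_inj sY).
  move=> x; have /(ses_ker sY) [y yE] : w (lX x) = 0; last by exists y.
  by rewrite lXE lE wX (ses_0 _ sX) linear0.
have [|v1 v1E] := @factor_inj _ _ _ _ kZ sY1 (ses_inj sZ).
  move=> y; have /(ses_ker sZ) [z zE] : vZ (sY1 y) = 0; last by exists z.
  by rewrite sY1E sE -wZ (ses_0 _ sY) linear0.
exists _, u1, v1; split; last by exists (p + q)%N, kY, w.
split.
- apply: lin_inj => x /(congr1 kY); rewrite u1E lXE lE linear0 => /(congr1 lsubmx).
  by rewrite row_mxKl linear0; exact: (lin_inj0 (ses_inj sX)).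
- move=> z; have [x xE] : exists x, u x = w (row_mx 0 (kZ z)).
    by apply/(ses_ker uv); rewrite wZ row_mxKr (ses_0 _ sZ).
  have [x' x'E] := ses_surj sX x.
  have /(ses_ker sY) [y yE] : w (row_mx 0 (kZ z) - row_mx x' 0) = 0.
    by rewrite linearB wX x'E xE subrr.
  exists y; apply: (ses_inj sZ); rewrite v1E sY1E sE yE linearB /= !row_mxKr subr0.
  by [].
- move=> y; split; last first.
    move=> [x <-]; apply: (lin_inj0 (ses_inj sZ)).
    by rewrite v1E sY1E sE u1E lXE lE row_mxKr.
  move=> /(congr1 kZ); rewrite v1E sY1E sE linear0 => ry.
  have yE : kY y = row_mx (lsubmx (kY y)) 0 by rewrite -ry hsubmxK.
  have /(ses_ker sX) [x xE] : vX (lsubmx (kY y)) = 0.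
    by apply: (lin_inj0 (ses_inj uv)); rewrite -wX -yE (ses_0 _ sY).
  by exists x; apply: (ses_inj sY); rewrite u1E lXE lE xE.
Qed.

(** [C_extend] extends the embedding of [X] in a free module to [Y]; combined with the embedding of
    [Z] it embeds [Y], with a cokernel that is an extension of [Z1] by [X1]. *)
Lemma dual_horseshoe X Y Z (u : {linear X -> Y}) (v : {linear Y -> Z}) X1 Z1 :
  ses u v -> C Z -> freeses X X1 -> freeses Z Z1 ->
  exists Y1 (u1 : {linear X1 -> Y1}) (v1 : {linear Y1 -> Z1}), ses u1 v1 /\ freeses Y Y1.
Proof.
move=> uv CZ [p [iX [vX sX]]] [q [iZ [vZ sZ]]].
have [ep epE] := C_extend uv CZ iX.
have [io ioE] : exists f : {linear Y -> 'rV[A]_(p + q)}, forall y, f y = row_mx (ep y) (iZ (v y)).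
  by apply: mk_linear => c x y; rewrite scale_row_mx add_row_mx -!linearP.
have [l lE] : exists l : {linear 'rV[A]_p -> 'rV[A]_(p + q)}, forall x, l x = row_mx x 0.
  by apply: mk_linear => c x y; rewrite scale_row_mx add_row_mx scaler0 addr0.
have [s sE] : exists s : {linear 'rV[A]_(p + q) -> 'rV[A]_q}, forall x, s x = rsubmx x.
  by apply: mk_linear => c x y; exact: linearP.
set N := im_smod io; pose pi : {linear 'rV[A]_(p + q) -> quot_mod N} := qpi N.
have pi0 w : pi w = 0 <-> exists y, io y = w by exact: qpi0P.
have sY : ses io pi.
  split; [|exact: qpi_surj|exact: pi0].
  apply: lin_inj => y; rewrite ioE => E.
  have /(lin_inj0 (ses_inj sZ)) /(ses_ker uv) [x xE] : iZ (v y) = 0.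
    by have := congr1 rsubmx E; rewrite row_mxKr linear0.
  rewrite -xE (_ : x = 0) ?linear0 //; apply: (lin_inj0 (ses_inj sX)).
  by have := congr1 lsubmx E; rewrite row_mxKl linear0 -xE epE.
have [pil pilE] := lin_comp pi l; have [vZs vZsE] := lin_comp vZ s.
have [|u1 u1E] := ses_factor sX (f := pil).
  by move=> x; rewrite pilE lE; apply/pi0; exists (u x); rewrite ioE epE (ses_0 _ uv) linear0.
have [|v1 v1E] := ses_factor sY (f := vZs).
  by move=> y; rewrite vZsE sE ioE row_mxKr (ses_0 _ sZ).
exists (quot_mod N), u1, v1; split; last by exists (p + q)%N, io, pi.
split.
- apply: lin_inj => x1; have [f <-] := ses_surj sX x1.
  rewrite u1E pilE lE => /pi0 [y]; rewrite ioE => /eq_row_mx [yf yv].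
  have /(ses_ker uv) [x xE] := lin_inj0 (ses_inj sZ) yv.
  by rewrite -yf -xE epE (ses_0 _ sX).
- move=> z; have [f <-] := ses_surj sZ z; exists (pi (row_mx 0 f)).
  by rewrite v1E vZsE sE row_mxKr.
- move=> w; have [f <-] := qpi_surj w; change (v1 (pi f) = 0 <-> exists x, u1 x = pi f).
  rewrite v1E vZsE sE; split.
    move=> /(ses_ker sZ) [z zE]; have [y yE] := ses_surj uv z.
    exists (vX (lsubmx f - ep y)); rewrite u1E pilE lE; apply/eqP; rewrite -subr_eq0 -linearB.
    apply/eqP/pi0; exists (- y); rewrite linearN ioE yE zE -{3}[f]hsubmxK.
    by rewrite opp_row_mx opp_row_mx add_row_mx sub0r [_ - ep y]addrC addrK.
  move=> [x]; have [f' <-] := ses_surj sX x; rewrite u1E pilE lE => E.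
  have /pi0 [y] : pi (f - row_mx f' 0) = 0 by rewrite linearB E subrr.
  rewrite ioE => /(congr1 rsubmx); rewrite linearB /= !row_mxKr subr0 => <-.
  exact: (ses_0 _ sZ).
Qed.

(* G holds at every module of C reached from X by n steps, each of which takes a
   syzygy or a cosyzygy. *)
Fixpoint orbit_in n X : Prop := if n is n'.+1 then
  forall Y, C Y -> freeses Y X \/ freeses X Y -> orbit_in n' Y else G X.

Lemma ex_syzygy X : C X -> exists Y, freeses Y X /\ C Y.
Proof.
move=> CX; have [Y YX] := freeses_exists (C_fg CX); exists Y; split => //.
by have [p [u [v uv]]] := YX; exact: C_sub uv (C_row p) CX.
Qed.

Lemma orbit_retract n X Y : C X -> C Y -> retract Y X -> orbit_in n X -> orbit_in n Y.
Proof.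
elim: n X Y => [|n IH] X Y CX CY YX; first exact: G_retract.
move=> hX Y1 CY1 [h|h].
  have [X1 [h' CX1]] := ex_syzygy CX.
  by apply: (IH X1) => //; [exact: retract_freeses_l YX h h'|apply: hX => //; left].
have [X1 [h' CX1]] := C_cosyzygy CX.
by apply: (IH X1) => //; [exact: retract_freeses_r YX h h'|apply: hX => //; right].
Qed.

(** A given syzygy or cosyzygy of [Y] is only a stable retract of the one produced by the horseshoe,
    so [orbit_retract] has to come first. *)
Lemma orbit_mid n X Y Z (u : {linear X -> Y}) (v : {linear Y -> Z}) :
  ses u v -> C X -> C Y -> C Z -> orbit_in n X -> orbit_in n Z -> orbit_in n Y.
Proof.
elim: n X Y Z u v => [|n IH] X Y Z u v uv CX CY CZ; first exact: G_mid uv.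
move=> hX hZ Y1 CY1 [h|h].
  have [X1 [h1 CX1]] := ex_syzygy CX; have [Z1 [h2 CZ1]] := ex_syzygy CZ.
  have [Y2 [u1 [v1 [s1 h3]]]] := horseshoe uv h1 h2.
  have CY2 : C Y2 by exact: C_mid s1 CX1 CZ1.
  apply: (orbit_retract CY2) => //; first exact: retract_freeses_l (retract_refl Y) h h3.
  by apply: (IH _ _ _ _ _ s1) => //; [apply: hX => //; left|apply: hZ => //; left].
have [X1 [h1 CX1]] := C_cosyzygy CX; have [Z1 [h2 CZ1]] := C_cosyzygy CZ.
have [Y2 [u1 [v1 [s1 h3]]]] := dual_horseshoe uv CZ h1 h2.
have CY2 : C Y2 by exact: C_mid s1 CX1 CZ1.
apply: (orbit_retract CY2) => //; first exact: retract_freeses_r (retract_refl Y) h h3.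
by apply: (IH _ _ _ _ _ s1) => //; [apply: hX => //; right|apply: hZ => //; right].
Qed.

Definition stably_in X := C X /\ forall n, orbit_in n X.

Lemma stably_in_retract X Y : C Y -> retract Y X -> stably_in X -> stably_in Y.
Proof. by move=> CY YX [CX h]; split => // n; exact: orbit_retract YX (h n). Qed.

Lemma stably_in_syzygy X Y : freeses Y X -> stably_in X -> stably_in Y.
Proof.
move=> h [CX hX]; have CY : C Y by have [p [u [v uv]]] := h; exact: C_sub uv (C_row p) CX.
by split => // n; apply: (hX n.+1) => //; left.
Qed.

Lemma stably_in_cosyzygy X Y : C Y -> freeses X Y -> stably_in X -> stably_in Y.
Proof. by move=> CY h [CX hX]; split => // n; apply: (hX n.+1) => //; right. Qed.

Section TwoOfThree.
Variables (X Y Z : lmodType A) (u : {linear X -> Y}) (v : {linear Y -> Z}).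
Hypotheses (uv : ses u v) (CX : C X) (CY : C Y) (CZ : C Z).

Lemma stably_in_mid : stably_in X -> stably_in Z -> stably_in Y.
Proof. by move=> [_ hX] [_ hZ]; split => // n; exact: orbit_mid uv CX CY CZ (hX n) (hZ n). Qed.

(* The pullback W of Y -> Z along a free cover G of Z is X (+) G, and it is
   also an extension of Y by the syzygy of Z. *)
Lemma rotate_ses K : freeses K Z ->
  exists W (f : {linear K -> W}) (g : {linear W -> Y}), [/\ ses f g, retract X W & retract W X].
Proof.
move=> [p [k [w kw]]].
have [la laE] := row_lift w (ses_surj uv).
pose W := (X * 'rV[A]_p)%type.
have [g gE] : exists g : {linear W -> Y}, forall x, g x = u x.1 + la x.2.
  by apply: mk_linear => c x y; rewrite /= !linearP /= scalerDr addrACA.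
have [k' k'E] : exists f : {linear K -> Y}, forall x, f x = - la (k x).
  have [f0 f0E] := lin_zero K Y; have [f1 f1E] := lin_comp la k; have [f fE] := lin_sub f0 f1.
  by exists f => x; rewrite fE f0E f1E sub0r.
have [|h hE] := @factor_inj _ _ _ _ u k' (ses_inj uv).
  move=> x; have /(ses_ker uv) [y yE] : v (k' x) = 0; last by exists y.
  by rewrite k'E linearN laE (ses_0 _ kw) oppr0.
have [f fE] : exists f : {linear K -> W}, forall x, f x = (h x, k x).
  by apply: mk_linear => c x y; apply: pair_ext => /=; rewrite linearP.
exists W, f, g; split; [|exact: retract_prod|exact: retract_prod_row].
split.
- by apply: lin_inj => x; rewrite fE => -[_ /(lin_inj0 (ses_inj kw))].
- move=> y; have [r rE] := ses_surj kw (v y).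
  have /(ses_ker uv) [x xE] : v (y - la r) = 0 by rewrite linearB laE rE subrr.
  by exists (x, r); rewrite gE /= xE subrK.
- move=> [x r]; rewrite gE /=; split; last first.
    by move=> [z]; rewrite fE => -[<- <-]; rewrite hE k'E addNr.
  move=> E; have /(ses_ker kw) [z zE] : w r = 0.
    by rewrite -laE; have := congr1 v E; rewrite linearD (ses_0 _ uv) add0r linear0.
  exists z; rewrite fE zE; congr (_, _); apply: (ses_inj uv); rewrite hE k'E zE.
  by apply/eqP; rewrite eq_sym -addr_eq0 E.
Qed.
End TwoOfThree.

(** Rotation turns the first term into the middle one: [X] is a retract of an extension [W] of [Y]
    by a syzygy of [Z]. *)
Lemma stably_in_sub X Y Z (u : {linear X -> Y}) (v : {linear Y -> Z}) :
  ses u v -> C X -> stably_in Y -> stably_in Z -> stably_in X.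
Proof.
move=> uv CX hY hZ; have [K [h CK]] := ex_syzygy hZ.1.
have [W [f [g [fg XW _]]]] := rotate_ses uv h.
apply: stably_in_retract XW _ => //; apply: (stably_in_mid fg) => //.
- exact: C_mid fg CK hY.1.
- exact: hY.1.
- exact: stably_in_syzygy h hZ.
Qed.

(** After rotation a syzygy [K] of [Z] is the first term, and [Z] is recovered as a cosyzygy of
    [K]. *)
Lemma stably_in_quot X Y Z (u : {linear X -> Y}) (v : {linear Y -> Z}) :
  ses u v -> C Z -> stably_in X -> stably_in Y -> stably_in Z.
Proof.
move=> uv CZ hX hY; have [K [h CK]] := ex_syzygy CZ.
have [W [f [g [fg _ WX]]]] := rotate_ses uv h.
apply: (stably_in_cosyzygy CZ h); apply: (stably_in_sub fg) => //.
by apply: stably_in_retract WX hX; exact: C_mid fg CK hY.1.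
Qed.
End StableClosure.

Section MinimalCovers.
Variables (A : comNzRingType) (m : ideal A).
Hypotheses (A_noeth : noetherian A) (A_local : local_ring m).

(** A relation with a unit coefficient would express one generator by the others, so a cover of
    least rank is minimal. *)
Lemma ex_min_cover (X : lmodType A) : fin_gen (full_smod X) -> exists c : min_cover m X, True.
Proof.
move=> fgX.
pose P p := `[< exists v : {linear 'rV[A]_p -> X}, forall x, exists y, v y = x >].
have ex : exists p, P p by have [p [v vs]] := fg_cover fgX; exists p; apply/asboolP; exists v.
case: (ex_minnP ex) => p /asboolP [v vs] pmin.
suff vm w : v w = 0 -> forall i, m (w 0 i) by exists (MinCover vs vm).
move=> vw i; apply: contrapT => /(local_unit A_noeth A_local) [b bE].
case: p => [|p] in v vs pmin w vw i b bE *; first by case: i bE.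
have [f [fE _]] := lin_row (fun j => v (delta_mx 0 (lift i j))).
suff /pmin : P p by rewrite ltnn.
apply/asboolP; exists f => x; have [z zE] := vs x.
pose z' := z - (z 0 i * b) *: w.
have z'i : z' 0 i = 0 by rewrite !mxE -mulrA bE mulr1 subrr.
exists (\row_j z' 0 (lift i j)); rewrite -zE fE.
have -> : v z = v z' by rewrite linearB linearZ_LR vw scaler0 subr0.
rewrite [in RHS](row_sum_delta z') linear_sum (bigD1_ord i) //= z'i scale0r linear0 add0r.
by apply: eq_bigr => j _; rewrite mxE linearZ.
Qed.
End MinimalCovers.

Section ModIso.
Variable A : comNzRingType.
Implicit Types X Y Z : lmodType A.

Lemma mod_iso_linear X Y : mod_iso X Y ->
  exists (f : {linear X -> Y}) (g : {linear Y -> X}), cancel f g /\ cancel g f.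
Proof.
move=> [f [g fg gf]]; have [h hE] : exists h : {linear Y -> X}, forall y, h y = g y.
  by apply: mk_linear => c x y; apply: (can_inj fg); rewrite linearP !gf.
by exists f, h; split => x; rewrite hE.
Qed.

Lemma mod_iso_sym X Y : mod_iso X Y -> mod_iso Y X.
Proof. by move=> /mod_iso_linear [f [g [fg gf]]]; exists g; exists f. Qed.

Lemma mod_iso_refl X : mod_iso X X.
Proof. by exists idfun; exists idfun. Qed.

Lemma freeses_iso_l X Y Z : mod_iso Y X -> freeses X Z -> freeses Y Z.
Proof.
move=> /mod_iso_linear [f [g [fg gf]]] [p [u [v uv]]]; have [h hE] := lin_comp u f.
exists p, h, v; split.
- by move=> x y; rewrite !hE => /(ses_inj uv) /(can_inj fg).
- exact: (ses_surj uv).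
- move=> y; rewrite (ses_ker uv); split=> -[x xE].
    by exists (g x); rewrite hE gf.
  by exists (f x); rewrite -hE.
Qed.

Lemma freeses_iso_r X Y Z : mod_iso Z Y -> freeses X Y -> freeses X Z.
Proof.
move=> /mod_iso_linear [f [g [fg gf]]] [p [u [v uv]]]; have [h hE] := lin_comp g v.
exists p, u, h; split.
- exact: (ses_inj uv).
- by move=> z; have [y yE] := ses_surj uv (f z); exists y; rewrite hE yE fg.
- move=> y; rewrite -(ses_ker uv) hE; split=> [|->]; last exact: linear0.
  by move=> E; apply: (can_inj gf); rewrite E linear0.
Qed.

Lemma freeses_syz m X (c : min_cover m X) : freeses (syz c) X.
Proof.
have [u uv] := ses_of_surj (cover_surj c).
by exists (cover_rank c), u, (cover_map c).
Qed.
End ModIso.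

(** * Thick subcategories and short exact sequences *)

Section Thick.
Variables (A : comNzRingType) (m : ideal A) (C G : lmodType A -> Prop).
Implicit Types X Y Z K W : lmodType A.
Hypotheses (A_noeth : noetherian A) (A_local : local_ring m)
  (C_fg : forall X, C X -> fin_gen (full_smod X))
  (C_extend : forall X Y Z (u : {linear X -> Y}) (v : {linear Y -> Z}), ses u v -> C Z ->
     forall p (f : {linear X -> 'rV[A]_p}), exists g : {linear Y -> 'rV[A]_p}, forall x, g (u x) = f x)
  (C_sub : forall X Y Z (u : {linear X -> Y}) (v : {linear Y -> Z}), ses u v -> C Y -> C Z -> C X)
  (C_mid : forall X Y Z (u : {linear X -> Y}) (v : {linear Y -> Z}), ses u v -> C X -> C Z -> C Y)
  (C_row : forall p, C 'rV[A]_p)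
  (C_dual : forall X, C X -> C (dual X))
  (C_cosyz : forall X (c : min_cover m (dual X)), C X ->
     exists (u : {linear X -> 'rV[A]_(cover_rank c)}) (v : {linear 'rV[A]_(cover_rank c) -> cosyz c}),
     [/\ ses u v, forall x, u x = cosyz_in c x & C (cosyz c)])
  (C_MCM : forall X, MCM m X <-> C X)
  (G_retract : forall X Y, C Y -> retract Y X -> G X -> G Y)
  (G_mid : forall X Y Z (u : {linear X -> Y}) (v : {linear Y -> Z}), ses u v -> G X -> G Z -> G Y)
  (G0 : G 'rV[A]_0).

Lemma C_iso X Y : mod_iso Y X -> C X -> C Y.
Proof.
move=> /mod_iso_linear [f [g [fg gf]]] CX; have [z zE] := lin_zero X 'rV[A]_0.
apply: (C_sub (u := f) (v := z)) => //; split.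
- exact: can_inj fg.
- by move=> w; exists 0; rewrite zE; apply/rowP => -[].
- by move=> x; split=> [_|_]; [exists (g x)|rewrite zE].
Qed.

Lemma C_cosyzygy X : C X -> exists Y, freeses X Y /\ C Y.
Proof.
move=> CX; have [c _] := ex_min_cover A_noeth A_local (C_fg (C_dual CX)).
have [u [v [uv _ CY]]] := C_cosyz c CX; exists (cosyz c); split => //.
by exists (cover_rank c), u, v.
Qed.

Local Notation P := (stably_in C G).
Let P_retract := stably_in_retract C_fg C_extend C_sub C_row C_cosyzygy G_retract.
Let P_syzygy := stably_in_syzygy C_sub C_row (G := G).

Lemma orbit_in0 n : orbit_in C G n 'rV[A]_0.
Proof.
have h0 : freeses 'rV[A]_0 'rV[A]_0.
  have [z zE] := lin_zero 'rV[A]_0 'rV[A]_0.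
  have E (x y : 'rV[A]_0) : x = y by apply/rowP => -[].
  exists 0%N, z, z; split=> //.
    by move=> x; exists 0; exact: E.
  by move=> y; split=> _; [exists 0; exact: E|exact: E].
elim: n => [|n IH] //= Y CY h.
apply: (orbit_retract C_fg C_extend C_sub C_row C_cosyzygy G_retract (C_row 0) CY _ IH).
case: h => h; first exact: retract_freeses_l (retract_refl _) h h0.
exact: (retract_freeses_r C_extend CY (C_row 0) (retract_refl _) h h0).
Qed.

Lemma stable_iso_stably_in X Y (f : {linear X -> Y}) : stable_iso f -> C X -> C Y ->
  (P X <-> P Y).
Proof.
move=> [g [gf fg]] CX CY; split; apply: P_retract => //.
  by exists g, f.
by exists f, g.
Qed.

(** The relations of the pushout say that the sum of [Y] and the free module maps onto [Z] with
    kernel [X]; injectivity comes from the cosyzygy embedding. *)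
Lemma standard_triangle_ses X Y Z (c : min_cover m (dual X)) (f : {linear X -> Y})
    (g : {linear Y -> Z}) (h : {linear Z -> cosyz c}) : C X -> standard_triangle f g h ->
  exists (u : {linear X -> (Y * 'rV[A]_(cover_rank c))%type})
    (v : {linear (Y * 'rV[A]_(cover_rank c))%type -> Z}), ses u v.
Proof.
move=> CX [j [js jk _ _]]; have [i [i2 [ij iE _]]] := C_cosyz c CX.
have [u uE] : exists u : {linear X -> (Y * 'rV[A]_(cover_rank c))%type}, forall x, u x = (f x, - i x).
  apply: mk_linear => a x y; apply: pair_ext => /=; first by rewrite linearP.
  by rewrite linearP opprD scalerN.
have [v vE] : exists v : {linear (Y * 'rV[A]_(cover_rank c))%type -> Z}, forall w, v w = g w.1 + j w.2.
  by apply: mk_linear => a x y; rewrite /= !linearP /= scalerDr addrACA.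
exists u, v; split.
- by move=> x y; rewrite !uE => E; apply: (ses_inj ij); apply: oppr_inj; exact: (congr1 snd E).
- by move=> z; have [y [r ->]] := js z; exists (y, r); rewrite vE.
- move=> [y r]; rewrite vE jk; split=> -[x].
    by move=> [/= -> ->]; exists x; rewrite uE iE.
  by rewrite uE iE => -[<- <-]; exists x.
Qed.

Theorem stably_in_thick : thick_subcat m P.
Proof.
have CM X : P X -> MCM m X by move=> [CX _]; apply/C_MCM.
split => //.
- by split => // n; exact: orbit_in0.
- by move=> X Y f /C_MCM CY hf hX; apply/(stable_iso_stably_in hf hX.1 CY).
- by move=> X Y [c h]; apply: P_syzygy; apply: freeses_iso_l h _; exact: freeses_syz.
- move=> X Y [c h] hX; have [u [v [uv _ CY]]] := C_cosyz c hX.1.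
  apply: (stably_in_cosyzygy (C_iso h CY) _ hX); apply: freeses_iso_r h _.
  by exists (cover_rank c), u, v.
- move=> X Y Z c u v w /C_MCM CX /C_MCM CY /C_MCM CZ.
  move=> [X' [Y' [Z' [c' [f [g [h [a [b [e [sa [[hX' hY' hZ'] [tri _] [ia ib ie] _]]]]]]]]]]]].
  have CX' : C X' by apply/C_MCM.
  have CY' : C Y' by apply/C_MCM.
  have CZ' : C Z' by apply/C_MCM.
  have [i [q iq]] := standard_triangle_ses CX' tri.
  have CW : C (Y' * 'rV[A]_(cover_rank c'))%type by exact: C_mid iq CX' CZ'.
  have hX := stable_iso_stably_in ia CX CX'; have hY := stable_iso_stably_in ib CY CY'.
  have hZ := stable_iso_stably_in ie CZ CZ'.
  have hW : P Y' -> P (Y' * 'rV[A]_(cover_rank c'))%type.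
    by apply: P_retract => //; exact: retract_prod_row.
  split.
  + move=> /hX PX /hY /hW PY; apply/hZ.
    exact: (stably_in_quot C_fg C_extend C_sub C_mid C_row C_cosyzygy G_retract G_mid iq).
  + move=> /hY /hW PY /hZ PZ; apply/hX.
    exact: (stably_in_sub C_fg C_extend C_sub C_mid C_row C_cosyzygy G_retract G_mid iq).
  + move=> /hX PX /hZ PZ; apply/hY; apply: (P_retract CY' (retract_prod _ 'rV[A]_(cover_rank c'))).
    exact: (stably_in_mid C_fg C_extend C_sub C_mid C_row C_cosyzygy G_retract G_mid iq).
- by move=> X Y /C_MCM CX _; apply: P_retract => //; exact: retract_prod.
Qed.

Lemma Omega_C E s N : C E -> is_Omega m s E N -> C N.
Proof.
move=> CE; case: s => k.
  elim: k N => [|k IH] N; first by move=> /mod_iso_sym h; exact: C_iso h CE.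
  move=> [K /IH CK [c h]]; apply: C_iso h _.
  by have [p [u [v uv]]] := freeses_syz c; exact: C_sub uv (C_row p) CK.
elim: k N => [|k IH] N [K hK [c h]]; apply: C_iso h _.
  by have [u [v []]] := C_cosyz c (C_iso (mod_iso_sym hK) CE).
by have [u [v []]] := C_cosyz c (IH _ hK).
Qed.

Lemma Omega_syz E s X : C E -> is_Omega m s E X -> exists s' K, is_Omega m s' E K /\ freeses K X.
Proof.
move=> CE hX; have CX := Omega_C CE hX; case: s hX => k hX.
  have [c _] := ex_min_cover A_noeth A_local (C_fg CX).
  exists (Posz k.+1), (syz c); split; last exact: freeses_syz.
  by exists X => //; exists c; exact: mod_iso_refl.
have [K hK [c h]] := hX.
(* [Negz k] is the shift by [-k - 1], so the next one up is [Negz k'], or the shift 0 when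
   [k = 0]. *)
exists (if k is k'.+1 then Negz k' else 0), K; have hK' : is_Omega m (if k is k'.+1 then Negz k' else 0) E K.
  by case: k hX hK.
split => //; have [u [v [uv _ _]]] := C_cosyz c (Omega_C CE hK').
by apply: freeses_iso_r h _; exists (cover_rank c), u, v.
Qed.

Lemma Omega_cosyz E s X : C E -> is_Omega m s E X -> exists s' K, is_Omega m s' E K /\ freeses X K.
Proof.
move=> CE hX; have CX := Omega_C CE hX.
have [c _] := ex_min_cover A_noeth A_local (C_fg (C_dual CX)).
have [u [v [uv _ _]]] := C_cosyz c CX.
have hc : freeses X (cosyz c) by exists (cover_rank c), u, v.
have hcos : is_cosyz m X (cosyz c) by exists c; exact: mod_iso_refl.
case: s hX => -[|k] hX.
- by exists (Negz 0), (cosyz c); split => //; exists X.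
- have [K hK [c' h]] := hX; exists (Posz k), K; split => //.
  by apply: freeses_iso_l h _; exact: freeses_syz.
- by exists (Negz 1), (cosyz c); split => //; exists X.
- by exists (Negz k.+2), (cosyz c); split => //; exists X.
Qed.

(** Orbits use arbitrary covers while [is_Omega] uses minimal ones. They agree up to stable
    retracts, so the induction runs over retracts [X] of the modules [Omega^s E]. *)
Lemma stably_in_Omega E : C E -> (forall s N, is_Omega m s E N -> C N -> G N) -> P E.
Proof.
move=> CE GE; split => // n.
suff main s O X : is_Omega m s E O -> C X -> retract X O -> orbit_in C G n X.
  by apply: (main 0 E) => //; [exact: mod_iso_refl|exact: retract_refl].
elim: n s O X => [|n IH] s O X hO CX XO; have CO := Omega_C CE hO.
  exact: (G_retract CX XO (GE _ _ hO CO)).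
move=> Y CY [h|h].
  have [s' [K [hK KO]]] := Omega_syz CE hO.
  by apply: (IH s' K) => //; exact: retract_freeses_l XO h KO.
have [s' [K [hK OK]]] := Omega_cosyz CE hO.
apply: (IH s' K) => //; exact: (retract_freeses_r C_extend CY (Omega_C CE hK) XO h OK).
Qed.
End Thick.

Lemma int_sup_le (S : set int) (b : int) : (forall n, S n -> n <= b) -> (int_sup S <= b%:E)%E.
Proof.
move=> hb; rewrite /int_sup; case: xgetP => [y _ [_ ymin]|none].
  by apply: ymin => n /hb; rewrite lee_fin.
exfalso; case: (pselect (exists n, S n)) => [[n0 Sn0]|noS]; last first.
  apply: (none -oo%E); split => [n Sn|v _]; last exact: leNye.
  by case: noS; exists n.
(* An element of [S] at least distance below [b] is the maximum of [S], so a supremum exists and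
   [xget] does not return its default. *)
pose Q k := `[< exists2 n, S n & b - n = k%:Z >].
have ex : exists k, Q k.
  exists `|b - n0|%N; apply/asboolP; exists n0 => //; have := hb _ Sn0; lia.
case: (ex_minnP ex) => k /asboolP [n Sn nk] kmin.
apply: (none n%:E); split => [n' Sn'|v]; last by apply.
rewrite lee_fin leNgt; apply/negP => nn'.
have : (k <= `|b - n'|)%N.
  by apply: kmin; apply/asboolP; exists n' => //; have := hb _ Sn'; lia.
have := hb _ Sn'; lia.
Qed.

Lemma int_sup_ge (S : set int) (b n : int) : (int_sup S <= b%:E)%E -> S n -> n <= b.
Proof.
rewrite /int_sup; case: xgetP => [y _ [yub _] yb|_]; last by [].
by move=> /yub ny; rewrite -lee_fin; exact: le_trans ny yb.
Qed.

(** * Closure properties of totally reflexive modules *)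

Section GorensteinClass.
Variables (A : comNzRingType) (m : ideal A).
Hypothesis A_noeth : noetherian A.
Variables (J : nat -> lmodType A) (e : {linear A^o -> J 0})
  (dJ : forall i, {linear J i -> J i.+1}) (n0 : nat).
Hypotheses (J_inj : forall i, injective_module (J i))
  (J_zero : forall i, (n0 < i)%N -> is_zero (J i)) (e_inj : injective e)
  (J_exact0 : smod_eq (ker_smod (dJ 0)) (im_smod e))
  (J_exact : forall i, smod_eq (ker_smod (dJ i.+1)) (im_smod (dJ i))).
Implicit Types X Y Z : lmodType A.
Local Notation C := (totrefl dJ).

Lemma totrefl_row p : C 'rV[A]_p.
Proof. by split=> [|j]; [exact: fin_gen_row|exact: noext_row]. Qed.

Lemma totrefl_mid X Y Z (u : {linear X -> Y}) (v : {linear Y -> Z}) : ses u v -> C X -> C Z -> C Y.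
Proof.
move=> uv [fgX hX] [fgZ hZ]; split; last by move=> j; apply: (noext_mid J_inj J_exact uv).
have [p [vX sX]] := fg_cover fgX; have [q [vZ sZ]] := fg_cover fgZ.
have [w [sw _ _]] := horseshoe_cover uv sX sZ.
exact: fin_gen_surj sw (fin_gen_row A _).
Qed.

Lemma totrefl_sub X Y Z (u : {linear X -> Y}) (v : {linear Y -> Z}) : ses u v -> C Y -> C Z -> C X.
Proof. by move=> uv [fgY hY]; apply: (totrefl_ker A_noeth J_inj J_exact uv). Qed.

Lemma totrefl_extend X Y Z (u : {linear X -> Y}) (v : {linear Y -> Z}) : ses u v -> C Z ->
  forall p (f : {linear X -> 'rV[A]_p}), exists g : {linear Y -> 'rV[A]_p}, forall x, g (u x) = f x.
Proof.
move=> uv [_ hZ] p f.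
have /choice [g gE] (i : 'I_p) : exists g : {linear Y -> A^o}, forall x, g (u x) = f x 0 i.
  have [c cE] : exists c : {linear X -> A^o}, forall x, c x = f x 0 i.
    by apply: mk_linear => a x y; rewrite linearP !mxE.
  have [g gE] := hom_extend J_inj e_inj J_exact0 J_exact uv c (hZ 0%N).
  by exists g => x; rewrite gE.
have [h hE] : exists h : {linear Y -> 'rV[A]_p}, forall y, h y = \row_i g i y.
  by apply: mk_linear => a x y; apply/rowP => i; rewrite !mxE linearP.
by exists h => x; apply/rowP => i; rewrite hE mxE gE.
Qed.

Lemma totrefl_cosyz X (c : min_cover m (dual X)) : C X ->
  exists (u : {linear X -> 'rV[A]_(cover_rank c)}) (v : {linear 'rV[A]_(cover_rank c) -> cosyz c}),
  [/\ ses u v, forall x, u x = cosyz_in c x & C (cosyz c)].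
Proof.
move=> CX; have [k kc] := ses_of_surj (cover_surj c).
have [u [v [uv CY uE _]]] := cosyzygy_ses A_noeth J_inj J_zero e_inj J_exact0 J_exact CX kc.
by exists u, v.
Qed.
End GorensteinClass.

Theorem theoremV (A : comNzRingType) (m : ideal A) (d : nat) (I : ideal A)
    (A_noetherian : noetherian A) (A_local : local_ring m)
    (A_gorenstein : gorenstein A) (A_nonregular : ~ regular_local m)
    (dim_A : krull_dim A d) (d_ge1 : (1 <= d)%N)
    (I_primary : primary_to m I) :
  exists eta : int,
    forall (E : lmodType A) (q : nat),
      MCM m E -> (1 <= q)%N ->
      (r_infty m I E <= (d%:Z - q%:Z)%:E)%E ->
      forall M : lmodType A, MCM m M -> thick m E M ->
        (\big[maxe/-oo]_(d.+1 - q <= i < d.+1) a_inv (assoc_gm I M) i <= eta%:E)%E.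
Proof.
have [s sE] := (fin_genP I).1 (A_noetherian I).
pose a : nat -> A := nth (0 : A^o) s; pose r := size s.
have Ia (N : ideal A) : (forall k, (k < r)%N -> N (a k)) -> I <=s N.
  move=> Na; rewrite sE; apply: span_le => x /= xs.
  by rewrite -(nth_index 0 xs); apply: Na; rewrite index_mem.
(* Beyond [r] the sequence takes the default value 0, so membership holds for every [k], as [totops]
   asks. *)
have aI k : I (a k).
  case: (ltnP k r) => kr; last by rewrite /a nth_default //; exact: smod0.
  by rewrite sE; apply: span_mem; exact: mem_nth.
pose aIr k (_ : (k < r)%N) : I (a k) := aI k.
have [eta eta_lvan] := lvan_ring A_noetherian aIr Ia.
exists eta%:Z => E q mcmE q_ge1 rE M mcmM thickM.
(* The bound [d - q] on degrees is the bound [k] on sizes of the Tor polynomials; [k] is also the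
   lowest index in the maximum. *)
pose k := (d.+1 - q)%N.
suff main i n : (k <= i)%N -> (eta <= n)%N ->
    lvan (adic aIr (full_smod M))
         (gshift (adic aIr (full_smod M))) i n.
  rewrite big_nat_cond; apply: (big_ind (fun x => x <= eta%:Z%:E)%E).
  - exact: leNye.
  - by move=> x y hx hy; rewrite ge_max hx hy.
  (* Negative degrees lie below [eta], which is a natural number. *)
  move=> i /andP [/andP [ki _] _]; apply: int_sup_le => -[n|//].
  rewrite lez_nat leqNgt => hn; apply/negP => en.
  exact: (lvan_loc_coh A_noetherian Ia (main i n ki (ltnW en))).
case: (pselect (is_zero M)) => [M0 _ _|nzM ki en].
  by apply: van_triv => n' x _ _; rewrite (M0 x); exact: smod0.
have [n0 [J [e [dJ [J_inj J_zero e_inj J_exact0 J_exact]]]]] := A_gorenstein.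
(* Here the nonzero module [M] witnesses that [A] has depth [d]. *)
have C_MCM := MCM_totrefl A_noetherian A_local dim_A J_inj J_zero e_inj J_exact0 J_exact mcmM nzM.
pose C := totrefl dJ; pose G := pres_growth aIr k.
have C_fg X : C X -> fin_gen (full_smod X) by case.
have C_sub := totrefl_sub A_noetherian J_inj J_exact.
have C_mid := totrefl_mid J_inj J_exact.
have C_row := totrefl_row J_exact.
have C_extend := totrefl_extend J_inj e_inj J_exact0 J_exact.
have C_dual X : C X -> C (dual X) := totrefl_dual A_noetherian J_inj J_zero e_inj J_exact0 J_exact (X := X).
have C_cosyz := totrefl_cosyz (m := m) A_noetherian J_inj J_zero e_inj J_exact0 J_exact.
have G_retract X Y : C Y -> retract Y X -> G X -> G Y.
  by move=> /C_fg; exact: pres_growth_retract.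
have G_mid (X Y Z : lmodType A) (u : {linear X -> Y}) (v : {linear Y -> Z}) : ses u v -> G X -> G Z -> G Y.
  exact: pres_growth_mid.
have PE : stably_in C G E.
  apply: (stably_in_Omega A_noetherian A_local C_fg C_extend C_sub C_row C_dual C_cosyz G_retract).
    exact/C_MCM.
  move=> t N EN CN; apply: (r1_growth A_noetherian A_local I_primary aIr Ia (C_fg _ CN)) => x hx.
  have := int_sup_ge rE (ex_intro _ t (ex_intro _ N (conj EN hx))).
  rewrite /k; lia.
have PM : stably_in C G M.
  apply: thickM PE.
  apply: (stably_in_thick A_noetherian A_local C_fg C_extend C_sub C_mid C_row C_dual C_cosyz C_MCM) => //.
  exact: pres_growth0.
(* Members of [stably_in C G] have the growth bound, by orbits of 0 steps, and their syzygies are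
   members again, as the iteration requires. *)
apply: (lvan_bound A_noetherian A_local I_primary Ia (k := k) _ eta_lvan PM) => // X [CX hX].
have [p [v [vs vg]]] := hX 0%N; exists p, v; split => //.
have [u uv] := ses_of_surj vs.
by apply: (stably_in_syzygy C_sub C_row (X := X)) => //; exists p, u, v.
Qed.
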